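(* Let $X,Y$ be real nonzero Banach spaces, $S:X\rightrightarrows X^*$ and $T:Y\rightrightarrows Y^*$ maximal monotone operators of Gossez type (D) with strong representative functions $h_S$ and $h_T$, and $A:X\to Y$ linear continuous with $\big(\operatorname{dom}h_T\times\operatorname{pr}_{X^*}(\operatorname{dom}h_S)\big)\cap\big(\operatorname{im}A\times\Delta_{Y^*}^{A^*}\big)\neq\emptyset$. Assume one of: (a) $(0,0,0)\in{}^{ic}\big(\operatorname{dom}h_T\times\operatorname{pr}_{X^*}(\operatorname{dom}h_S)-\operatorname{im}A\times\Delta_{Y^*}^{A^*}\big)$; (b) the set $\{(u^*,A^*v^*,A^{**}u^{**}+v^{**},r): r\in\mathbb R,\ h_S^*(u^*,u^{**})+h_T^*(v^*,v^{**})\le r\}$ is closed regarding $\Delta_{X^*}\times\operatorname{im}A^{**}\times\mathbb R$ in $(X^*,w^* )\times(X^*,w^* )\times(Y^{**},w^* )\times\mathbb R$. Then $h:=\operatorname{cl}_{\|\cdot\|\times\|\cdot\|_*}(h_S\bigcirc_1^A h_T)$ is a strong representative function of $\overline S\|_A\overline T$, and $\overline S\|_A\overline T$ is a maximal monotone operator of Gossez type (D).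
   Context: $X$ is identified with its canonical image in $X^{**}$ (same for $Y$). For an operator $M$, $G(M)$ is its graph and $M^{-1}$ the operator with inverse graph. Coupling $c(x,x^* )=\langle x^*,x\rangle$. Conjugate of $h:X\times X^*\to\overline{\mathbb R}$: $h^*(x^*,x^{**})=\sup_{(x,y^* )}\{\langle x^*,x\rangle+\langle x^{**},y^*\rangle-h(x,y^* )\}$ on $X^*\times X^{**}$. A representative function of a monotone $S$ is a convex, norm-lower semicontinuous $h_S:X\times X^*\to\overline{\mathbb R}$ with $h_S\ge c$ and $G(S)\subseteq\{(x,x^* ):h_S(x,x^* )=\langle x^*,x\rangle\}$; it is strong if moreover $h_S^*(x^*,x^{**})\ge\langle x^{**},x^*\rangle$ for all $(x^*,x^{**})$. Gossez's monotone closure $\overline S:X^{**}\rightrightarrows X^*$ has graph $\{(x^{**},x^* ):\langle x^{**}-y,x^*-y^*\rangle\ge0\ \forall(y,y^* )\in G(S)\}$; a maximal monotone $S$ is of Gossez type (D) if each $(x^{**},x^* )\in G(\overline S)$ is the $w^*\times\|\cdot\|_*$-limit of a bounded net in $G(S)$. $A^*,A^{**}$ are adjoint and biadjoint; $\operatorname{im}A=A(X)$; $\Delta_{X^*}=\{(x^*,x^* )\}$; $\Delta_{Y^*}^{A^*}=\{(y^*,A^*y^* ):y^*\in Y^*\}$; $\operatorname{pr}_{X^*}$ projection. $(h_S\bigcirc_1^A h_T)(x,x^* )=\inf\{h_S(u,x^* )+h_T(Aw,v^* ):u,w\in X,\ v^*\in Y^*,\ u+w=x,\ A^*v^*=x^*\}$.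 The extended generalized parallel sum is $\overline S\|_A\overline T:X\rightrightarrows X^*$, $\overline S\|_A\overline T(x)=(\overline S^{-1}+(A^*\overline TA^{**})^{-1})^{-1}(x)$ for $x\in X$. A set $D$ is closed regarding $W$ if $\operatorname{cl}D\cap W=D\cap W$. ${}^{ic}D=\operatorname{icr}D$ if $\operatorname{aff}D$ is closed, else $\emptyset$, where $\operatorname{icr}D=\{u:\forall x\in\operatorname{aff}(D-D)\ \exists\delta>0\ \forall\lambda\in[0,\delta]:\ u+\lambda x\in D\}$. *)

(* Defs.v *)
From Stdlib Require Import Reals List ClassicalEpsilon.
Open Scope R_scope.

Record Banach : Type := {
  carrier :> Type;
  vzero : carrier;
  vadd : carrier -> carrier -> carrier;
  vopp : carrier -> carrier;
  vscal : R -> carrier -> carrier;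
  vnorm : carrier -> R;
  vaddA : forall x y z, vadd x (vadd y z) = vadd (vadd x y) z;
  vaddC : forall x y, vadd x y = vadd y x;
  vadd0 : forall x, vadd x vzero = x;
  vaddN : forall x, vadd x (vopp x) = vzero;
  vscal1 : forall x, vscal 1 x = x;
  vscalA : forall a b x, vscal a (vscal b x) = vscal (a * b) x;
  vscalDl : forall a b x, vscal (a + b) x = vadd (vscal a x) (vscal b x);
  vscalDr : forall a x y, vscal a (vadd x y) = vadd (vscal a x) (vscal a y);
  vnorm_eq0 : forall x, vnorm x = 0 -> x = vzero;
  vnorm_scal : forall a x, vnorm (vscal a x) = Rabs a * vnorm x;
  vnorm_tri : forall x y, vnorm (vadd x y) <= vnorm x + vnorm y;
  vcomplete : forall u : nat -> carrier,
    (forall eps, 0 < eps -> exists N, forall m n, (N <= m)%nat -> (N <= n)%nat ->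
        vnorm (vadd (u m) (vopp (u n))) < eps) ->
    exists l, forall eps, 0 < eps -> exists N, forall n, (N <= n)%nat ->
        vnorm (vadd (u n) (vopp l)) < eps
}.
Arguments vzero {_}.
Arguments vadd {_} _ _.
Arguments vopp {_} _.
Arguments vscal {_} _ _.
Arguments vnorm {_} _.

Definition vsub {X : Banach} (x y : X) : X := vadd x (vopp y).

Definition nonzero_space (X : Banach) : Prop := exists x : X, x <> vzero.

Inductive Rbar : Type := Fin (r : R) | PInf | MInf.

Definition Rbar_le (x y : Rbar) : Prop :=
  match x, y with
  | MInf, _ => True
  | _, PInf => True
  | Fin a, Fin b => a <= b
  | _, _ => False
  end.
Definition Rbar_lt (x y : Rbar) : Prop := Rbar_le x y /\ x <> y.

Definition Rbar_plus (x y : Rbar) : Rbar :=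
  match x, y with
  | Fin a, Fin b => Fin (a + b)
  | PInf, _ => PInf
  | _, PInf => PInf
  | _, _ => MInf
  end.

Definition Rbar_rminus (r : R) (e : Rbar) : Rbar :=
  match e with Fin a => Fin (r - a) | PInf => MInf | MInf => PInf end.

Definition Rbar_is_sup (E : Rbar -> Prop) (s : Rbar) : Prop :=
  (forall e, E e -> Rbar_le e s) /\
  (forall t, (forall e, E e -> Rbar_le e t) -> Rbar_le s t).
Definition Rbar_is_inf (E : Rbar -> Prop) (s : Rbar) : Prop :=
  (forall e, E e -> Rbar_le s e) /\
  (forall t, (forall e, E e -> Rbar_le t e) -> Rbar_le t s).

Definition Rbar_sup (E : Rbar -> Prop) : Rbar :=
  epsilon (inhabits PInf) (Rbar_is_sup E).
Definition Rbar_inf (E : Rbar -> Prop) : Rbar :=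
  epsilon (inhabits PInf) (Rbar_is_inf E).

Section Duals.
Context {X : Banach}.

Definition is_linf (f : X -> R) : Prop :=
  (forall x y, f (vadd x y) = f x + f y) /\ (forall a x, f (vscal a x) = a * f x).

Definition dbound (f : X -> R) (K : R) : Prop :=
  forall x, Rabs (f x) <= K * vnorm x.

Definition is_dual (f : X -> R) : Prop := is_linf f /\ exists K, dbound f K.

Definition dadd (f g : X -> R) : X -> R := fun x => f x + g x.
Definition dsub (f g : X -> R) : X -> R := fun x => f x - g x.
Definition dscal (a : R) (f : X -> R) : X -> R := fun x => a * f x.
Definition dzero : X -> R := fun _ => 0.

Definition dball (f g : X -> R) (eps : R) : Prop :=
  exists K, K < eps /\ dbound (dsub f g) K.

Definition is_bidual (p : (X -> R) -> R) : Prop :=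
  (forall f g, is_dual f -> is_dual g -> p (dadd f g) = p f + p g) /\
  (forall a f, is_dual f -> p (dscal a f) = a * p f) /\
  (exists M, forall f K, is_dual f -> 0 <= K -> dbound f K -> Rabs (p f) <= M * K).

(* equality in X^** (elements only matter on X^* ) *)
Definition beq (p q : (X -> R) -> R) : Prop := forall f, is_dual f -> p f = q f.
Definition badd (p q : (X -> R) -> R) : (X -> R) -> R := fun f => p f + q f.

Definition Jc (x : X) : (X -> R) -> R := fun f => f x.

End Duals.

Definition lin_cont {X Y : Banach} (A : X -> Y) : Prop :=
  (forall x y, A (vadd x y) = vadd (A x) (A y)) /\
  (forall a x, A (vscal a x) = vscal a (A x)) /\
  (exists K, forall x, vnorm (A x) <= K * vnorm x).

Definition adj {X Y : Banach} (A : X -> Y) (g : Y -> R) : X -> R := fun x => g (A x).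
Definition biadj {X Y : Banach} (A : X -> Y) (p : (X -> R) -> R) : (Y -> R) -> R :=
  fun g => p (adj A g).

Definition op (X : Banach) := X -> (X -> R) -> Prop.

Definition is_operator {X : Banach} (S : op X) : Prop :=
  forall x f, S x f -> is_dual f.

Definition monotone {X : Banach} (S : op X) : Prop :=
  is_operator S /\
  forall x f y g, S x f -> S y g -> 0 <= f (vsub x y) - g (vsub x y).

Definition maximal_monotone {X : Banach} (S : op X) : Prop :=
  monotone S /\
  forall S' : op X, monotone S' -> (forall x f, S x f -> S' x f) ->
    forall x f, S' x f -> S x f.

(* Gossez's monotone closure  X^** => X^*  :
   <x** - y, x* - y* > = x**(x* - y* ) - (x* - y* )(y) >= 0 *)
Definition gossez {X : Banach} (S : op X) (p : (X -> R) -> R) (f : X -> R) : Prop :=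
  is_bidual p /\ is_dual f /\
  forall y g, S y g -> 0 <= p (dsub f g) - dsub f g y.

Definition directed {I : Type} (le : I -> I -> Prop) : Prop :=
  inhabited I /\ (forall i, le i i) /\
  (forall i j k, le i j -> le j k -> le i k) /\
  (forall i j, exists k, le i k /\ le j k).
Definition eventually {I : Type} (le : I -> I -> Prop) (P : I -> Prop) : Prop :=
  exists i0, forall i, le i0 i -> P i.
Definition net_conv {I : Type} (le : I -> I -> Prop) (a : I -> R) (l : R) : Prop :=
  forall eps, 0 < eps -> eventually le (fun i => Rabs (a i - l) < eps).

Definition typeD {X : Banach} (S : op X) : Prop :=
  maximal_monotone S /\
  forall p f, gossez S p f ->
    exists (I : Type) (le : I -> I -> Prop) (xs : I -> X) (fs : I -> X -> R),
      directed le /\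
      (forall i, S (xs i) (fs i)) /\
      (exists M, forall i, vnorm (xs i) <= M /\ dbound (fs i) M) /\
      (forall g, is_dual g -> net_conv le (fun i => g (xs i)) (p g)) /\
      (forall eps, 0 < eps -> eventually le (fun i => dball (fs i) f eps)).

Definition bifun (X : Banach) := X -> (X -> R) -> Rbar.

Definition convexf {X : Banach} (h : bifun X) : Prop :=
  forall x1 f1 x2 f2 r1 r2 l, is_dual f1 -> is_dual f2 -> 0 <= l <= 1 ->
    Rbar_le (h x1 f1) (Fin r1) -> Rbar_le (h x2 f2) (Fin r2) ->
    Rbar_le (h (vadd (vscal l x1) (vscal (1 - l) x2))
               (dadd (dscal l f1) (dscal (1 - l) f2)))
            (Fin (l * r1 + (1 - l) * r2)).

Definition norm_lsc {X : Banach} (h : bifun X) : Prop :=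
  forall x f r, is_dual f -> Rbar_lt (Fin r) (h x f) ->
    exists eps, 0 < eps /\
      forall y g, is_dual g -> vnorm (vsub y x) < eps -> dball g f eps ->
        Rbar_lt (Fin r) (h y g).

Definition conjf {X : Banach} (h : bifun X) (f : X -> R) (p : (X -> R) -> R) : Rbar :=
  Rbar_sup (fun e => exists x g, is_dual g /\ e = Rbar_rminus (f x + p g) (h x g)).

Definition rep_fun {X : Banach} (h : bifun X) (S : op X) : Prop :=
  convexf h /\ norm_lsc h /\
  (forall x f, is_dual f -> Rbar_le (Fin (f x)) (h x f)) /\
  (forall x f, S x f -> h x f = Fin (f x)).

Definition strong_rep {X : Banach} (h : bifun X) (S : op X) : Prop :=
  rep_fun h S /\
  forall f p, is_dual f -> is_bidual p -> Rbar_le (Fin (p f)) (conjf h f p).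

Definition domf {X : Banach} (h : bifun X) (x : X) (f : X -> R) : Prop :=
  is_dual f /\ h x f <> PInf.

Definition aff {T : Type} (add : T -> T -> T) (scal : R -> T -> T) (zero : T)
  (D : T -> Prop) (z : T) : Prop :=
  exists l : list (R * T),
    Forall (fun q => D (snd q)) l /\
    fold_right (fun q acc => fst q + acc) 0 l = 1 /\
    z = fold_right (fun q acc => add (scal (fst q) (snd q)) acc) zero l.

Definition diffset {T : Type} (add : T -> T -> T) (scal : R -> T -> T)
  (D : T -> Prop) (z : T) : Prop :=
  exists d1 d2, D d1 /\ D d2 /\ z = add d1 (scal (-1) d2).

Definition icr {T : Type} (add : T -> T -> T) (scal : R -> T -> T) (zero : T)
  (D : T -> Prop) (u : T) : Prop :=
  forall x, aff add scal zero (diffset add scal D) x ->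
    exists delta, 0 < delta /\
      forall lam, 0 <= lam <= delta -> D (add u (scal lam x)).

Section Triples.
Context {X Y : Banach}.
Definition trip := (Y * (Y -> R) * (X -> R))%type.
Definition tadd (a b : trip) : trip :=
  let '(y1, g1, f1) := a in let '(y2, g2, f2) := b in
  (vadd y1 y2, dadd g1 g2, dadd f1 f2).
Definition tscal (c : R) (a : trip) : trip :=
  let '(y, g, f) := a in (vscal c y, dscal c g, dscal c f).
Definition tzero : trip := (vzero, dzero, dzero).
Definition tspace (a : trip) : Prop :=
  let '(_, g, f) := a in is_dual g /\ is_dual f.
Definition tnear (a b : trip) (eps : R) : Prop :=
  let '(y1, g1, f1) := a in let '(y2, g2, f2) := b in
  vnorm (vsub y1 y2) < eps /\ dball g1 g2 eps /\ dball f1 f2 eps.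
Definition tclosed (C : trip -> Prop) : Prop :=
  forall z, tspace z ->
    (forall eps, 0 < eps -> exists w, C w /\ tnear w z eps) -> C z.
Definition ic (D : trip -> Prop) (u : trip) : Prop :=
  tclosed (aff tadd tscal tzero D) /\ icr tadd tscal tzero D u.
End Triples.
Arguments trip : clear implicits.

Definition quad (X Y : Banach) :=
  ((X -> R) * (X -> R) * ((Y -> R) -> R) * R)%type.

Definition qspace {X Y : Banach} (z : quad X Y) : Prop :=
  let '(f1, f2, p, _) := z in is_dual f1 /\ is_dual f2 /\ is_bidual p.

Definition qeq {X Y : Banach} (z w : quad X Y) : Prop :=
  let '(f1, f2, p, r) := z in let '(f1', f2', p', r') := w in
  (forall x, f1 x = f1' x) /\ (forall x, f2 x = f2' x) /\ beq p p' /\ r = r'.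

(* closure for the product topology (X^*,w^* ) x (X^*,w^* ) x (Y^**,w^* ) x R,
   via basic neighbourhoods *)
Definition wcl {X Y : Banach} (E : quad X Y -> Prop) (z : quad X Y) : Prop :=
  let '(f1, f2, p, r) := z in
  forall (xs1 xs2 : list X) (gs : list (Y -> R)) (eps : R),
    0 < eps -> Forall is_dual gs ->
    exists f1' f2' p' r', E (f1', f2', p', r') /\
      Forall (fun x => Rabs (f1' x - f1 x) < eps) xs1 /\
      Forall (fun x => Rabs (f2' x - f2 x) < eps) xs2 /\
      Forall (fun g => Rabs (p' g - p g) < eps) gs /\
      Rabs (r' - r) < eps.

Definition wclosed_regarding {X Y : Banach} (E W : quad X Y -> Prop) : Prop :=
  forall z, qspace z -> W z -> (wcl E z /\ W z <-> E z /\ W z).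

Section Thm.
Context {X Y : Banach}.

Definition qual_nonempty (hS : bifun X) (hT : bifun Y) (A : X -> Y) : Prop :=
  exists (y : Y) (g : Y -> R) (f : X -> R),
    domf hT y g /\ (exists u, domf hS u f) /\
    (exists w, y = A w) /\ is_dual g /\ (forall x, f x = adj A g x).

Definition qual_set (hS : bifun X) (hT : bifun Y) (A : X -> Y) (z : trip X Y) : Prop :=
  exists (y : Y) (g : Y -> R) (f : X -> R) (w : X) (v : Y -> R),
    domf hT y g /\ (exists u, domf hS u f) /\ is_dual v /\
    z = (vsub y (A w), dsub g v, dsub f (adj A v)).

Definition cond_a (hS : bifun X) (hT : bifun Y) (A : X -> Y) : Prop :=
  ic (qual_set hS hT A) tzero.

Definition cond_b_set (hS : bifun X) (hT : bifun Y) (A : X -> Y) (z : quad X Y) : Prop :=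
  exists (uf : X -> R) (up : (X -> R) -> R) (vf : Y -> R) (vp : (Y -> R) -> R) (r : R),
    is_dual uf /\ is_bidual up /\ is_dual vf /\ is_bidual vp /\
    Rbar_le (Rbar_plus (conjf hS uf up) (conjf hT vf vp)) (Fin r) /\
    qeq z (uf, adj A vf, badd (biadj A up) vp, r).

Definition cond_b_W (A : X -> Y) (z : quad X Y) : Prop :=
  let '(f1, f2, p, _) := z in
  (forall x, f1 x = f2 x) /\ exists q, is_bidual q /\ beq p (biadj A q).

Definition cond_b (hS : bifun X) (hT : bifun Y) (A : X -> Y) : Prop :=
  wclosed_regarding (cond_b_set hS hT A) (cond_b_W A).

Definition infconv (hS : bifun X) (hT : bifun Y) (A : X -> Y) : bifun X :=
  fun x f => Rbar_inf (fun e => exists (u w : X) (v : Y -> R),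
     is_dual v /\ vadd u w = x /\ (forall z, adj A v z = f z) /\
     e = Rbar_plus (hS u f) (hT (A w) v)).

(* lower semicontinuous hull (closure of the epigraph) for ||.|| x ||.||_* *)
Definition clf (h : bifun X) : bifun X :=
  fun x f => Rbar_inf (fun e => exists r : R, e = Fin r /\
     forall eps, 0 < eps -> exists (y : X) (g : X -> R) (s : R),
       is_dual g /\ vnorm (vsub y x) < eps /\ dball g f eps /\
       Rabs (s - r) < eps /\ Rbar_le (h y g) (Fin s)).

(* extended generalized parallel sum:
   x^* in (S-bar^{-1} + (A^* T-bar A^** )^{-1})^{-1}(x) *)
Definition par_sum (S : op X) (T : op Y) (A : X -> Y) : op X :=
  fun x f => is_dual f /\
    exists (p q : (X -> R) -> R),
      is_bidual p /\ is_bidual q /\ beq (Jc x) (badd p q) /\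
      gossez S p f /\
      exists g : Y -> R, gossez T (biadj A q) g /\ (forall z, adj A g z = f z).

End Thm.

(* Main.v *)
(** The proof works with epigraphs [H x f r], meaning [h x f <= r], over the Banach spaces [X],
[X^*] and [X^**].

If [h] is convex, closed, [h >= c] and [h^* >= c], then Fenchel duality shows that
[h(y, g) - <f, y> - <p, g> + <p, f>], plus quadratic penalties of [y - z] and [g - f], has infimum
at most 0 when [z] ranges over a convex set weakly-* adherent to [p].  Iterating this for [p] and [z]
in [X] produces points where [h = c] near every point where [h - c] is small.  Centered at [(0, f)]
with a vanishing penalty on [y], it bounds the infimum of [<p - y, f - g>] over [{h = c}] by 0, that
is, the convex hull of [c] on [{h = c}] again has a conjugate above [c].  Applied to that hull, it
yields, for [(p, f)] in the Gossez closure, bounded contact points converging to [(p, f)].  So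
[{h = c}] is maximal monotone of type (D), with Gossez closure [{h^* = c}].

Each of the conditions (a) and (b) gives
[h^*(f, p) = min { h_S^*(f, q) + h_T^*(v, A^**(p - q)) : A^* v = f }] for the closed infimal
convolution [h]: (a) by a subgradient of the value function, bounded near 0 by a Robinson-Ursescu
argument, (b) because separation and the Fenchel-Moreau theorem always put the optimal value in the
weak closure.  Hence [h^* >= c], and equality in the minimum says exactly that [f] belongs to the
parallel sum, which is therefore [{h = c}]. *)
Require Import Defs.
From Stdlib Require Import Reals List ClassicalEpsilon.
From Stdlib Require Import Lra Lia FunctionalExtensionality ProofIrrelevance.
From mathcomp Require classical_sets.
Set Bullet Behavior "Strict Subproofs".
Open Scope R_scope.

(** * Hahn-Banach theorem *)

(** The spaces need not be reflexive: minima over [X] and its dual need not be attained, and a point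
    [p] of the bidual cannot be inserted into [h]. Hence infima are used only up to an error, and a
    convex subset of [X] that is weakly-* adherent to [p] stands in for [p]. The passage to the
    convex hull of [c] on the contact set comes from the Gossez closure: monotone relatedness of
    [(p, f)] speaks of contact points only, and gives a priori no lower bound for the unpenalized
    part of the minimized expression over all of [h]. On the hull this part is nonnegative, so the
    penalties alone must be small. Their weights [mu / 2] and [/ (2 * mu)] are tuned so that Young's
    inequality for the dual pairing is cancelled exactly by the conjugates of the two penalties.
    Since separation and completeness arguments are run on [X], on its duals and on finite products,
    all of these are built as instances of the one record [Banach]. *)

Section VectorAlgebra.
Context {X : Banach}.
Implicit Types x y z : X.

Lemma vadd0l x : vadd vzero x = x.
Proof. rewrite vaddC. apply vadd0. Qed.

Lemma vadd_cancel x y z : vadd x y = vadd x z -> y = z.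
Proof.
  intros H. rewrite <- (vadd0l y), <- (vadd0l z), <- (vaddN _ x), (vaddC _ x), <- !vaddA, H.
  reflexivity.
Qed.

Lemma vscal0 x : vscal 0 x = vzero.
Proof.
  apply (vadd_cancel (vscal 0 x)). rewrite <- vscalDl, vadd0. f_equal. ring.
Qed.

Lemma vscal_zero a : vscal a (vzero : X) = vzero.
Proof. rewrite <- (vscal0 vzero), vscalA. f_equal. ring. Qed.

Lemma vopp_scal x : vopp x = vscal (-1) x.
Proof.
  apply (vadd_cancel x). rewrite vaddN.
  assert (H : vadd (vscal 1 x) (vscal (-1) x) = vzero).
  { rewrite <- vscalDl. replace (1 + -1) with 0 by ring. apply vscal0. }
  rewrite vscal1 in H. symmetry. exact H.
Qed.

Lemma vadd_swap x y z t : vadd (vadd x y) (vadd z t) = vadd (vadd x z) (vadd y t).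
Proof.
  rewrite <- !vaddA. f_equal. rewrite !vaddA. f_equal. apply vaddC.
Qed.

(** Reified linear expressions for the tactic [vec]: a vector identity is reduced to equality of the
    real coefficients on each atom. *)
Inductive vexp : Type :=
  | EVar (n : nat) | EZero | EAdd (a b : vexp) | EOpp (a : vexp) | EScal (r : R) (a : vexp).

Fixpoint veval (env : list X) (e : vexp) : X :=
  match e with
  | EVar n => nth n env vzero
  | EZero => vzero
  | EAdd a b => vadd (veval env a) (veval env b)
  | EOpp a => vopp (veval env a)
  | EScal r a => vscal r (veval env a)
  end.

Fixpoint vcoef (e : vexp) (n : nat) : R :=
  match e with
  | EVar m => if Nat.eqb m n then 1 else 0
  | EZero => 0
  | EAdd a b => vcoef a n + vcoef b n
  | EOpp a => - vcoef a n
  | EScal r a => r * vcoef a n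
  end.

Fixpoint vcomb (c : nat -> R) (env : list X) : X :=
  match env with
  | nil => vzero
  | x :: l => vadd (vscal (c 0%nat) x) (vcomb (fun n => c (S n)) l)
  end.

Lemma vcomb_add c d env :
  vcomb (fun n => c n + d n) env = vadd (vcomb c env) (vcomb d env).
Proof.
  revert c d. induction env as [|x l IH]; intros c d; simpl.
  - symmetry; apply vadd0.
  - rewrite (IH (fun n => c (S n)) (fun n => d (S n))), vscalDl. apply vadd_swap.
Qed.

Lemma vcomb_scal a c env : vcomb (fun n => a * c n) env = vscal a (vcomb c env).
Proof.
  revert c. induction env as [|x l IH]; intros c; simpl.
  - symmetry; apply vscal_zero.
  - rewrite (IH (fun n => c (S n))), vscalDr, vscalA. reflexivity.
Qed.

Lemma vcomb_zero env : vcomb (fun _ => 0) env = vzero.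
Proof.
  induction env as [|x l IH]; simpl; [reflexivity|]. rewrite IH, vscal0. apply vadd0.
Qed.

Lemma vcomb_var env m :
  vcomb (fun n => if Nat.eqb m n then 1 else 0) env = nth m env vzero.
Proof.
  revert m. induction env as [|x l IH]; intros [|m]; simpl; auto.
  - rewrite vcomb_zero, vscal1. apply vadd0.
  - rewrite (IH m), vscal0. apply vadd0l.
Qed.

Lemma veval_vcomb env e : veval env e = vcomb (vcoef e) env.
Proof.
  induction e; simpl.
  - symmetry; apply vcomb_var.
  - symmetry; apply vcomb_zero.
  - rewrite IHe1, IHe2. symmetry; apply vcomb_add.
  - rewrite IHe, vopp_scal, <- vcomb_scal. f_equal. extensionality k. ring.
  - rewrite IHe. symmetry; apply vcomb_scal.
Qed.

(** A conjunction built by recursion, so that [cbn] unfolds it into one real equation per atom. *)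
Fixpoint veq_coefs (k n : nat) (e1 e2 : vexp) : Prop :=
  match n with
  | 0%nat => True
  | S n' => vcoef e1 k = vcoef e2 k /\ veq_coefs (S k) n' e1 e2
  end.

Lemma vcomb_eq env : forall c d,
  (forall n, (n < length env)%nat -> c n = d n) -> vcomb c env = vcomb d env.
Proof.
  induction env as [|x l IH]; intros c d H; simpl; auto.
  rewrite (H 0%nat) by (simpl; lia). f_equal. apply IH. intros n Hn. apply H. simpl; lia.
Qed.

Lemma veq_reflect env e1 e2 :
  veq_coefs 0 (length env) e1 e2 -> veval env e1 = veval env e2.
Proof.
  intros H. rewrite !veval_vcomb. apply vcomb_eq.
  assert (G : forall n k, veq_coefs k n e1 e2 ->
     forall j, (k <= j < k + n)%nat -> vcoef e1 j = vcoef e2 j).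
  { induction n as [|n IH]; simpl; intros k Hk j Hj; [lia|].
    destruct Hk as [H1 H2]. destruct (Nat.eq_dec k j) as [->|Hne]; auto.
    apply (IH (S k)); auto; lia. }
  intros n Hn. apply (G _ _ H). lia.
Qed.

End VectorAlgebra.

Ltac vmem x l :=
  match l with
  | nil => constr:(false)
  | x :: _ => constr:(true)
  | _ :: ?t => vmem x t
  end.
Ltac vpos x l :=
  match l with
  | x :: _ => constr:(0%nat)
  | _ :: ?t => let n := vpos x t in constr:(S n)
  end.
Ltac vatoms e l :=
  match e with
  | vzero => l
  | vadd ?a ?b => let l1 := vatoms a l in vatoms b l1
  | vopp ?a => vatoms a l
  | vscal _ ?a => vatoms a l
  | _ => let b := vmem e l in
         match b with true => l | false => constr:(e :: l) end
  end.
Ltac vquote e l :=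
  match e with
  | vzero => constr:(EZero)
  | vadd ?a ?b => let a' := vquote a l in let b' := vquote b l in constr:(EAdd a' b')
  | vopp ?a => let a' := vquote a l in constr:(EOpp a')
  | vscal ?r ?a => let a' := vquote a l in constr:(EScal r a')
  | _ => let n := vpos e l in constr:(EVar n)
  end.
(* Reduces an equality of linear expressions to equalities of coefficients, leaving those that
   [ring] and [field] do not solve. *)
Ltac vec :=
  unfold vsub;
  match goal with
  | |- @eq (carrier ?X) ?a ?b =>
    let l0 := constr:(@nil (carrier X)) in
    let l1 := vatoms a l0 in let l := vatoms b l1 in
    let ea := vquote a l in let eb := vquote b l in
    change (@veval X l ea = @veval X l eb);
    apply (@veq_reflect X); cbn; repeat split; try (ring || (field; lra))
  end.

Section NormFacts.
Context {X : Banach}.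
Implicit Types x y z : X.

Lemma vnorm_zero : vnorm (vzero : X) = 0.
Proof. rewrite <- (vscal0 (vzero : X)), vnorm_scal, Rabs_R0. ring. Qed.

Lemma vnorm_opp x : vnorm (vopp x) = vnorm x.
Proof. rewrite vopp_scal, vnorm_scal, Rabs_left by lra. ring. Qed.

Lemma vnorm_ge0 x : 0 <= vnorm x.
Proof.
  pose proof (vnorm_tri _ x (vopp x)) as H. rewrite vaddN, vnorm_zero, vnorm_opp in H. lra.
Qed.

Lemma vnorm_sub_sym x y : vnorm (vsub x y) = vnorm (vsub y x).
Proof. rewrite <- vnorm_opp. f_equal. vec. Qed.

Lemma vnorm_sub_tri x y z : vnorm (vsub x z) <= vnorm (vsub x y) + vnorm (vsub y z).
Proof. replace (vsub x z) with (vadd (vsub x y) (vsub y z)) by vec. apply vnorm_tri. Qed.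

Lemma vsub_eq0 x y : vsub x y = vzero -> x = y.
Proof.
  intros H. replace x with (vadd (vsub x y) y) by vec. rewrite H. vec.
Qed.

Lemma vnorm_scal_pos a x : 0 <= a -> vnorm (vscal a x) = a * vnorm x.
Proof. intros H. rewrite vnorm_scal, Rabs_right; lra. Qed.

End NormFacts.

Lemma ex_glb (P : R -> Prop) (m : R) :
  (exists x, P x) -> (forall x, P x -> m <= x) ->
  exists g, (forall x, P x -> g <= x) /\ (forall b, (forall x, P x -> b <= x) -> b <= g).
Proof.
  intros [x0 H0] Hm.
  destruct (completeness (fun y => P (- y))) as [s [Hs1 Hs2]].
  - exists (- m). intros y Hy. specialize (Hm _ Hy). lra.
  - exists (- x0). rewrite Ropp_involutive. exact H0.
  - exists (- s). split.
    + intros x Hx. assert (- x <= s) by (apply Hs1; rewrite Ropp_involutive; exact Hx). lra.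
    + intros b Hb. assert (s <= - b); [|lra].
      apply Hs2. intros y Hy. specialize (Hb _ Hy). lra.
Qed.

Section HahnBanach.
Context {V : Banach}.

Definition sublinear (q : V -> R) : Prop :=
  (forall x y, q (vadd x y) <= q x + q y) /\ (forall a x, 0 < a -> q (vscal a x) <= a * q x).

Lemma sublinear0 q : sublinear q -> q vzero = 0.
Proof.
  intros [H1 H2]. pose proof (H2 2 vzero ltac:(lra)) as Ha.
  pose proof (H2 (/2) vzero ltac:(lra)) as Hb. rewrite !vscal_zero in *. lra.
Qed.

Lemma sublinear_opp q x : sublinear q -> - q (vopp x) <= q x.
Proof.
  intros Hq. pose proof (proj1 Hq x (vopp x)) as H. rewrite vaddN, sublinear0 in H; auto. lra.
Qed.

Lemma sublinear_scal q a x : sublinear q -> 0 <= a -> q (vscal a x) = a * q x.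
Proof.
  intros Hq Ha. destruct (Rle_lt_or_eq_dec 0 a Ha) as [H|<-].
  - apply Rle_antisym; [apply Hq; auto|].
    pose proof (proj2 Hq (/ a) (vscal a x) (Rinv_0_lt_compat _ H)) as H1.
    rewrite vscalA, Rinv_l, vscal1 in H1 by lra.
    apply (Rmult_le_compat_l a) in H1; [|lra].
    rewrite <- Rmult_assoc, Rinv_r in H1 by lra. lra.
  - rewrite vscal0, sublinear0; auto. ring.
Qed.

Definition convexG (C : V -> R -> Prop) : Prop :=
  forall z1 r1 z2 r2 l, 0 <= l <= 1 -> C z1 r1 -> C z2 r2 ->
    C (vadd (vscal l z1) (vscal (1 - l) z2)) (l * r1 + (1 - l) * r2).

(** The functional is [q' x = inf (q (x + t z) - t r)] over [t >= 0] and [C z r]. Subadditivity of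
    [q] and [r <= q z] give the lower bound [- q (- x)], so the infimum is finite; convexity of [C]
    makes it subadditive, and [t = 0], [t = 1] give the two upper bounds. *)
Lemma sublinear_reduce (q : V -> R) (C : V -> R -> Prop) :
  sublinear q -> convexG C -> (forall z r, C z r -> r <= q z) -> (exists z r, C z r) ->
  exists q', sublinear q' /\ (forall x, q' x <= q x) /\
    (forall x z r, C z r -> q' x <= q (vadd x z) - r).
Proof.
  intros Hq HC Hle [z0 [r0 H0]].
  pose (P := fun (x : V) (s : R) =>
    exists z r t, C z r /\ 0 <= t /\ s = q (vadd x (vscal t z)) - t * r).
  assert (HP : forall x, exists g, (forall s, P x s -> g <= s) /\
      (forall b, (forall s, P x s -> b <= s) -> b <= g)).
  { intros x. apply (ex_glb (P x) (- q (vopp x))).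
    - exists (q (vadd x (vscal 0 z0)) - 0 * r0), z0, r0, 0. repeat split; auto; lra.
    - intros s (z & r & t & Hz & Ht & ->).
      pose proof (proj1 Hq (vadd x (vscal t z)) (vopp x)) as H.
      replace (vadd (vadd x (vscal t z)) (vopp x)) with (vscal t z) in H by vec.
      rewrite sublinear_scal in H; auto. specialize (Hle _ _ Hz).
      apply (Rmult_le_compat_l t) in Hle; auto. lra. }
  pose (q' := fun x => proj1_sig (constructive_indefinite_description _ (HP x))).
  assert (H1 : forall x s, P x s -> q' x <= s).
  { intros x. unfold q'. destruct constructive_indefinite_description as [g Hg]; simpl. apply Hg. }
  assert (H2 : forall x b, (forall s, P x s -> b <= s) -> b <= q' x).
  { intros x. unfold q'. destruct constructive_indefinite_description as [g Hg]; simpl. apply Hg. }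
  exists q'. split; [split|split].
  - intros x y.
    assert (q' (vadd x y) - q' x <= q' y); [|lra].
    apply H2. intros s2 Hs2.
    assert (q' (vadd x y) - s2 <= q' x); [|lra].
    apply H2. intros s1 Hs1.
    destruct Hs1 as (z1 & r1 & t1 & Hz1 & Ht1 & ->).
    destruct Hs2 as (z2 & r2 & t2 & Hz2 & Ht2 & ->).
    (* [t1 z1 + t2 z2] is [t1 + t2] times a convex combination of points of [C], except when both
       weights vanish. *)
    assert (G : P (vadd x y) (q (vadd (vadd x y) (vadd (vscal t1 z1) (vscal t2 z2)))
                              - (t1 * r1 + t2 * r2))).
    { destruct (Req_dec (t1 + t2) 0) as [E|E].
      - exists z1, r1, 0. split; auto. split; [lra|].
        replace t1 with 0 by lra. replace t2 with 0 by lra.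
        replace (vadd (vscal 0 z1) (vscal 0 z2)) with (vscal 0 z1) by vec. ring.
      - exists (vadd (vscal (t1 / (t1 + t2)) z1) (vscal (1 - t1 / (t1 + t2)) z2)),
          (t1 / (t1 + t2) * r1 + (1 - t1 / (t1 + t2)) * r2), (t1 + t2).
        split; [|split; [lra|]].
        + apply HC; auto. assert (0 < t1 + t2) by lra. split.
          * apply Rmult_le_pos; auto. left; apply Rinv_0_lt_compat; auto.
          * apply (Rmult_le_reg_r (t1 + t2)); auto. unfold Rdiv.
            rewrite Rmult_assoc, Rinv_l; lra.
        + f_equal; [f_equal; f_equal; vec|]; field; auto. }
    apply H1 in G. eapply Rle_trans; [apply Rplus_le_compat_r, G|].
    replace (vadd (vadd x y) (vadd (vscal t1 z1) (vscal t2 z2)))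
      with (vadd (vadd x (vscal t1 z1)) (vadd y (vscal t2 z2))) by vec.
    pose proof (proj1 Hq (vadd x (vscal t1 z1)) (vadd y (vscal t2 z2))). lra.
  - intros a x Ha.
    assert (/ a * q' (vscal a x) <= q' x).
    { apply H2. intros s (z & r & t & Hz & Ht & ->).
      apply (Rmult_le_reg_l a); auto. rewrite <- Rmult_assoc, Rinv_r, Rmult_1_l by lra.
      apply H1. exists z, r, (a * t). repeat split; auto.
      - apply Rmult_le_pos; lra.
      - rewrite Rmult_minus_distr_l, <- (sublinear_scal q a) by (auto; lra).
        f_equal; [f_equal; vec|ring]. }
    apply (Rmult_le_compat_l a) in H; [|lra].
    rewrite <- Rmult_assoc, Rinv_r, Rmult_1_l in H by lra. exact H.
  - intros x. apply H1. exists z0, r0, 0. repeat split; auto; try lra.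
    replace (vadd x (vscal 0 z0)) with x by vec. ring.
  - intros x z r Hz. apply H1. exists z, r, 1. rewrite vscal1. repeat split; auto; lra.
Qed.

(** Zorn's lemma for the reversed pointwise order. A nonempty chain is bounded by its pointwise
    infimum, which is finite because every sublinear [a <= q] satisfies [a x >= - q (- x)]. *)
Lemma sublinear_minimal (q : V -> R) : sublinear q ->
  exists q', sublinear q' /\ (forall x, q' x <= q x) /\
    forall q'', sublinear q'' -> (forall x, q'' x <= q' x) -> q'' = q'.
Proof.
  intros Hq.
  pose (T := {q' : V -> R | sublinear q' /\ forall x, q' x <= q x}).
  pose (le := fun a b : T => forall x, proj1_sig b x <= proj1_sig a x).
  pose (leb := fun a b : T => if excluded_middle_informative (le a b) then true else false).
  assert (Hle : forall a b, is_true (leb a b) <-> le a b).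
  { intros a b. unfold leb, is_true. destruct excluded_middle_informative; split; auto; discriminate. }
  assert (Tlow : forall (a : T) x, - q (vopp x) <= proj1_sig a x).
  { intros [a [Ha1 Ha2]] x; simpl. pose proof (sublinear_opp a x Ha1).
    pose proof (Ha2 (vopp x)). lra. }
  destruct (@classical_sets.Zorn T leb) as [[m [Hm1 Hm2]] Hm].
  - intros t. apply Hle. intros x. lra.
  - intros a b c Hab Hbc. apply Hle in Hab. apply Hle in Hbc. apply Hle.
    intros x. specialize (Hab x). specialize (Hbc x). lra.
  - intros [a Ha] [b Hb] H1 H2. apply Hle in H1. apply Hle in H2.
    assert (a = b) as <-.
    { extensionality x. specialize (H1 x). specialize (H2 x). simpl in *. lra. }
    f_equal. apply proof_irrelevance.
  - intros A Htot.
    destruct (classic (exists a, A a)) as [[a0 Ha0]|Hno].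
    2:{ assert (Hqq : sublinear q /\ forall x, q x <= q x) by (split; auto; intros; lra).
        exists (exist _ q Hqq). intros s Hs. exfalso; eauto. }
    assert (HP : forall x, exists g, (forall s, (exists a, A a /\ s = proj1_sig a x) -> g <= s) /\
      (forall b, (forall s, (exists a, A a /\ s = proj1_sig a x) -> b <= s) -> b <= g)).
    { intros x. apply (ex_glb _ (- q (vopp x))); [eauto|].
      intros s (a & _ & ->). apply Tlow. }
    pose (q' := fun x => proj1_sig (constructive_indefinite_description _ (HP x))).
    assert (H1 : forall x a, A a -> q' x <= proj1_sig a x).
    { intros x a Ha. unfold q'. destruct constructive_indefinite_description as [g Hg]; simpl.
      apply Hg; eauto. }
    assert (H2 : forall x b, (forall a, A a -> b <= proj1_sig a x) -> b <= q' x).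
    { intros x b Hb. unfold q'. destruct constructive_indefinite_description as [g Hg]; simpl.
      apply Hg. intros s (a & Ha & ->). auto. }
    assert (Hq' : sublinear q' /\ forall x, q' x <= q x).
    { split; [split|].
      - intros x y.
        assert (q' (vadd x y) - q' x <= q' y); [|lra].
        apply H2. intros b Hb.
        assert (q' (vadd x y) - proj1_sig b y <= q' x); [|lra].
        apply H2. intros a Ha.
        assert (Hc : exists c, A c /\ proj1_sig c x <= proj1_sig a x /\ proj1_sig c y <= proj1_sig b y).
        { destruct (Htot a b Ha Hb) as [H|H]; apply Hle in H;
            [exists b|exists a]; repeat split; auto; try lra; apply H. }
        destruct Hc as (c & Hc & Hx & Hy).
        pose proof (H1 (vadd x y) c Hc). destruct c as [c [Hc1 Hc2]]; simpl in *.
        pose proof (proj1 Hc1 x y). lra.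
      - intros a x Ha.
        assert (/ a * q' (vscal a x) <= q' x).
        { apply H2. intros b Hb. pose proof (H1 (vscal a x) b Hb).
          destruct b as [b [Hb1 Hb2]]; simpl in *.
          rewrite (sublinear_scal b) in H by (auto; lra).
          apply (Rmult_le_reg_l a); auto. rewrite <- Rmult_assoc, Rinv_r, Rmult_1_l by lra. exact H. }
        apply (Rmult_le_compat_l a) in H; [|lra].
        rewrite <- Rmult_assoc, Rinv_r, Rmult_1_l in H by lra. exact H.
      - intros x. pose proof (H1 x a0 Ha0). pose proof (proj2 (proj2_sig a0) x) as H'.
        simpl in H'. lra. }
    exists (exist _ q' Hq'). intros s Hs. apply Hle. intros x. simpl. auto.
  - exists m. split; [|split]; auto. intros q'' H1 H2.
    assert (H3 : sublinear q'' /\ forall x, q'' x <= q x).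
    { split; auto. intros x. pose proof (H2 x). pose proof (Hm2 x). lra. }
    assert (E : exist _ q'' H3 = exist _ m (conj Hm1 Hm2) :> T).
    { apply Hm. apply Hle. exact H2. }
    exact (f_equal (@proj1_sig _ _) E).
Qed.

(* A minimal sublinear functional is additive: reducing it along the single pair (z, q z) cannot decrease it. *)
Lemma hahn_banach (q : V -> R) : sublinear q ->
  exists l : V -> R, is_linf l /\ forall x, l x <= q x.
Proof.
  intros Hq. destruct (sublinear_minimal q Hq) as (l & Hl & Hlq & Hmin).
  assert (Hadd : forall x y, l (vadd x y) = l x + l y).
  { intros x y. apply Rle_antisym; [apply Hl|].
    destruct (sublinear_reduce l (fun z r => z = y /\ r = l y) Hl) as (q' & H1 & H2 & H3).
    - intros z1 r1 z2 r2 a Ha [-> ->] [-> ->]. split; [vec|ring].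
    - intros z r [-> ->]. lra.
    - eauto.
    - rewrite (Hmin q' H1 H2) in H3. specialize (H3 x y (l y) (conj eq_refl eq_refl)). lra. }
  assert (Hopp : forall x, l (vopp x) = - l x).
  { intros x. pose proof (Hadd x (vopp x)) as H. rewrite vaddN, sublinear0 in H; auto. lra. }
  exists l. split; [split|]; auto.
  intros a x. destruct (Rle_or_lt 0 a) as [Ha|Ha].
  - apply sublinear_scal; auto.
  - replace (vscal a x) with (vopp (vscal (- a) x)) by vec.
    rewrite Hopp, sublinear_scal by (auto; lra). ring.
Qed.

(** [C] plays the hypograph of a concave function below [q]. A linear functional below the reduced
    functional is below [q], and its value at [- z] is at most [q 0 - r = - r], which is the
    required bound on [C]. *)
Lemma sandwich (q : V -> R) (C : V -> R -> Prop) :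
  sublinear q -> convexG C -> (forall z r, C z r -> r <= q z) ->
  exists l, is_linf l /\ (forall x, l x <= q x) /\ (forall z r, C z r -> r <= l z).
Proof.
  intros Hq HC Hle.
  destruct (classic (exists z r, C z r)) as [Hne|Hno].
  - destruct (sublinear_reduce q C Hq HC Hle Hne) as (q' & H1 & H2 & H3).
    destruct (hahn_banach q' H1) as (l & Hl1 & Hl2).
    exists l. split; [|split]; auto.
    + intros x. specialize (Hl2 x). specialize (H2 x). lra.
    + intros z r Hz. specialize (H3 (vopp z) z r Hz). specialize (Hl2 (vopp z)).
      replace (vadd (vopp z) z) with (vzero : V) in H3 by vec. rewrite sublinear0 in H3; auto.
      assert (l (vopp z) = - l z); [|lra].
      rewrite vopp_scal, (proj2 Hl1). ring.
  - destruct (hahn_banach q Hq) as (l & Hl1 & Hl2).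
    exists l. split; [|split]; auto. intros z r Hz. exfalso; eauto.
Qed.

End HahnBanach.

(** * Dual and product spaces *)

Lemma Rle_eps a b : (forall e, 0 < e -> a <= b + e) -> a <= b.
Proof.
  intros H. destruct (Rle_or_lt a b) as [|Hlt]; auto.
  specialize (H ((a - b) / 2) ltac:(lra)). lra.
Qed.

Lemma Rabs_le_inv a b : Rabs a <= b -> - b <= a <= b.
Proof. unfold Rabs. destruct Rcase_abs; lra. Qed.

Lemma is_linf_zero {X : Banach} (f : X -> R) : is_linf f -> f vzero = 0.
Proof. intros [_ H]. rewrite <- (vscal0 vzero), H. ring. Qed.
Lemma is_linf_opp {X : Banach} (f : X -> R) x : is_linf f -> f (vopp x) = - f x.
Proof. intros [_ H]. rewrite vopp_scal, H. ring. Qed.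
Lemma is_linf_sub {X : Banach} (f : X -> R) x y : is_linf f -> f (vsub x y) = f x - f y.
Proof. intros H. unfold vsub. rewrite (proj1 H), is_linf_opp; auto. Qed.

Lemma is_dual_bound {X : Banach} (f : X -> R) : is_dual f ->
  exists K, 0 <= K /\ dbound f K.
Proof.
  intros [_ [K HK]]. exists (Rmax K 0). split; [apply Rmax_r|].
  intros x. eapply Rle_trans; [apply HK|]. apply Rmult_le_compat_r; [apply vnorm_ge0|apply Rmax_l].
Qed.

Lemma is_dual_zero {X : Banach} : is_dual (@dzero X).
Proof.
  unfold dzero. repeat split; intros; try ring. exists 0. intros x. rewrite Rabs_R0. lra.
Qed.

Lemma is_dual_add {X : Banach} (f g : X -> R) : is_dual f -> is_dual g -> is_dual (dadd f g).
Proof.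
  unfold dadd. intros [Hf [K HK]] [Hg [L HL]]. repeat split.
  - intros. rewrite (proj1 Hf), (proj1 Hg). ring.
  - intros. rewrite (proj2 Hf), (proj2 Hg). ring.
  - exists (K + L). intros x. eapply Rle_trans; [apply Rabs_triang|].
    specialize (HK x). specialize (HL x). lra.
Qed.

Lemma is_dual_scal {X : Banach} a (f : X -> R) : is_dual f -> is_dual (dscal a f).
Proof.
  unfold dscal. intros [Hf [K HK]]. repeat split.
  - intros. rewrite (proj1 Hf). ring.
  - intros. rewrite (proj2 Hf). ring.
  - exists (Rabs a * K). intros x. rewrite Rabs_mult, Rmult_assoc.
    apply Rmult_le_compat_l; [apply Rabs_pos|apply HK].
Qed.

Section DualSpace.
Context (X : Banach).

Definition dual_carrier : Type := {f : X -> R | is_dual f}.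
Implicit Types f g : dual_carrier.

Lemma dual_ext f g : (forall x, proj1_sig f x = proj1_sig g x) -> f = g.
Proof.
  destruct f as [f Hf], g as [g Hg]; simpl. intros H.
  assert (f = g) as <- by (extensionality x; auto). f_equal. apply proof_irrelevance.
Qed.

(** The dual norm is the least nonnegative admissible bound. The restriction [0 <= K] keeps the set
    of bounds bounded below even on the zero space. *)
Lemma dnorm_ex f : exists n, 0 <= n /\ dbound (proj1_sig f) n /\
  forall K, 0 <= K -> dbound (proj1_sig f) K -> n <= K.
Proof.
  destruct (ex_glb (fun K => 0 <= K /\ dbound (proj1_sig f) K) 0) as (n & H1 & H2).
  - apply is_dual_bound. apply (proj2_sig f).
  - tauto.
  - exists n. split; [|split].
    + apply H2. tauto.
    + intros x. destruct (vnorm_ge0 x) as [Hx|Hx].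
      * assert (Rabs (proj1_sig f x) / vnorm x <= n).
        { apply H2. intros K [HK HKb]. specialize (HKb x).
          apply (Rmult_le_reg_r (vnorm x)); auto. unfold Rdiv.
          rewrite Rmult_assoc, Rinv_l; lra. }
        apply (Rmult_le_compat_r (vnorm x)) in H; [|lra].
        unfold Rdiv in H. rewrite Rmult_assoc, Rinv_l in H; lra.
      * destruct (is_dual_bound _ (proj2_sig f)) as (K & HK & HKb).
        specialize (HKb x). rewrite <- Hx in *. lra.
    + intros K HK HKb. apply H1. auto.
Qed.

Definition dnorm f : R := proj1_sig (constructive_indefinite_description _ (dnorm_ex f)).
Lemma dnorm_spec f : 0 <= dnorm f /\ dbound (proj1_sig f) (dnorm f) /\
  forall K, 0 <= K -> dbound (proj1_sig f) K -> dnorm f <= K.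
Proof. unfold dnorm. destruct constructive_indefinite_description. auto. Qed.

Definition dual_zero : dual_carrier := exist _ dzero is_dual_zero.
Definition dual_add f g : dual_carrier := exist _ _ (is_dual_add _ _ (proj2_sig f) (proj2_sig g)).
Definition dual_scal a f : dual_carrier := exist _ _ (is_dual_scal a _ (proj2_sig f)).
Definition dual_opp f := dual_scal (-1) f.

Lemma dual_complete (u : nat -> dual_carrier) :
    (forall eps, 0 < eps -> exists N, forall m n, (N <= m)%nat -> (N <= n)%nat ->
        dnorm (dual_add (u m) (dual_opp (u n))) < eps) ->
    exists l, forall eps, 0 < eps -> exists N, forall n, (N <= n)%nat ->
        dnorm (dual_add (u n) (dual_opp l)) < eps.
Proof.
  intros Hc.
  assert (Hd : forall x m n, Rabs (proj1_sig (u m) x - proj1_sig (u n) x) <=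
     dnorm (dual_add (u m) (dual_opp (u n))) * vnorm x).
  { intros x m n. destruct (dnorm_spec (dual_add (u m) (dual_opp (u n)))) as (_ & H & _).
    specialize (H x). simpl in H. unfold dadd, dscal in H.
    replace (proj1_sig (u m) x - proj1_sig (u n) x) with
      (proj1_sig (u m) x + -1 * proj1_sig (u n) x) by ring. exact H. }
  assert (Hl : forall x, exists l, Un_cv (fun n => proj1_sig (u n) x) l).
  { intros x. destruct (R_complete (fun n => proj1_sig (u n) x)) as [l Hl]; [|eauto].
    intros eps He. pose proof (vnorm_ge0 x).
    destruct (Hc (eps / (vnorm x + 1))) as [N HN]; [apply Rdiv_lt_0_compat; lra|].
    exists N. intros n m Hn Hm. unfold Rdist. eapply Rle_lt_trans; [apply Hd|].
    specialize (HN n m Hn Hm).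
    apply Rle_lt_trans with (eps / (vnorm x + 1) * vnorm x).
    - apply Rmult_le_compat_r; lra.
    - apply (Rmult_lt_reg_r (vnorm x + 1)); [lra|].
      replace (eps / (vnorm x + 1) * vnorm x * (vnorm x + 1)) with (eps * vnorm x) by (field; lra).
      apply Rmult_lt_compat_l; lra. }
  pose (l := fun x => proj1_sig (constructive_indefinite_description _ (Hl x))).
  assert (Hlc : forall x, Un_cv (fun n => proj1_sig (u n) x) (l x)).
  { intros x. unfold l. destruct constructive_indefinite_description. auto. }
  (* Letting one index tend to infinity turns the Cauchy estimate into a uniform estimate against
     the pointwise limit. *)
  assert (Happ : forall eps, 0 < eps -> exists N, forall n, (N <= n)%nat ->
       forall x, Rabs (proj1_sig (u n) x - l x) <= eps * vnorm x).
  { intros eps He. destruct (Hc eps He) as [N HN]. exists N. intros n Hn x.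
    apply Rle_eps. intros e He'. destruct (Hlc x e He') as [N' HN'].
    specialize (HN' (N + N')%nat ltac:(lia)). unfold Rdist in HN'.
    specialize (HN n (N + N')%nat Hn ltac:(lia)). specialize (Hd x n (N + N')%nat).
    assert (dnorm (dual_add (u n) (dual_opp (u (N + N')%nat))) * vnorm x <= eps * vnorm x).
    { apply Rmult_le_compat_r; [apply vnorm_ge0|lra]. }
    replace (proj1_sig (u n) x - l x) with
      ((proj1_sig (u n) x - proj1_sig (u (N + N')%nat) x) + (proj1_sig (u (N + N')%nat) x - l x)) by ring.
    eapply Rle_trans; [apply Rabs_triang|]. lra. }
  assert (Hld : is_dual l).
  { split; [split|].
    - intros x y. eapply UL_sequence; [apply Hlc|].
      apply Un_cv_ext with (fun n => proj1_sig (u n) x + proj1_sig (u n) y).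
      + intros n. symmetry. apply (proj1 (proj2_sig (u n))).
      + apply CV_plus; apply Hlc.
    - intros a x. eapply UL_sequence; [apply Hlc|].
      apply Un_cv_ext with (fun n => a * proj1_sig (u n) x).
      + intros n. symmetry. apply (proj1 (proj2_sig (u n))).
      + apply (CV_mult (fun _ => a)); [|apply Hlc].
        intros eps He. exists 0%nat. intros. unfold Rdist. rewrite Rminus_diag, Rabs_R0. exact He.
    - destruct (Happ 1 Rlt_0_1) as [N HN]. specialize (HN N (le_n _)).
      destruct (dnorm_spec (u N)) as (_ & HK & _).
      exists (1 + dnorm (u N)). intros x. specialize (HN x). specialize (HK x).
      rewrite Rabs_minus_sym in HN.
      replace (l x) with ((l x - proj1_sig (u N) x) + proj1_sig (u N) x) by ring.
      eapply Rle_trans; [apply Rabs_triang|]. lra. }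
  exists (exist _ l Hld). intros eps He. destruct (Happ (eps / 2) ltac:(lra)) as [N HN].
  exists N. intros n Hn. apply Rle_lt_trans with (eps / 2); [|lra].
  apply dnorm_spec; [lra|]. intros x. simpl. unfold dadd, dscal.
  replace (proj1_sig (u n) x + -1 * l x) with (proj1_sig (u n) x - l x) by ring. auto.
Qed.

Definition DualB : Banach.
Proof.
  refine {| carrier := dual_carrier; vzero := dual_zero; vadd := dual_add; vopp := dual_opp;
            vscal := dual_scal; vnorm := dnorm |}.
  - intros; apply dual_ext; intros; simpl; unfold dadd; ring.
  - intros; apply dual_ext; intros; simpl; unfold dadd; ring.
  - intros; apply dual_ext; intros; simpl; unfold dadd, dzero; ring.
  - intros; apply dual_ext; intros; simpl; unfold dadd, dzero, dscal; ring.
  - intros; apply dual_ext; intros; simpl; unfold dscal; ring.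
  - intros; apply dual_ext; intros; simpl; unfold dscal; ring.
  - intros; apply dual_ext; intros; simpl; unfold dscal, dadd; ring.
  - intros; apply dual_ext; intros; simpl; unfold dscal, dadd; ring.
  - intros f Hf. apply dual_ext. intros x. destruct (dnorm_spec f) as (_ & H & _).
    specialize (H x). rewrite Hf, Rmult_0_l in H. simpl. unfold dzero.
    pose proof (Rabs_pos (proj1_sig f x)).
    destruct (Req_dec (proj1_sig f x) 0) as [|Hn]; auto. apply Rabs_no_R0 in Hn. lra.
  - assert (H : forall a f, dnorm (dual_scal a f) <= Rabs a * dnorm f).
    { intros a f. destruct (dnorm_spec f) as (H1 & H2 & _). apply dnorm_spec.
      - apply Rmult_le_pos; auto. apply Rabs_pos.
      - intros x. simpl. unfold dscal. rewrite Rabs_mult, Rmult_assoc.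
        apply Rmult_le_compat_l; [apply Rabs_pos|apply H2]. }
    intros a f. apply Rle_antisym; auto.
    destruct (Req_dec a 0) as [->|Ha].
    + rewrite Rabs_R0, Rmult_0_l. apply dnorm_spec.
    + pose proof (H (/ a) (dual_scal a f)) as H1.
      replace (dual_scal (/ a) (dual_scal a f)) with f in H1.
      2:{ apply dual_ext; intros; simpl; unfold dscal. field; auto. }
      apply (Rmult_le_compat_l (Rabs a)) in H1; [|apply Rabs_pos].
      rewrite <- Rmult_assoc, <- Rabs_mult, Rinv_r, Rabs_R1 in H1; auto. lra.
  - intros f g. destruct (dnorm_spec f) as (H1 & H2 & _), (dnorm_spec g) as (H3 & H4 & _).
    apply dnorm_spec; [lra|]. intros x. simpl. unfold dadd.
    eapply Rle_trans; [apply Rabs_triang|]. specialize (H2 x). specialize (H4 x). lra.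
  - exact dual_complete.
Defined.

End DualSpace.

Definition ev {X : Banach} (f : DualB X) (x : X) : R := proj1_sig f x.

Section DualFacts.
Context {X : Banach}.
Implicit Types (f g : DualB X) (x y : X).

Lemma ev_ext f g : (forall x, ev f x = ev g x) -> f = g.
Proof. apply dual_ext. Qed.
Lemma ev_dual f : is_dual (ev f).
Proof. exact (proj2_sig f). Qed.
Lemma ev_linf f : is_linf (ev f).
Proof. apply ev_dual. Qed.
Lemma mk_dual (f : X -> R) : is_dual f -> exists F : DualB X, ev F = f.
Proof. intros H. exists (exist _ f H). reflexivity. Qed.
Lemma ev_addr f x y : ev f (vadd x y) = ev f x + ev f y.
Proof. apply ev_linf. Qed.
Lemma ev_scalr f a x : ev f (vscal a x) = a * ev f x.
Proof. apply ev_linf. Qed.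
Lemma ev_oppr f x : ev f (vopp x) = - ev f x.
Proof. apply is_linf_opp, ev_linf. Qed.
Lemma ev_subr f x y : ev f (vsub x y) = ev f x - ev f y.
Proof. apply is_linf_sub, ev_linf. Qed.
Lemma ev_zeror f : ev f vzero = 0.
Proof. apply is_linf_zero, ev_linf. Qed.
Lemma ev_addl f g x : ev (vadd f g) x = ev f x + ev g x.
Proof. reflexivity. Qed.
Lemma ev_scall f a x : ev (vscal a f) x = a * ev f x.
Proof. reflexivity. Qed.
Lemma ev_oppl f x : ev (vopp f) x = - ev f x.
Proof. change (ev (vopp f) x) with (-1 * ev f x). ring. Qed.
Lemma ev_subl f g x : ev (vsub f g) x = ev f x - ev g x.
Proof. unfold vsub. rewrite ev_addl, ev_oppl. ring. Qed.
Lemma ev_zerol x : ev (vzero : DualB X) x = 0.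
Proof. reflexivity. Qed.
Lemma ev_bound f x : Rabs (ev f x) <= vnorm f * vnorm x.
Proof. apply (dnorm_spec X f). Qed.
Lemma dual_norm_le f K : 0 <= K -> dbound (ev f) K -> vnorm f <= K.
Proof. apply (dnorm_spec X f). Qed.
Lemma ev_le f x : ev f x <= vnorm f * vnorm x.
Proof. eapply Rle_trans; [apply Rle_abs|apply ev_bound]. Qed.

Lemma ev_norm_approx f eta : 0 < eta -> exists d, vnorm d <= 1 /\ vnorm f - eta <= ev f d.
Proof.
  intros He. destruct (Rle_or_lt (vnorm f) eta) as [Hle|Hlt].
  - exists vzero. rewrite vnorm_zero, ev_zeror. lra.
  - apply NNPP. intros Hno.
    assert (vnorm f <= vnorm f - eta); [|lra].
    apply dual_norm_le; [lra|]. intros x.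
    destruct (vnorm_ge0 x) as [Hx|Hx].
    + assert (Hu : forall s, Rabs s = 1 -> s * ev f x <= (vnorm f - eta) * vnorm x).
      { intros s Hs. apply Rnot_lt_le. intros Hc. apply Hno.
        exists (vscal (s / vnorm x) x). rewrite vnorm_scal, ev_scalr. split.
        - unfold Rdiv. rewrite Rabs_mult, Hs, Rabs_inv, (Rabs_right (vnorm x)) by lra.
          rewrite Rmult_1_l, Rinv_l; lra.
        - apply (Rmult_le_reg_r (vnorm x)); auto.
          replace (s / vnorm x * ev f x * vnorm x) with (s * ev f x) by (field; lra). lra. }
      unfold Rabs. destruct Rcase_abs.
      * specialize (Hu (-1)). rewrite Rabs_left in Hu by lra. lra.
      * specialize (Hu 1 Rabs_R1). lra.
    + pose proof (ev_bound f x). rewrite <- Hx in *. lra.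
Qed.

End DualFacts.

#[global] Hint Rewrite @ev_addr @ev_scalr @ev_oppr @ev_subr @ev_zeror
  @ev_addl @ev_scall @ev_oppl @ev_subl @ev_zerol : lin.

Section Product.
Context (X Y : Banach).

Definition ProdB : Banach.
Proof.
  refine {| carrier := (X * Y)%type; vzero := (vzero, vzero);
     vadd := fun a b => (vadd (fst a) (fst b), vadd (snd a) (snd b));
     vopp := fun a => (vopp (fst a), vopp (snd a));
     vscal := fun r a => (vscal r (fst a), vscal r (snd a));
     vnorm := fun a => vnorm (fst a) + vnorm (snd a) |};
  intros; simpl; try (f_equal; vec; fail).
  - destruct x; simpl; f_equal; vec.
  - destruct x; simpl; f_equal; vec.
  - destruct x as [x y]; simpl in *. pose proof (vnorm_ge0 x). pose proof (vnorm_ge0 y).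
    f_equal; apply vnorm_eq0; lra.
  - rewrite !vnorm_scal. ring.
  - pose proof (vnorm_tri _ (fst x) (fst y)). pose proof (vnorm_tri _ (snd x) (snd y)). lra.
  - destruct (vcomplete _ (fun n => fst (u n))) as [l1 H1].
    { intros eps He. destruct (H eps He) as [N HN]. exists N. intros m n Hm Hn.
      specialize (HN m n Hm Hn). simpl in HN.
      pose proof (vnorm_ge0 (vadd (snd (u m)) (vopp (snd (u n))))). lra. }
    destruct (vcomplete _ (fun n => snd (u n))) as [l2 H2].
    { intros eps He. destruct (H eps He) as [N HN]. exists N. intros m n Hm Hn.
      specialize (HN m n Hm Hn). simpl in HN.
      pose proof (vnorm_ge0 (vadd (fst (u m)) (vopp (fst (u n))))). lra. }
    exists (l1, l2). intros eps He.
    destruct (H1 (eps / 2) ltac:(lra)) as [N1 HN1], (H2 (eps / 2) ltac:(lra)) as [N2 HN2].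
    exists (N1 + N2)%nat. intros n Hn. simpl.
    specialize (HN1 n ltac:(lia)). specialize (HN2 n ltac:(lia)). lra.
Defined.

Definition pr (x : X) (y : Y) : ProdB := (x, y).
Definition p1 (a : ProdB) : X := fst a.
Definition p2 (a : ProdB) : Y := snd a.
End Product.
Arguments pr {X Y} _ _.
Arguments p1 {X Y} _.
Arguments p2 {X Y} _.

Section ProductFacts.
Context {X Y : Banach}.
Implicit Types a b : ProdB X Y.
Lemma p1_pr (x : X) (y : Y) : p1 (pr x y) = x. Proof. reflexivity. Qed.
Lemma p2_pr (x : X) (y : Y) : p2 (pr x y) = y. Proof. reflexivity. Qed.
Lemma p1_add a b : p1 (vadd a b) = vadd (p1 a) (p1 b). Proof. reflexivity. Qed.
Lemma p2_add a b : p2 (vadd a b) = vadd (p2 a) (p2 b). Proof. reflexivity. Qed.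
Lemma p1_scal r a : p1 (vscal r a) = vscal r (p1 a). Proof. reflexivity. Qed.
Lemma p2_scal r a : p2 (vscal r a) = vscal r (p2 a). Proof. reflexivity. Qed.
Lemma p1_opp a : p1 (vopp a) = vopp (p1 a). Proof. reflexivity. Qed.
Lemma p2_opp a : p2 (vopp a) = vopp (p2 a). Proof. reflexivity. Qed.
Lemma p1_sub a b : p1 (vsub a b) = vsub (p1 a) (p1 b). Proof. reflexivity. Qed.
Lemma p2_sub a b : p2 (vsub a b) = vsub (p2 a) (p2 b). Proof. reflexivity. Qed.
Lemma p1_zero : p1 (vzero : ProdB X Y) = vzero. Proof. reflexivity. Qed.
Lemma p2_zero : p2 (vzero : ProdB X Y) = vzero. Proof. reflexivity. Qed.
Lemma prod_ext a b : p1 a = p1 b -> p2 a = p2 b -> a = b.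
Proof. destruct a, b; simpl; intros -> ->; reflexivity. Qed.
Lemma prod_norm a : vnorm a = vnorm (p1 a) + vnorm (p2 a). Proof. reflexivity. Qed.

Lemma prod_dual (l : DualB (ProdB X Y)) :
  exists (u : DualB X) (v : DualB Y), forall a, ev l a = ev u (p1 a) + ev v (p2 a).
Proof.
  destruct (mk_dual (fun x : X => ev l (pr x vzero))) as [u Hu].
  { split; [split|].
    - intros x y. rewrite <- ev_addr. f_equal. apply prod_ext; simpl; vec.
    - intros r x. rewrite <- ev_scalr. f_equal. apply prod_ext; simpl; vec.
    - exists (vnorm l). intros x. eapply Rle_trans; [apply ev_bound|].
      rewrite prod_norm. simpl. rewrite vnorm_zero. lra. }
  destruct (mk_dual (fun y : Y => ev l (pr vzero y))) as [v Hv].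
  { split; [split|].
    - intros x y. rewrite <- ev_addr. f_equal. apply prod_ext; simpl; vec.
    - intros r x. rewrite <- ev_scalr. f_equal. apply prod_ext; simpl; vec.
    - exists (vnorm l). intros x. eapply Rle_trans; [apply ev_bound|].
      rewrite prod_norm. simpl. rewrite vnorm_zero. lra. }
  exists u, v. intros a. rewrite Hu, Hv, <- ev_addr. f_equal.
  apply prod_ext; simpl; vec.
Qed.
End ProductFacts.

#[global] Hint Rewrite @p1_pr @p2_pr @p1_add @p2_add @p1_scal @p2_scal @p1_opp @p2_opp
  @p1_sub @p2_sub @p1_zero @p2_zero : lin.

(** The real line as a [Banach], so that function values can be coordinates of points in a
    product. *)
Definition RB : Banach.
Proof.
  refine {| carrier := R; vzero := 0; vadd := Rplus; vopp := Ropp; vscal := Rmult; vnorm := Rabs |};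
  intros; try ring.
  - apply NNPP. intros Hn. apply Rabs_no_R0 in Hn. auto.
  - apply Rabs_mult.
  - apply Rabs_triang.
  - destruct (R_complete u) as [l Hl].
    + intros eps He. destruct (H eps He) as [N HN]. exists N. intros n m Hn Hm.
      apply (HN n m); auto.
    + exists l. intros eps He. destruct (Hl eps He) as [N HN]. exists N. intros n Hn.
      apply HN. auto.
Defined.

(** * Subgradients and weak separation *)

Ltac lin := autorewrite with lin.
Ltac linin H := autorewrite with lin in H.
Ltac pvec := repeat apply prod_ext; lin; try vec.

Lemma ev_RB (s : DualB RB) (t : R) : ev s (t : RB) = t * ev s (1 : RB).
Proof.
  rewrite <- ev_scalr. f_equal. change (t = t * 1). ring.
Qed.

Lemma sublinear_norm {E : Banach} (K : R) : 0 <= K -> sublinear (fun z : E => K * vnorm z).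
Proof.
  intros HK. split.
  - intros x y. rewrite <- Rmult_plus_distr_l. apply Rmult_le_compat_l; auto. apply vnorm_tri.
  - intros a x Ha. rewrite vnorm_scal_pos by lra. lra.
Qed.

Lemma linf_norm_dual {E : Banach} (l : E -> R) (K : R) :
  is_linf l -> (forall x, l x <= K * vnorm x) -> is_dual l.
Proof.
  intros Hl HK. split; auto. exists K. intros x. unfold Rabs. destruct Rcase_abs; auto.
  rewrite <- is_linf_opp, <- vnorm_opp; auto.
Qed.

Lemma norm_sq_convex {E : Banach} (a b : E) l : 0 <= l <= 1 ->
  vnorm (vadd (vscal l a) (vscal (1 - l) b)) ^ 2 <= l * vnorm a ^ 2 + (1 - l) * vnorm b ^ 2.
Proof.
  intros Hl. pose proof (vnorm_ge0 a). pose proof (vnorm_ge0 b).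
  assert (vnorm (vadd (vscal l a) (vscal (1 - l) b)) <= l * vnorm a + (1 - l) * vnorm b).
  { eapply Rle_trans; [apply vnorm_tri|]. rewrite !vnorm_scal_pos by lra. lra. }
  pose proof (vnorm_ge0 (vadd (vscal l a) (vscal (1 - l) b))).
  apply Rle_trans with ((l * vnorm a + (1 - l) * vnorm b) ^ 2).
  - apply pow_incr. lra.
  - assert (0 <= l * (1 - l) * (vnorm a - vnorm b) ^ 2); [|nra].
    apply Rmult_le_pos; [nra|apply pow2_ge_0].
Qed.

(* [G] is the epigraph of a convex value function, minorized by [m] at the origin and bounded
   by [B] on the part of the ball of radius [delta] opposite to its domain. *)
Lemma subgradient {E : Banach} (G : E -> R -> Prop) (m B delta : R) :
  convexG G -> 0 < delta -> (forall s, G vzero s -> m <= s) ->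
  (forall z s t, G z s -> 0 <= t -> t * vnorm z <= delta ->
     exists s', s' <= B /\ G (vscal (- t) z) s') ->
  exists l : DualB E, forall z s, G z s -> m - s <= ev l z.
Proof.
  intros HG Hd Hm HB.
  (* The slope forced by the bound [B] at distance [delta]: convexity between [z] and the opposite
     point [- t z] with [t |z| = delta], compared with [m] at the origin, gives [m - s <= K |z|]. *)
  pose (K := Rabs (B - m) / delta).
  assert (HK : 0 <= K).
  { apply Rmult_le_pos; [apply Rabs_pos|]. left. apply Rinv_0_lt_compat; auto. }
  destruct (sandwich (fun z : E => K * vnorm z) (fun z r => G z (m - r))) as (l & Hl & HlK & Hlm).
  - apply sublinear_norm; auto.
  - intros z1 r1 z2 r2 a Ha H1 H2.
    replace (m - (a * r1 + (1 - a) * r2)) with (a * (m - r1) + (1 - a) * (m - r2)) by ring.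
    apply HG; auto.
  - intros z r Hz. destruct (vnorm_ge0 z) as [Hn|Hn].
    + destruct (HB z _ (delta / vnorm z) Hz) as (s' & Hs' & HG').
      * apply Rlt_le, Rdiv_lt_0_compat; auto.
      * right. field. lra.
      * set (t := delta / vnorm z) in *.
        assert (Ht : 0 < t) by (apply Rdiv_lt_0_compat; auto).
        assert (Hl : 0 <= t / (1 + t) <= 1).
        { split; [apply Rlt_le, Rdiv_lt_0_compat; lra|].
          apply (Rmult_le_reg_r (1 + t)); [lra|]. unfold Rdiv. rewrite Rmult_assoc, Rinv_l; lra. }
        pose proof (HG _ _ _ _ _ Hl Hz HG') as H0.
        replace (vadd (vscal (t / (1 + t)) z) (vscal (1 - t / (1 + t)) (vscal (- t) z)))
          with (vzero : E) in H0 by (vec; field; lra).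
        apply Hm in H0.
        replace (t / (1 + t) * (m - r) + (1 - t / (1 + t)) * s')
          with ((t * (m - r) + s') / (1 + t)) in H0 by (field; lra).
        apply (Rmult_le_compat_r (1 + t)) in H0; [|lra].
        replace ((t * (m - r) + s') / (1 + t) * (1 + t)) with (t * (m - r) + s') in H0 by (field; lra).
        assert (Htr : t * r <= Rabs (B - m)) by (pose proof (Rle_abs (B - m)); nra).
        apply (Rmult_le_reg_l t); auto. apply (Rle_trans _ _ _ Htr). right.
        unfold K, t. field. lra.
    + symmetry in Hn. apply vnorm_eq0 in Hn. subst z. rewrite vnorm_zero.
      apply Hm in Hz. lra.
  - destruct (mk_dual l (linf_norm_dual l K Hl HlK)) as [L HL].
    exists L. intros z s Hz. rewrite HL. apply Hlm. replace (m - (m - s)) with s by ring. exact Hz.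
Qed.

Section WeakSeparation.
Context {V : Banach}.
Variable P : (V -> R) -> Prop.
Hypothesis P_linf : forall phi, P phi -> is_linf phi.
Hypothesis P_zero : P (fun _ => 0).
Hypothesis P_comb : forall a phi psi, P phi -> P psi -> P (fun z => phi z + a * psi z).

Lemma kernel_span (Phi : list (V -> R)) : Forall P Phi ->
  forall l, is_linf l -> (forall z, Forall (fun phi => phi z = 0) Phi -> l z = 0) -> P l.
Proof.
  induction 1 as [|phi Phi Hphi HPhi IH]; intros l Hl Hk.
  - replace l with (fun _ : V => 0); auto. extensionality z. symmetry. apply Hk. constructor.
  - destruct (classic (exists e, Forall (fun psi => psi e = 0) Phi /\ phi e <> 0)) as [(e & He & Hne)|Hno].
    + assert (HP : P (fun z => l z + - (l e / phi e) * phi z)).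
      { apply IH.
        - destruct (P_linf _ Hphi) as [Ha Hs]. split; intros.
          + rewrite (proj1 Hl), Ha. ring.
          + rewrite (proj2 Hl), Hs. ring.
        - intros z Hz.
          assert (H0 : l (vadd z (vscal (- (phi z / phi e)) e)) = 0).
          { apply Hk. constructor.
            - rewrite (proj1 (P_linf _ Hphi)), (proj2 (P_linf _ Hphi)). field. auto.
            - rewrite Forall_forall in *. intros psi Hpsi.
              pose proof (P_linf _ (HPhi _ Hpsi)) as Hlin.
              rewrite (proj1 Hlin), (proj2 Hlin), (He _ Hpsi), (Hz _ Hpsi). ring. }
          rewrite (proj1 Hl), (proj2 Hl) in H0.
          replace (- (l e / phi e) * phi z) with (- (phi z / phi e) * l e) by (field; auto). exact H0. }
      replace l with (fun z => (l z + - (l e / phi e) * phi z) + (l e / phi e) * phi z).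
      * apply (P_comb _ _ _ HP Hphi).
      * extensionality z. ring.
    + apply IH; auto. intros z Hz. apply Hk. constructor; auto.
      apply NNPP. intros Hn. apply Hno. eauto.
Qed.

(** [P] stands for the functionals continuous in some weak topology. The sandwich theorem with the
    sum of the seminorms [|phi|] gives a linear [l] below this sum; such an [l] vanishes on the
    common kernel of [Phi], hence belongs to [P]. *)
Lemma weak_separation (Phi : list (V -> R)) (C : V -> Prop) (z0 : V) (eps : R) :
  Forall P Phi ->
  (forall x y l, 0 <= l <= 1 -> C x -> C y -> C (vadd (vscal l x) (vscal (1 - l) y))) ->
  (forall c, C c -> exists phi, In phi Phi /\ eps <= Rabs (phi (vsub c z0))) ->
  exists l, P l /\ forall c, C c -> eps <= l (vsub c z0).
Proof.
  intros HPhi HC Hfar.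
  pose (q := fun z : V => fold_right (fun phi acc => Rabs (phi z) + acc) 0 Phi).
  assert (Hq0 : forall z, 0 <= q z).
  { intros z. unfold q. clear. induction Phi as [|a L IH]; simpl; [lra|]. pose proof (Rabs_pos (a z)). lra. }
  assert (Hq : sublinear q).
  { unfold q. split.
    - intros x y. clear Hfar q Hq0. induction HPhi as [|phi L Hphi HL IH]; simpl; [lra|].
      rewrite (proj1 (P_linf _ Hphi)). pose proof (Rabs_triang (phi x) (phi y)). lra.
    - intros a x Ha. clear Hfar q Hq0. induction HPhi as [|phi L Hphi HL IH]; simpl; [lra|].
      rewrite (proj2 (P_linf _ Hphi)), Rabs_mult, (Rabs_right a) by lra. lra. }
  destruct (sandwich q (fun z r => (exists c, C c /\ z = vsub c z0) /\ r = eps))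
    as (l & Hl & Hlq & Hle); auto.
  - intros z1 r1 z2 r2 a Ha [(c1 & Hc1 & ->) ->] [(c2 & Hc2 & ->) ->]. split; [|ring].
    exists (vadd (vscal a c1) (vscal (1 - a) c2)). split; auto. vec.
  - intros z r [(c & Hc & ->) ->]. destruct (Hfar c Hc) as (phi & Hin & Hphi).
    apply (Rle_trans _ _ _ Hphi). unfold q. clear - Hin.
    induction Phi as [|psi L IH]; simpl in *; [tauto|].
    assert (0 <= fold_right (fun phi acc => Rabs (phi (vsub c z0)) + acc) 0 L).
    { clear. induction L as [|a L IH]; simpl; [lra|]. pose proof (Rabs_pos (a (vsub c z0))). lra. }
    pose proof (Rabs_pos (psi (vsub c z0))).
    destruct Hin as [->|Hin]; [lra|]. specialize (IH Hin). lra.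
  - exists l. split.
    + apply (kernel_span Phi); auto.
      assert (Hneg : forall z, Forall (fun phi => phi z = 0) Phi -> l z <= 0).
      { intros z Hz. apply (Rle_trans _ _ _ (Hlq z)). unfold q.
        clear - Hz. induction Hz as [|phi L H HL IH]; simpl; [lra|]. rewrite H, Rabs_R0. lra. }
      intros z Hz. apply Rle_antisym; auto.
      assert (l (vopp z) <= 0).
      { apply Hneg. rewrite Forall_forall in *. intros phi Hphi.
        rewrite (is_linf_opp _ _ (P_linf _ (HPhi _ Hphi))), (Hz _ Hphi). ring. }
      rewrite is_linf_opp in H; auto. lra.
    + intros c Hc. apply Hle. split; eauto.
Qed.
End WeakSeparation.

Section Goldstine.
Context {X : Banach}.

Lemma eval_dual (x : X) : is_dual (fun f : DualB X => ev f x).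
Proof.
  split; [split|].
  - intros; apply ev_addl.
  - intros; apply ev_scall.
  - exists (vnorm x). intros f. rewrite Rmult_comm. apply ev_bound.
Qed.
Definition J (x : X) : DualB (DualB X) := exist _ _ (eval_dual x).
Lemma ev_J x f : ev (J x) f = ev f x.
Proof. reflexivity. Qed.

(** Otherwise the evaluation at a single [g] separates [p] from the ball by [delta], and a multiple
    of a vector almost norming [g] contradicts this. The gap [delta] absorbs the fact that the norm
    of [g] need not be attained. *)
Lemma goldstine (p : DualB (DualB X)) (F : list (DualB X)) (delta : R) : 0 < delta ->
  exists z, vnorm z <= vnorm p /\ Forall (fun w => Rabs (ev w z - ev p w) < delta) F.
Proof.
  intros Hd. apply NNPP. intros Hno.
  destruct (@weak_separation (DualB (DualB X))
     (fun phi => exists g : DualB X, phi = fun P => ev P g)) with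
     (Phi := map (fun g (P : DualB (DualB X)) => ev P g) F)
     (C := fun P => exists z, vnorm z <= vnorm p /\ P = J z)
     (z0 := p) (eps := delta) as (l & (g & ->) & Hl).
  - intros phi (g & ->). split; intros; lin; auto.
  - exists vzero. extensionality P. lin. reflexivity.
  - intros a phi psi (g & ->) (h & ->). exists (vadd g (vscal a h)).
    extensionality P. lin. reflexivity.
  - apply Forall_forall. intros phi Hphi. apply in_map_iff in Hphi.
    destruct Hphi as (g & <- & _). eauto.
  - intros a b l Hl (x & Hx & ->) (y & Hy & ->).
    exists (vadd (vscal l x) (vscal (1 - l) y)). split.
    + eapply Rle_trans; [apply vnorm_tri|]. rewrite !vnorm_scal_pos by lra. nra.
    + apply ev_ext. intros f. lin. rewrite !ev_J. lin. reflexivity.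
  - intros P (z & Hz & ->). apply NNPP. intros Hn. apply Hno. exists z. split; auto.
    apply Forall_forall. intros w Hw. apply Rnot_le_lt. intros Hle. apply Hn.
    exists (fun P => ev P w). split; [apply in_map_iff; eauto|].
    rewrite ev_subl, ev_J. exact Hle.
  - pose proof (vnorm_ge0 p) as Hp.
    destruct (ev_norm_approx g (delta / (2 * (vnorm p + 1)))) as (d & Hd1 & Hd2).
    { apply Rdiv_lt_0_compat; lra. }
    specialize (Hl (J (vscal (- vnorm p) d))).
    assert (Hz : delta <= - vnorm p * ev g d - ev p g).
    { rewrite ev_subl, ev_J, ev_scalr in Hl. apply Hl.
      eexists; split; [|reflexivity]. rewrite vnorm_scal, Rabs_Ropp, Rabs_right by lra.
      rewrite <- (Rmult_1_r (vnorm p)) at 2. apply Rmult_le_compat_l; auto. }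
    pose proof (ev_bound p g) as Hpg. pose proof (Rle_abs (- ev p g)). rewrite Rabs_Ropp in H.
    assert (vnorm p * (delta / (2 * (vnorm p + 1))) <= delta / 2).
    { apply (Rmult_le_reg_r (vnorm p + 1)); [lra|].
      replace (vnorm p * (delta / (2 * (vnorm p + 1))) * (vnorm p + 1)) with (vnorm p * (delta / 2))
        by (field; lra). nra. }
    nra.
Qed.
End Goldstine.

(** * Fenchel duality for strong representative functions *)

Lemma dependent_choice_from {T : Type} (P : nat -> T -> Prop) (Q : nat -> T -> T -> Prop) (a0 : T) :
  (forall n a, P n a -> exists b, P (S n) b /\ Q n a b) -> P 0%nat a0 ->
  exists s : nat -> T, s 0%nat = a0 /\ forall n, P n (s n) /\ Q n (s n) (s (S n)).
Proof.
  intros Hstep H0.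
  pose (next := fun n a => epsilon (inhabits a0) (fun b => P (S n) b /\ Q n a b)).
  assert (Hnext : forall n a, P n a -> P (S n) (next n a) /\ Q n a (next n a)).
  { intros n a Ha. unfold next. apply epsilon_spec. auto. }
  pose (s := fix s n := match n with O => a0 | S m => next m (s m) end).
  assert (Hs : forall n, P n (s n)).
  { induction n; simpl; auto. apply Hnext; auto. }
  exists s. split; auto. intros n. split; auto. apply (Hnext n (s n)); auto.
Qed.

Lemma half_pow_pos n : 0 < (/ 2) ^ n.
Proof. apply pow_lt. lra. Qed.

Lemma half_pow_small c eps : 0 < eps -> exists N, forall n, (N <= n)%nat -> c * (/ 2) ^ n < eps.
Proof.
  intros He. destruct (pow_lt_1_zero (/ 2) ltac:(rewrite Rabs_right; lra) (eps / (Rabs c + 1)))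
    as [N HN].
  { pose proof (Rabs_pos c). apply Rdiv_lt_0_compat; lra. }
  exists N. intros n Hn. specialize (HN n Hn).
  pose proof (half_pow_pos n) as Hp. rewrite Rabs_right in HN by lra.
  pose proof (Rabs_pos c). pose proof (Rle_abs c).
  apply Rle_lt_trans with ((Rabs c + 1) * (/ 2) ^ n).
  - apply Rmult_le_compat_r; lra.
  - apply (Rmult_lt_compat_l (Rabs c + 1)) in HN; [|lra].
    replace ((Rabs c + 1) * (eps / (Rabs c + 1))) with eps in HN by (field; lra). exact HN.
Qed.

Lemma geometric_limit {E : Banach} (s : nat -> E) (rho : R) :
  (forall n, vnorm (vsub (s (S n)) (s n)) <= rho * (/ 2) ^ (S n)) ->
  exists l, forall n, vnorm (vsub l (s n)) <= rho * (/ 2) ^ n.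
Proof.
  intros Hs.
  assert (Hr : 0 <= rho).
  { specialize (Hs 0%nat). simpl in Hs. pose proof (vnorm_ge0 (vsub (s 1%nat) (s 0%nat))). lra. }
  (* The subtracted term makes the induction on [k] telescope. *)
  assert (Hk : forall n k, vnorm (vsub (s (n + k)%nat) (s n)) <= rho * (/ 2) ^ n - rho * (/ 2) ^ (n + k)).
  { intros n. induction k as [|k IH].
    - rewrite Nat.add_0_r. replace (vsub (s n) (s n)) with (vzero : E) by vec.
      rewrite vnorm_zero. lra.
    - pose proof (vnorm_sub_tri (s (n + S k)%nat) (s (n + k)%nat) (s n)).
      specialize (Hs (n + k)%nat). rewrite <- plus_n_Sm in *.
      replace ((/ 2) ^ S (n + k)) with (/ 2 * (/ 2) ^ (n + k)) in * by reflexivity. lra. }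
  assert (Hk' : forall n m, (n <= m)%nat -> vnorm (vsub (s m) (s n)) <= rho * (/ 2) ^ n).
  { intros n m Hnm. replace m with (n + (m - n))%nat by lia.
    eapply Rle_trans; [apply Hk|]. pose proof (half_pow_pos (n + (m - n))). nra. }
  destruct (vcomplete E s) as [l Hl].
  - intros eps He. destruct (half_pow_small (2 * rho) eps He) as [N HN].
    exists N. intros m n Hm Hn. specialize (HN N (le_n _)).
    pose proof (vnorm_sub_tri (s m) (s N) (s n)). rewrite (vnorm_sub_sym (s N)) in H.
    pose proof (Hk' N m Hm). pose proof (Hk' N n Hn). unfold vsub in *. lra.
  - exists l. intros n. apply Rle_eps. intros e He. destruct (Hl e He) as [N HN].
    specialize (HN (N + n)%nat ltac:(lia)).
    pose proof (vnorm_sub_tri l (s (N + n)%nat) (s n)). rewrite (vnorm_sub_sym l (s (N + n)%nat)) in H.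
    pose proof (Hk' n (N + n)%nat ltac:(lia)). unfold vsub in *. lra.
Qed.

Lemma ev_continuous {X : Banach} (g : DualB X) (y : X) eps : 0 < eps ->
  exists delta, 0 < delta /\ forall g' y', vnorm (vsub g' g) <= delta -> vnorm (vsub y' y) <= delta ->
    Rabs (ev g' y' - ev g y) < eps.
Proof.
  intros He. pose proof (vnorm_ge0 g) as Hg. pose proof (vnorm_ge0 y) as Hy.
  set (N := 1 + vnorm g + vnorm y).
  exists (Rmin 1 (eps / (2 * N))).
  assert (Hpos : 0 < eps / (2 * N)) by (apply Rdiv_lt_0_compat; unfold N; lra).
  split; [apply Rmin_glb_lt; lra|].
  intros g' y' H1 H2. set (d := Rmin 1 (eps / (2 * N))) in *.
  assert (Hd1 : d <= 1) by apply Rmin_l. assert (Hd2 : d <= eps / (2 * N)) by apply Rmin_r.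
  assert (HdN : d * N <= eps / 2).
  { apply (Rmult_le_compat_r N) in Hd2; [|unfold N; lra].
    replace (eps / (2 * N) * N) with (eps / 2) in Hd2 by (field; unfold N; lra). exact Hd2. }
  replace (ev g' y' - ev g y) with
    (ev (vsub g' g) (vsub y' y) + ev (vsub g' g) y + ev g (vsub y' y)) by (autorewrite with lin; ring).
  pose proof (ev_bound (vsub g' g) (vsub y' y)). pose proof (ev_bound (vsub g' g) y).
  pose proof (ev_bound g (vsub y' y)).
  pose proof (Rabs_triang (ev (vsub g' g) (vsub y' y) + ev (vsub g' g) y) (ev g (vsub y' y))).
  pose proof (Rabs_triang (ev (vsub g' g) (vsub y' y)) (ev (vsub g' g) y)).
  pose proof (vnorm_ge0 (vsub g' g)). pose proof (vnorm_ge0 (vsub y' y)).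
  assert (vnorm (vsub g' g) * vnorm (vsub y' y) <= d * 1) by (apply Rmult_le_compat; lra).
  assert (vnorm (vsub g' g) * vnorm y <= d * vnorm y) by (apply Rmult_le_compat_r; lra).
  assert (vnorm g * vnorm (vsub y' y) <= vnorm g * d) by (apply Rmult_le_compat_l; lra).
  unfold N in HdN. lra.
Qed.

Section Representable.
Context {X : Banach}.
Implicit Types (y z : X) (f g : DualB X) (p : DualB (DualB X)).

Definition epi_convex (H : X -> DualB X -> R -> Prop) : Prop :=
  forall y1 g1 r1 y2 g2 r2 l, 0 <= l <= 1 -> H y1 g1 r1 -> H y2 g2 r2 ->
    H (vadd (vscal l y1) (vscal (1 - l) y2)) (vadd (vscal l g1) (vscal (1 - l) g2))
      (l * r1 + (1 - l) * r2).
Definition epi_closed (H : X -> DualB X -> R -> Prop) : Prop :=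
  forall y g r, (forall eps, 0 < eps -> exists y' g' r', H y' g' r' /\
     vnorm (vsub y' y) < eps /\ vnorm (vsub g' g) < eps /\ Rabs (r' - r) < eps) -> H y g r.
Definition epi_upward (H : X -> DualB X -> R -> Prop) : Prop :=
  forall y g r s, H y g r -> r <= s -> H y g s.
Definition above_coupling (H : X -> DualB X -> R -> Prop) : Prop :=
  forall y g r, H y g r -> ev g y <= r.
Definition conj_above_coupling (H : X -> DualB X -> R -> Prop) : Prop :=
  forall f p eta, 0 < eta -> exists y g r, H y g r /\ ev p f - eta <= ev f y + ev p g - r.
Definition conj_le (H : X -> DualB X -> R -> Prop) f p (c : R) : Prop :=
  forall y g r, H y g r -> ev f y + ev p g - r <= c.
(** One functional at a time and from one side: for convex [C] this already says that [p] is in the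
    weak-* closure of [C], and it is the form in which the dual problem uses it. *)
Definition weakly_adherent (C : X -> Prop) p : Prop :=
  forall w eta, 0 < eta -> exists z, C z /\ ev p w - eta <= ev w z.
Definition convex_set (C : X -> Prop) : Prop :=
  forall x y l, 0 <= l <= 1 -> C x -> C y -> C (vadd (vscal l x) (vscal (1 - l) y)).

(* Fenchel duality: by [conj_above_coupling] the dual value of this problem is at most
   [- <p + P, f + u> - |f + u|^2 / (2 mu) - mu |p + P|^2 / 2 <= 0]. *)
Lemma almost_minimizer (H : X -> DualB X -> R -> Prop) (C : X -> Prop) f p mu eps :
  epi_convex H -> conj_above_coupling H -> convex_set C -> weakly_adherent C p ->
  0 < mu -> 0 < eps ->
  exists y g r z, H y g r /\ C z /\
    r - ev f y - ev p g + ev p f + mu / 2 * vnorm (vsub y z) ^ 2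
      + / (2 * mu) * vnorm (vsub g f) ^ 2 < eps.
Proof.
  intros HH Hconj HC Hadh Hmu Heps. apply NNPP. intros Hno.
  assert (Hge : forall y g r z, H y g r -> C z -> eps <=
    r - ev f y - ev p g + ev p f + mu / 2 * vnorm (vsub y z) ^ 2
      + / (2 * mu) * vnorm (vsub g f) ^ 2).
  { intros y g r z H1 H2. apply Rnot_lt_le. intros H3. apply Hno. exists y, g, r, z. auto. }
  clear Hno.
  assert (Hmu2 : 0 < / (2 * mu)) by (apply Rinv_0_lt_compat; lra).
  (* Epigraph of a value function in which the arguments of the linear and quadratic terms, but not
     those of [H], are shifted by [a]. It is therefore bounded near the origin, and a subgradient
     there is a dual solution. *)
  pose (G := fun (a : ProdB X (DualB X)) (s : R) => exists y g r z, H y g r /\ C z /\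
    r - ev f (vsub y (p1 a)) - ev p (vsub g (p2 a)) + ev p f
      + mu / 2 * vnorm (vsub (vsub y z) (p1 a)) ^ 2
      + / (2 * mu) * vnorm (vsub (vsub g f) (p2 a)) ^ 2 <= s).
  destruct (Hconj vzero vzero 1 Rlt_0_1) as (y0 & g0 & r0 & H0 & _).
  destruct (Hadh vzero 1 Rlt_0_1) as (z0 & Hz0 & _).
  destruct (@subgradient (ProdB X (DualB X)) G eps
    (r0 - ev f y0 - ev p g0 + ev p f + vnorm f + vnorm p
      + mu / 2 * (vnorm (vsub y0 z0) + 1) ^ 2
      + / (2 * mu) * (vnorm (vsub g0 f) + 1) ^ 2) 1) as (l & Hl).
  - intros a1 s1 a2 s2 t Ht (y1 & g1 & r1 & z1 & Hy1 & Hz1 & Hs1) (y2 & g2 & r2 & z2 & Hy2 & Hz2 & Hs2).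
    exists (vadd (vscal t y1) (vscal (1 - t) y2)), (vadd (vscal t g1) (vscal (1 - t) g2)),
      (t * r1 + (1 - t) * r2), (vadd (vscal t z1) (vscal (1 - t) z2)).
    split; [apply HH; auto|]. split; [apply HC; auto|]. lin.
    pose proof (norm_sq_convex (vsub (vsub y1 z1) (p1 a1)) (vsub (vsub y2 z2) (p1 a2)) t Ht) as N1.
    pose proof (norm_sq_convex (vsub (vsub g1 f) (p2 a1)) (vsub (vsub g2 f) (p2 a2)) t Ht) as N2.
    match goal with |- _ + mu / 2 * vnorm ?A ^ 2 + _ * vnorm ?B ^ 2 <= _ =>
      replace A with (vadd (vscal t (vsub (vsub y1 z1) (p1 a1))) (vscal (1 - t) (vsub (vsub y2 z2) (p1 a2)))) by vec;
      replace B with (vadd (vscal t (vsub (vsub g1 f) (p2 a1))) (vscal (1 - t) (vsub (vsub g2 f) (p2 a2)))) by vec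
    end.
    linin Hs1. linin Hs2.
    apply (Rmult_le_compat_l (mu / 2)) in N1; [|lra].
    apply (Rmult_le_compat_l (/ (2 * mu))) in N2; [|lra].
    apply (Rmult_le_compat_l t) in Hs1; [|lra].
    apply (Rmult_le_compat_l (1 - t)) in Hs2; [|lra]. lra.
  - lra.
  - intros s (y & g & r & z & Hy & Hz & Hs). specialize (Hge _ _ _ _ Hy Hz). linin Hs.
    replace (vsub (vsub y z) vzero) with (vsub y z) in Hs by vec.
    replace (vsub (vsub g f) vzero) with (vsub g f) in Hs by vec. lra.
  - intros a s t _ Ht Hta.
    eexists. split; [apply Rle_refl|].
    exists y0, g0, r0, z0. split; auto. split; auto.
    set (b := vscal (- t) a).
    assert (Hb : vnorm b <= 1).
    { unfold b. rewrite vnorm_scal, Rabs_Ropp, Rabs_right by lra. auto. }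
    rewrite prod_norm in Hb.
    pose proof (vnorm_ge0 (p1 b)). pose proof (vnorm_ge0 (p2 b)).
    pose proof (ev_le f (p1 b)). pose proof (ev_le p (p2 b)).
    pose proof (vnorm_ge0 f). pose proof (vnorm_ge0 p).
    assert (vnorm f * vnorm (p1 b) <= vnorm f * 1) by (apply Rmult_le_compat_l; lra).
    assert (vnorm p * vnorm (p2 b) <= vnorm p * 1) by (apply Rmult_le_compat_l; lra).
    assert (N1 : vnorm (vsub (vsub y0 z0) (p1 b)) ^ 2 <= (vnorm (vsub y0 z0) + 1) ^ 2).
    { apply pow_incr. split; [apply vnorm_ge0|]. unfold vsub at 1.
      eapply Rle_trans; [apply vnorm_tri|]. rewrite vnorm_opp. lra. }
    assert (N2 : vnorm (vsub (vsub g0 f) (p2 b)) ^ 2 <= (vnorm (vsub g0 f) + 1) ^ 2).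
    { apply pow_incr. split; [apply vnorm_ge0|]. unfold vsub at 1.
      eapply Rle_trans; [apply vnorm_tri|]. rewrite vnorm_opp. lra. }
    apply (Rmult_le_compat_l (mu / 2)) in N1; [|lra].
    apply (Rmult_le_compat_l (/ (2 * mu))) in N2; [|lra].
    rewrite !ev_subr. lra.
  - destruct (prod_dual l) as (u & P & HuP).
    pose (w := vadd f u). pose (w' := vadd p P).
    pose proof (vnorm_ge0 w) as Hw. pose proof (vnorm_ge0 w') as Hw'.
    (* [N] collects the factors by which [d0] and [e0] are scaled, so that their errors [eta] total
       at most [eps / 4]. *)
    set (N := vnorm w / mu + mu * vnorm w' + 1).
    assert (HN : 1 <= N).
    { unfold N. assert (0 <= vnorm w / mu) by (apply Rmult_le_pos; auto; left; apply Rinv_0_lt_compat; auto).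
      assert (0 <= mu * vnorm w') by (apply Rmult_le_pos; lra). lra. }
    pose (eta := eps / (4 * N)).
    assert (Heta : 0 < eta) by (apply Rdiv_lt_0_compat; lra).
    destruct (Hconj (vopp u) (vopp P) (eps / 8) ltac:(lra)) as (y & g & r & Hy & Hr).
    destruct (Hadh w (eps / 8) ltac:(lra)) as (z & Hz & Hzw).
    destruct (ev_norm_approx w eta Heta) as (d0 & Hd0 & Hd0').
    destruct (ev_norm_approx w' eta Heta) as (e0 & He0 & He0').
    (* These lengths minimize [mu / 2 * t ^ 2 - t * vnorm w] and
       [/ (2 * mu) * t ^ 2 - t * vnorm w'], so [d] and [e] nearly attain the conjugates of the two
       penalties. *)
    pose (d := vscal (vnorm w / mu) d0). pose (e := vscal (mu * vnorm w') e0).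
    assert (Hwm : 0 <= vnorm w / mu) by (apply Rmult_le_pos; auto; left; apply Rinv_0_lt_compat; auto).
    assert (Hwm' : 0 <= mu * vnorm w') by (apply Rmult_le_pos; lra).
    specialize (Hl (pr (vsub (vsub y z) d) (vsub (vsub g f) e))
      (r - ev f (vadd z d) - ev p (vadd f e) + ev p f + mu / 2 * vnorm d ^ 2
        + / (2 * mu) * vnorm e ^ 2)).
    assert (HG : G (pr (vsub (vsub y z) d) (vsub (vsub g f) e))
      (r - ev f (vadd z d) - ev p (vadd f e) + ev p f + mu / 2 * vnorm d ^ 2
        + / (2 * mu) * vnorm e ^ 2)).
    { exists y, g, r, z. split; auto. split; auto. right. rewrite p1_pr, p2_pr.
      replace (vsub y (vsub (vsub y z) d)) with (vadd z d) by vec.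
      replace (vsub g (vsub (vsub g f) e)) with (vadd f e) by vec.
      replace (vsub (vsub y z) (vsub (vsub y z) d)) with d by vec.
      replace (vsub (vsub g f) (vsub (vsub g f) e)) with e by vec. reflexivity. }
    specialize (Hl HG). rewrite HuP in Hl.
    assert (Hd : mu / 2 * vnorm d ^ 2 <= vnorm w ^ 2 / (2 * mu)).
    { unfold d. rewrite vnorm_scal_pos by auto.
      assert (S : (vnorm w / mu * vnorm d0) ^ 2 <= (vnorm w / mu) ^ 2).
      { apply pow_incr. split; [apply Rmult_le_pos; auto; apply vnorm_ge0|].
        rewrite <- (Rmult_1_r (vnorm w / mu)) at 2. apply Rmult_le_compat_l; auto. }
      apply (Rmult_le_compat_l (mu / 2)) in S; [|lra].
      replace (vnorm w ^ 2 / (2 * mu)) with (mu / 2 * (vnorm w / mu) ^ 2) by (field; lra). exact S. }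
    assert (He : / (2 * mu) * vnorm e ^ 2 <= mu * vnorm w' ^ 2 / 2).
    { unfold e. rewrite vnorm_scal_pos by auto.
      assert (S : (mu * vnorm w' * vnorm e0) ^ 2 <= (mu * vnorm w') ^ 2).
      { apply pow_incr. split; [apply Rmult_le_pos; auto; apply vnorm_ge0|].
        rewrite <- (Rmult_1_r (mu * vnorm w')) at 2. apply Rmult_le_compat_l; auto. }
      apply (Rmult_le_compat_l (/ (2 * mu))) in S; [|lra].
      replace (mu * vnorm w' ^ 2 / 2) with (/ (2 * mu) * (mu * vnorm w') ^ 2) by (field; lra). exact S. }
    assert (Hwd : vnorm w ^ 2 / mu - eta * (vnorm w / mu) <= ev w d).
    { unfold d. rewrite ev_scalr. apply (Rmult_le_compat_l (vnorm w / mu)) in Hd0'; auto.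
      eapply Rle_trans; [|exact Hd0']. right. field. lra. }
    assert (Hwe : mu * vnorm w' ^ 2 - eta * (mu * vnorm w') <= ev w' e).
    { unfold e. rewrite ev_scalr. apply (Rmult_le_compat_l (mu * vnorm w')) in He0'; auto.
      eapply Rle_trans; [|exact He0']. right. ring. }
    assert (HNe : eta * N = eps / 4) by (unfold eta; field; lra).
    unfold N in HNe.
    assert (Hww : - ev w' w <= vnorm w ^ 2 / (2 * mu) + mu * vnorm w' ^ 2 / 2).
    { pose proof (ev_bound w' w). pose proof (Rle_abs (- ev w' w)). rewrite Rabs_Ropp in *.
      assert (0 <= / (2 * mu) * (vnorm w - mu * vnorm w') ^ 2)
        by (apply Rmult_le_pos; [lra|apply pow2_ge_0]).
      assert (E : / (2 * mu) * (vnorm w - mu * vnorm w') ^ 2 =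
        vnorm w ^ 2 / (2 * mu) + mu * vnorm w' ^ 2 / 2 - vnorm w' * vnorm w) by (field; lra).
      lra. }
    assert (E2 : vnorm w ^ 2 / mu = 2 * (vnorm w ^ 2 / (2 * mu))) by (field; lra).
    unfold w, w' in Hwd, Hwe, Hww, Hzw. repeat (lin; autorewrite with lin in *).
    fold w in Hwd, Hww. fold w' in Hwe, Hww. fold w w' in HNe. lra.
Qed.

End Representable.

(** * Contact points of a closed convex function with [h >= c] and [h^* >= c] *)

Section StrongRepresentation.
Context {X : Banach}.
Variable H : X -> DualB X -> R -> Prop.
Hypothesis H_convex : epi_convex H.
Hypothesis H_closed : epi_closed H.
Hypothesis H_above : above_coupling H.
Hypothesis H_conj : conj_above_coupling H.
Implicit Types (y z : X) (f g : DualB X) (p : DualB (DualB X)).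

Definition contact y g : Prop := H y g (ev g y).

Lemma almost_contact_step y g r rho : 0 < rho -> H y g r -> r <= ev g y + rho ^ 2 / 40 ->
  exists y1 g1 r1, (H y1 g1 r1 /\ r1 <= ev g1 y1 + (rho / 2) ^ 2 / 40) /\
    vnorm (vsub y1 y) <= rho / 2 /\ vnorm (vsub g1 g) <= rho / 2.
Proof.
  intros Hrho Hy Hr.
  destruct (almost_minimizer H (fun z => z = y) g (J y) 1 ((rho / 2) ^ 2 / 40))
    as (y1 & g1 & r1 & z & H1 & -> & Hlt); auto; try lra.
  - intros a b l Hl -> ->. vec.
  - intros w eta He. exists y. rewrite ev_J. split; auto; lra.
  - nra.
  - rewrite !ev_J in Hlt.
    pose proof (H_above _ _ _ H1) as Ha1.
    assert (Hmid : (ev g y + ev g y1 + ev g1 y + ev g1 y1) / 4 <= r / 2 + r1 / 2).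
    { pose proof (H_above _ _ _ (H_convex _ _ _ _ _ _ (/ 2) ltac:(lra) Hy H1)) as Hm.
      linin Hm. lra. }
    assert (Hprod : - ((vnorm (vsub y1 y) ^ 2 + vnorm (vsub g1 g) ^ 2) / 2) <=
       ev g1 y1 - ev g y1 - ev g1 y + ev g y).
    { pose proof (ev_bound (vsub g1 g) (vsub y1 y)) as Hb.
      pose proof (Rle_abs (- ev (vsub g1 g) (vsub y1 y))) as Hb'. rewrite Rabs_Ropp in Hb'.
      pose proof (pow2_ge_0 (vnorm (vsub g1 g) - vnorm (vsub y1 y))).
      autorewrite with lin in *. nra. }
    assert (HD : (vnorm (vsub y1 y) ^ 2 + vnorm (vsub g1 g) ^ 2) / 2 < rho ^ 2 / 16) by lra.
    pose proof (pow2_ge_0 (vnorm (vsub y1 y))). pose proof (pow2_ge_0 (vnorm (vsub g1 g))).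
    exists y1, g1, r1. split; [split; auto|split].
    + lra.
    + apply Rnot_lt_le. intros Hc. assert ((rho / 2) ^ 2 <= vnorm (vsub y1 y) ^ 2) by (apply pow_incr; lra). lra.
    + apply Rnot_lt_le. intros Hc. assert ((rho / 2) ^ 2 <= vnorm (vsub g1 g) ^ 2) by (apply pow_incr; lra). lra.
Qed.

(** Halving [rho] at each step gives a Cauchy sequence along which the gap to the coupling tends to
    0; closedness of [H] makes its limit a contact point, and the displacements sum to at most
    [rho]. *)
Lemma brondsted_rockafellar y g r rho : 0 < rho -> H y g r -> r <= ev g y + rho ^ 2 / 40 ->
  exists y' g', contact y' g' /\ vnorm (vsub y' y) <= rho /\ vnorm (vsub g' g) <= rho.
Proof.
  intros Hrho Hy Hr.
  destruct (@dependent_choice_from (X * DualB X * R)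
    (fun n t => H (fst (fst t)) (snd (fst t)) (snd t) /\
       snd t <= ev (snd (fst t)) (fst (fst t)) + (rho * (/ 2) ^ n) ^ 2 / 40)
    (fun n t t' => vnorm (vsub (fst (fst t')) (fst (fst t))) <= rho * (/ 2) ^ (S n) /\
       vnorm (vsub (snd (fst t')) (snd (fst t))) <= rho * (/ 2) ^ (S n)) (y, g, r))
    as (s & Hs0 & Hs).
  - intros n [[y0 g0] r0] [H1 H2]; cbn [fst snd] in *.
    destruct (almost_contact_step y0 g0 r0 (rho * (/ 2) ^ n)) as (y1 & g1 & r1 & (H3 & H4) & H5 & H6); auto.
    { apply Rmult_lt_0_compat; auto. apply half_pow_pos. }
    exists (y1, g1, r1); cbn [fst snd].
    replace (rho * (/ 2) ^ S n) with (rho * (/ 2) ^ n / 2) by (simpl; field). auto.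
  - cbn [fst snd]. split; auto. rewrite pow_O, Rmult_1_r. auto.
  - destruct (geometric_limit (fun n => fst (fst (s n))) rho) as (y' & Hy').
    { intros n. apply Hs. }
    destruct (geometric_limit (fun n => snd (fst (s n))) rho) as (g' & Hg').
    { intros n. apply Hs. }
    exists y', g'. split; [|split].
    + apply H_closed. intros eps He.
      destruct (ev_continuous g' y' (eps / 2) ltac:(lra)) as (delta & Hd & Hcont).
      destruct (half_pow_small rho eps He) as [N1 HN1].
      destruct (half_pow_small rho delta Hd) as [N2 HN2].
      destruct (half_pow_small (rho ^ 2) (eps / 2) ltac:(lra)) as [N3 HN3].
      set (n := (N1 + N2 + N3)%nat).
      specialize (HN1 n ltac:(lia)). specialize (HN2 n ltac:(lia)). specialize (HN3 n ltac:(lia)).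
      specialize (Hy' n). specialize (Hg' n). cbn beta in *.
      destruct (Hs n) as [[H1 H2] _].
      rewrite vnorm_sub_sym in Hy'. rewrite vnorm_sub_sym in Hg'.
      exists (fst (fst (s n))), (snd (fst (s n))), (snd (s n)).
      split; auto. split; [lra|]. split; [lra|].
      specialize (Hcont (snd (fst (s n))) (fst (fst (s n))) ltac:(lra) ltac:(lra)).
      pose proof (H_above _ _ _ H1) as H3.
      assert (Hsm : (rho * (/ 2) ^ n) ^ 2 / 40 < eps / 2).
      { pose proof (half_pow_pos n).
        assert ((/ 2) ^ n <= 1) by (rewrite <- (pow1 n); apply pow_incr; lra).
        apply Rle_lt_trans with (rho ^ 2 * (/ 2) ^ n); auto.
        rewrite Rpow_mult_distr.
        assert (0 <= rho ^ 2) by apply pow2_ge_0.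
        assert (((/ 2) ^ n) ^ 2 <= (/ 2) ^ n) by nra.
        assert (rho ^ 2 * ((/ 2) ^ n) ^ 2 <= rho ^ 2 * (/ 2) ^ n) by (apply Rmult_le_compat_l; auto).
        assert (0 <= rho ^ 2 * ((/ 2) ^ n) ^ 2) by (apply Rmult_le_pos; auto; apply pow2_ge_0). lra. }
      apply Rabs_def1; apply Rabs_def2 in Hcont; lra.
    + specialize (Hy' 0%nat). cbn beta in Hy'. rewrite Hs0 in Hy'. cbn [fst snd pow] in Hy'. lra.
    + specialize (Hg' 0%nat). cbn beta in Hg'. rewrite Hs0 in Hg'. cbn [fst snd pow] in Hg'. lra.
Qed.

Lemma AM_GM (a b mu : R) : 0 < mu -> a * b <= mu / 2 * a ^ 2 + / (2 * mu) * b ^ 2.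
Proof.
  intros Hmu.
  assert (0 <= / (2 * mu) * (mu * a - b) ^ 2).
  { apply Rmult_le_pos; [|apply pow2_ge_0]. left. apply Rinv_0_lt_compat. lra. }
  replace (/ (2 * mu) * (mu * a - b) ^ 2) with (mu / 2 * a ^ 2 + / (2 * mu) * b ^ 2 - a * b)
    in H0 by (field; lra). lra.
Qed.

(* Minimizing around [(0, f)] with the weight [mu] gives contact points [(y, g)] with
   [<p - y, f - g>] at most [mu |p|^2 / 2] up to an arbitrarily small error. *)
Lemma contact_negative_infimum p f theta : 0 < theta ->
  exists y g, contact y g /\ ev p f - theta <= ev f y + ev p g - ev g y.
Proof.
  intros Hth. pose proof (vnorm_ge0 p) as Hp. set (N := vnorm p) in *.
  (* Chosen so that [mu / 2 * (N + 1) ^ 2] equals [theta / 4]; the [+ 1] leaves room for the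
     displacement [rho], which is added to [N] below. *)
  pose (mu := theta / (2 * (N + 1) ^ 2)).
  assert (HN2 : 0 < (N + 1) ^ 2) by (apply pow_lt; lra).
  assert (Hmu : 0 < mu) by (apply Rdiv_lt_0_compat; lra).
  assert (Hmu1 : mu / 2 * (N + 1) ^ 2 = theta / 4) by (unfold mu; field; lra).
  (* [rho <= mu] keeps [/ (2 * mu) * rho ^ 2] below [rho / 2], and the last bound controls the other
     errors made in moving to a contact point. *)
  assert (Hrho : exists rho, 0 < rho /\ rho <= 1 /\ rho <= mu /\ rho * (N + 2) <= theta / 8).
  { exists (Rmin 1 (Rmin mu (theta / (8 * (N + 2))))).
    assert (0 < theta / (8 * (N + 2))) by (apply Rdiv_lt_0_compat; lra).
    split; [repeat apply Rmin_glb_lt; lra|]. split; [apply Rmin_l|]. split.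
    - eapply Rle_trans; [apply Rmin_r|apply Rmin_l].
    - apply Rle_trans with (theta / (8 * (N + 2)) * (N + 2)).
      + apply Rmult_le_compat_r; [lra|]. eapply Rle_trans; [apply Rmin_r|apply Rmin_r].
      + right. field. lra. }
  destruct Hrho as (rho & Hrho0 & Hrho1 & Hrhomu & HrhoN).
  destruct (almost_minimizer H (fun z => z = vzero) f (J vzero) mu (Rmin (theta / 4) (rho ^ 2 / 40)))
    as (y & g & r & z & Hy & -> & Hlt); auto.
  - intros a b l Hl -> ->. vec.
  - intros w eta He. exists vzero. rewrite ev_J. split; auto; lra.
  - apply Rmin_glb_lt; nra.
  - rewrite !ev_J, !ev_zeror in Hlt. replace (vsub y vzero) with y in Hlt by vec.
    pose proof (Rmin_l (theta / 4) (rho ^ 2 / 40)). pose proof (Rmin_r (theta / 4) (rho ^ 2 / 40)).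
    pose proof (H_above _ _ _ Hy) as Hab.
    set (d := vnorm y) in *. set (e := vnorm (vsub g f)) in *.
    assert (Hd : 0 <= d) by apply vnorm_ge0. assert (He : 0 <= e) by apply vnorm_ge0.
    pose proof (ev_bound (vsub g f) y) as Hgf. fold e d in Hgf. rewrite ev_subl in Hgf.
    apply Rabs_le_inv in Hgf. pose proof (AM_GM d e mu Hmu) as Ham.
    destruct (brondsted_rockafellar y g r rho Hrho0 Hy) as (y' & g' & Hc & Hy' & Hg'); [lra|].
    exists y', g'. split; auto.
    set (d1 := vsub y' y) in *. set (d2 := vsub g' g) in *.
    assert (Ey : y' = vadd y d1) by (unfold d1; vec).
    assert (Eg : g' = vadd g d2) by (unfold d2; vec).
    pose proof (vnorm_ge0 d1) as Hd1. pose proof (vnorm_ge0 d2) as Hd2.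
    assert (Hbd : forall s t s' t', 0 <= s -> 0 <= t -> s <= s' -> t <= t' -> s * t <= s' * t')
      by (intros; apply Rmult_le_compat; auto).
    assert (B1 : ev (vsub g f) d1 <= e * rho).
    { eapply Rle_trans; [apply ev_le|]. apply Hbd; auto; unfold e; apply vnorm_ge0 || lra. }
    assert (B2 : ev d2 y <= rho * d).
    { eapply Rle_trans; [apply ev_le|]. apply Hbd; auto; unfold d; apply vnorm_ge0 || lra. }
    assert (B3 : ev d2 d1 <= rho * rho).
    { eapply Rle_trans; [apply ev_le|]. apply Hbd; auto. }
    assert (B4 : - ev p (vsub g f) <= N * e).
    { pose proof (ev_bound p (vsub g f)) as Hb. apply Rabs_le_inv in Hb. fold N e in Hb. lra. }
    assert (B5 : - ev p d2 <= N * rho).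
    { pose proof (ev_bound p d2) as Hb. apply Rabs_le_inv in Hb. fold N in Hb.
      assert (N * vnorm d2 <= N * rho) by (apply Rmult_le_compat_l; lra). lra. }
    (* The penalties bounded through [Hlt] absorb the terms linear in [d] and [e], at the price of
       [mu / 2 * (N + rho) ^ 2 + / (2 * mu) * rho ^ 2]. *)
    pose proof (AM_GM (N + rho) e mu Hmu) as A1.
    pose proof (AM_GM d rho mu Hmu) as A2.
    assert (A3 : mu / 2 * (N + rho) ^ 2 <= theta / 4).
    { rewrite <- Hmu1. apply Rmult_le_compat_l; [lra|]. apply pow_incr. lra. }
    assert (A4 : / (2 * mu) * rho ^ 2 <= rho / 2).
    { apply (Rmult_le_reg_l (2 * mu)); [lra|].
      replace (2 * mu * (/ (2 * mu) * rho ^ 2)) with (rho * rho) by (field; lra).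
      assert (rho * rho <= rho * mu) by (apply Rmult_le_compat_l; lra). lra. }
    assert (A5 : rho * rho <= rho * 1) by (apply Rmult_le_compat_l; lra).
    rewrite Ey, Eg. autorewrite with lin in *. lra.
Qed.

(** Binary combinations already generate the convex hull of the graph of [c] over the contact set.
    It is contained in the convex set [H], so its points can still be corrected by
    [brondsted_rockafellar]. *)
Inductive contact_hull : X -> DualB X -> R -> Prop :=
  | hull_base y g : contact y g -> contact_hull y g (ev g y)
  | hull_comb y1 g1 r1 y2 g2 r2 l : 0 <= l <= 1 ->
      contact_hull y1 g1 r1 -> contact_hull y2 g2 r2 ->
      contact_hull (vadd (vscal l y1) (vscal (1 - l) y2)) (vadd (vscal l g1) (vscal (1 - l) g2))
        (l * r1 + (1 - l) * r2).

(** The condition [<p - y, f - g> >= 0] expanded: [(p, f)] is in the Gossez closure of the contact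
    set. *)
Definition related p f : Prop :=
  forall y g, contact y g -> ev f y + ev p g - ev g y <= ev p f.

(** Relatedness is affine in [(y, g, r)], hence passes to [contact_hull] and makes the unpenalized
    part nonnegative there; both distances are thus at most [tau]. Since [C] is bounded,
    [r - <g, y>] is then of order [tau], small enough to move on to a contact point. *)
Lemma contact_approximation (C : X -> Prop) p f K rho :
  convex_set C -> weakly_adherent C p -> (forall z, C z -> vnorm z <= K) -> related p f ->
  0 < rho ->
  exists z y g, C z /\ contact y g /\ vnorm (vsub y z) <= rho /\ vnorm (vsub g f) <= rho.
Proof.
  intros HC Hadh HK Hrel Hrho.
  set (N := Rabs K + vnorm p + 1).
  pose proof (Rabs_pos K). pose proof (vnorm_ge0 p).
  assert (Htau : exists tau, 0 < tau /\ tau <= rho / 2 /\ tau <= 1 /\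
      tau * (N + 2) <= (rho / 2) ^ 2 / 40).
  { exists (Rmin (rho / 2) (Rmin 1 ((rho / 2) ^ 2 / 40 / (N + 2)))).
    assert (0 < (rho / 2) ^ 2 / 40 / (N + 2)).
    { apply Rdiv_lt_0_compat; [nra|unfold N; lra]. }
    split; [repeat apply Rmin_glb_lt; lra|]. split; [apply Rmin_l|]. split.
    - eapply Rle_trans; [apply Rmin_r|apply Rmin_l].
    - apply Rle_trans with ((rho / 2) ^ 2 / 40 / (N + 2) * (N + 2)).
      + apply Rmult_le_compat_r; [unfold N; lra|]. eapply Rle_trans; [apply Rmin_r|apply Rmin_r].
      + right. field. unfold N; lra. }
  destruct Htau as (tau & Ht0 & Ht1 & Ht2 & Ht3).
  destruct (almost_minimizer contact_hull C f p 1 (tau ^ 2 / 2))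
    as (y & g & r & z & Hy & Hz & Hlt); auto; try lra.
  - intros y1 g1 r1 y2 g2 r2 l Hl Hc1 Hc2. apply hull_comb; auto.
  - intros f' p' eta He. destruct (contact_negative_infimum p' f' eta He) as (y & g & Hc & Hle).
    exists y, g, (ev g y). split; auto. apply hull_base; auto.
  - nra.
  - assert (Hrel' : 0 <= r - ev f y - ev p g + ev p f).
    { clear Hlt. induction Hy as [y g Hc|y1 g1 r1 y2 g2 r2 l Hl Hh1 IH1 Hh2 IH2].
      - specialize (Hrel y g Hc). lra.
      - lin. apply (Rmult_le_compat_l l) in IH1; [|lra].
        apply (Rmult_le_compat_l (1 - l)) in IH2; lra. }
    assert (HH : H y g r).
    { clear - Hy H_convex. induction Hy; auto. }
    pose proof (pow2_ge_0 (vnorm (vsub y z))). pose proof (pow2_ge_0 (vnorm (vsub g f))).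
    assert (Hyz : vnorm (vsub y z) <= tau).
    { apply Rnot_lt_le. intros Hc. assert (tau ^ 2 <= vnorm (vsub y z) ^ 2) by (apply pow_incr; lra). lra. }
    assert (Hgf : vnorm (vsub g f) <= tau).
    { apply Rnot_lt_le. intros Hc. assert (tau ^ 2 <= vnorm (vsub g f) ^ 2) by (apply pow_incr; lra). lra. }
    assert (Hr : r <= ev g y + (rho / 2) ^ 2 / 40).
    { pose proof (ev_bound (vsub g f) y) as B1. apply Rabs_le_inv in B1.
      pose proof (ev_bound p (vsub g f)) as B2. apply Rabs_le_inv in B2.
      assert (Hny : vnorm y <= Rabs K + tau).
      { pose proof (vnorm_sub_tri y z vzero) as Hn.
        replace (vsub y vzero) with y in Hn by vec. replace (vsub z vzero) with z in Hn by vec.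
        specialize (HK z Hz). pose proof (Rle_abs K). lra. }
      pose proof (vnorm_ge0 y). pose proof (vnorm_ge0 (vsub g f)).
      assert (vnorm (vsub g f) * vnorm y <= tau * (Rabs K + tau)) by (apply Rmult_le_compat; lra).
      assert (vnorm p * vnorm (vsub g f) <= vnorm p * tau) by (apply Rmult_le_compat_l; lra).
      autorewrite with lin in *. unfold N in Ht3. nra. }
    destruct (brondsted_rockafellar y g r (rho / 2) ltac:(lra) HH Hr) as (y' & g' & Hc & Hy' & Hg').
    exists z, y', g'. split; auto. split; auto. split.
    + pose proof (vnorm_sub_tri y' y z). lra.
    + pose proof (vnorm_sub_tri g' g f). lra.
Qed.

(** [C] is the part of the ball of radius [|p|] on which all functionals in [F] are within
    [delta / 2] of [p]; Goldstine's theorem for the list [w :: F] makes it weakly-* adherent to [p].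
    The factor [2 * B] in [rho] pays for the move from [z] to the contact point. *)
Lemma related_weak_approximation p f (F : list (DualB X)) delta : related p f -> 0 < delta ->
  exists y g, contact y g /\ vnorm y <= vnorm p + delta /\ vnorm (vsub g f) <= delta /\
    Forall (fun w => Rabs (ev w y - ev p w) <= delta) F.
Proof.
  intros Hrel Hd.
  assert (HB : exists B, 0 < B /\ Forall (fun w => vnorm w <= B) F).
  { clear. induction F as [|w F (B & HB & HF)].
    - exists 1. split; [lra|constructor].
    - exists (B + vnorm w). pose proof (vnorm_ge0 w). split; [lra|]. constructor; [lra|].
      eapply Forall_impl; [|exact HF]. cbn beta; intros; lra. }
  destruct HB as (B & HB & HF).
  pose (rho := Rmin delta (delta / (2 * B))).
  assert (Hrho : 0 < rho).
  { apply Rmin_glb_lt; auto. apply Rdiv_lt_0_compat; lra. }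
  destruct (contact_approximation
    (fun z => vnorm z <= vnorm p /\ Forall (fun w => Rabs (ev w z - ev p w) <= delta / 2) F)
    p f (vnorm p) rho) as (z & y & g & (Hz1 & Hz2) & Hc & Hy & Hg); auto.
  - intros a b l Hl [Ha1 Ha2] [Hb1 Hb2]. split.
    + eapply Rle_trans; [apply vnorm_tri|]. rewrite !vnorm_scal_pos by lra.
      apply (Rmult_le_compat_l l) in Ha1; [|lra].
      apply (Rmult_le_compat_l (1 - l)) in Hb1; lra.
    + rewrite Forall_forall in *. intros w Hw. specialize (Ha2 w Hw). specialize (Hb2 w Hw).
      apply Rabs_le_inv in Ha2. apply Rabs_le_inv in Hb2. lin. apply Rabs_le.
      destruct Ha2 as [A1 A2], Hb2 as [B1 B2].
      apply (Rmult_le_compat_l l) in A1; [|lra]. apply (Rmult_le_compat_l l) in A2; [|lra].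
      apply (Rmult_le_compat_l (1 - l)) in B1; [|lra]. apply (Rmult_le_compat_l (1 - l)) in B2; [|lra].
      lra.
  - intros w eta He.
    destruct (goldstine p (w :: F) (Rmin eta (delta / 2))) as (z & Hz & HzF).
    { apply Rmin_glb_lt; lra. }
    inversion HzF as [|w' F' Hw HF']; subst.
    pose proof (Rmin_l eta (delta / 2)). pose proof (Rmin_r eta (delta / 2)).
    exists z. split; [split; auto|].
    + eapply Forall_impl; [|exact HF']. cbn beta; intros; lra.
    + apply Rabs_def2 in Hw. lra.
  - tauto.
  - exists y, g. split; auto.
    assert (Hr1 : rho <= delta) by apply Rmin_l.
    assert (Hr2 : rho * B <= delta / 2).
    { apply Rle_trans with (delta / (2 * B) * B); [|right; field; lra].
      apply Rmult_le_compat_r; [lra|apply Rmin_r]. }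
    split; [|split; [lra|]].
    + pose proof (vnorm_sub_tri y z vzero) as Hn.
      replace (vsub y vzero) with y in Hn by vec. replace (vsub z vzero) with z in Hn by vec. lra.
    + rewrite Forall_forall in *. intros w Hw. specialize (HF w Hw). specialize (Hz2 w Hw).
      pose proof (ev_bound w (vsub y z)) as Hb. pose proof (vnorm_ge0 w). pose proof (vnorm_ge0 (vsub y z)).
      assert (vnorm w * vnorm (vsub y z) <= B * rho) by (apply Rmult_le_compat; lra).
      apply Rabs_le_inv in Hb. apply Rabs_le_inv in Hz2. rewrite ev_subr in Hb.
      apply Rabs_le. lra.
Qed.

(** On the segment from [(y, g)] to [(a, b)] the inequality [h >= c] starts as an equality; dividing
    by the parameter [t] and letting it tend to 0 gives the subgradient inequality. *)
Lemma contact_conj_le y g : contact y g -> conj_le H g (J y) (ev g y).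
Proof.
  intros Hc a b r Hab. rewrite ev_J.
  set (k := ev g a + ev b y).
  assert (Ht : forall t, 0 < t <= 1 -> (1 - t) * (k - ev g y) + t * ev b a <= r).
  { intros t Ht.
    pose proof (H_above _ _ _ (H_convex _ _ _ _ _ _ t ltac:(lra) Hab Hc)) as Hm.
    linin Hm. apply (Rmult_le_reg_l t); [lra|]. unfold k. nra. }
  assert (k - ev g y <= r); [|unfold k in *; lra].
  apply Rle_eps. intros e He.
  pose (D := Rabs (k - ev g y) + Rabs (ev b a) + 1).
  pose proof (Rabs_pos (k - ev g y)). pose proof (Rabs_pos (ev b a)).
  assert (Hmin : 0 < Rmin 1 (e / D)).
  { apply Rmin_glb_lt; [lra|]. apply Rdiv_lt_0_compat; unfold D; lra. }
  specialize (Ht (Rmin 1 (e / D)) (conj Hmin (Rmin_l _ _))).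
  assert (HD : Rmin 1 (e / D) * D <= e).
  { apply Rle_trans with (e / D * D); [|right; field; unfold D; lra].
    apply Rmult_le_compat_r; [unfold D; lra|apply Rmin_r]. }
  set (t := Rmin 1 (e / D)) in *. unfold D in HD.
  pose proof (Rle_abs (k - ev g y)). pose proof (Rle_abs (- ev b a)) as Hb. rewrite Rabs_Ropp in Hb.
  nra.
Qed.

(** The inequality at contact points passes to the limit along an approximation of [(p, f)]: weak
    closeness is tested on [b] and [f] only, and since [y] stays bounded, norm closeness of [g] to
    [f] handles the product [<g, y>]. *)
Lemma related_conj_le p f : related p f -> conj_le H f p (ev p f).
Proof.
  intros Hrel a b r Hab. apply Rle_eps. intros e He.
  pose proof (vnorm_ge0 a). pose proof (vnorm_ge0 p).
  set (D := vnorm a + vnorm p + 4).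
  pose (delta := Rmin 1 (e / D)).
  assert (Hdel : 0 < delta).
  { apply Rmin_glb_lt; [lra|]. apply Rdiv_lt_0_compat; unfold D; lra. }
  assert (HD : delta * D <= e).
  { apply Rle_trans with (e / D * D); [|right; field; unfold D; lra].
    apply Rmult_le_compat_r; [unfold D; lra|apply Rmin_r]. }
  assert (Hd1 : delta <= 1) by apply Rmin_l.
  destruct (related_weak_approximation p f (b :: f :: nil) delta Hrel Hdel)
    as (y & g & Hc & Hy & Hg & HF).
  inversion HF as [|? ? Hb HF' E1]; subst. inversion HF' as [|? ? Hf _ E2]; subst.
  apply Rabs_le_inv in Hb. apply Rabs_le_inv in Hf.
  pose proof (contact_conj_le y g Hc a b r Hab) as Hle. rewrite ev_J in Hle.
  pose proof (ev_bound (vsub g f) a) as B1. apply Rabs_le_inv in B1.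
  pose proof (ev_bound (vsub g f) y) as B2. apply Rabs_le_inv in B2.
  pose proof (vnorm_ge0 y). pose proof (vnorm_ge0 (vsub g f)).
  assert (vnorm (vsub g f) * vnorm a <= delta * vnorm a) by (apply Rmult_le_compat; lra).
  assert (vnorm (vsub g f) * vnorm y <= delta * (vnorm p + 1)) by (apply Rmult_le_compat; lra).
  rewrite ev_subl in B1, B2. unfold D in HD. lra.
Qed.

Lemma conj_le_related p f : conj_le H f p (ev p f) -> related p f.
Proof. intros Hc y g Hy. apply (Hc y g _ Hy). Qed.

Lemma contact_related y g : contact y g -> related (J y) g.
Proof. intros Hc. apply conj_le_related. rewrite ev_J. apply contact_conj_le; auto. Qed.

(** For a point of [X] the singleton is an admissible [C], so the approximating contact points
    converge in norm and [H_closed] applies. *)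
Lemma related_contact x f : related (J x) f -> contact x f.
Proof.
  intros Hrel. apply H_closed. intros eps He.
  destruct (ev_continuous f x eps He) as (delta & Hd & Hcont).
  pose (rho := Rmin delta (eps / 2)).
  assert (Hrho : 0 < rho) by (apply Rmin_glb_lt; lra).
  destruct (contact_approximation (fun z => z = x) (J x) f (vnorm x) rho)
    as (z & y & g & -> & Hc & Hy & Hg); auto.
  - intros a b l Hl -> ->. vec.
  - intros w eta Heta. exists x. rewrite ev_J. split; auto; lra.
  - intros z ->. lra.
  - assert (rho <= delta) by apply Rmin_l. assert (rho <= eps / 2) by apply Rmin_r.
    exists y, g, (ev g y). split; auto. split; [lra|]. split; [lra|].
    apply Hcont; lra.
Qed.

End StrongRepresentation.

(** * Fenchel-Moreau and open mapping theorems *)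

Lemma linf_bounded_above_zero {E : Banach} (phi : E -> R) (c : R) :
  is_linf phi -> (forall x, phi x <= c) -> forall x, phi x = 0.
Proof.
  intros Hphi Hc.
  assert (Hle : forall x, phi x <= 0).
  { intros x. apply Rnot_lt_le. intros Hlt.
    specialize (Hc (vscal ((Rabs c + 1) / phi x) x)). rewrite (proj2 Hphi) in Hc.
    replace ((Rabs c + 1) / phi x * phi x) with (Rabs c + 1) in Hc by (field; lra).
    pose proof (Rle_abs c). lra. }
  intros x. apply Rle_antisym; auto. specialize (Hle (vopp x)).
  rewrite is_linf_opp in Hle; auto. lra.
Qed.

(** The supremum of [P] is the splitting value. This separates the two conjugates contained in one
    joint inequality. *)
Lemma sum_bound_split (P Q : R -> Prop) (c : R) : (exists x, P x) -> (exists y, Q y) ->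
  (forall x y, P x -> Q y -> x + y <= c) ->
  exists c1 c2, (forall x, P x -> x <= c1) /\ (forall y, Q y -> y <= c2) /\ c1 + c2 <= c.
Proof.
  intros [x0 Hx0] [y0 Hy0] Hxy.
  destruct (completeness P) as [s [Hs1 Hs2]].
  - exists (c - y0). intros x Hx. specialize (Hxy x y0 Hx Hy0). lra.
  - eauto.
  - exists s, (c - s). split; [|split; [|lra]].
    + intros x Hx. apply Hs1; auto.
    + intros y Hy. assert (s <= c - y); [|lra]. apply Hs2.
      intros x Hx. specialize (Hxy x y Hx Hy). lra.
Qed.

Lemma affine_unbounded a b c : 0 < b -> (forall N, 0 <= N -> a + N * b <= c) -> False.
Proof.
  intros Hb HN. specialize (HN ((Rabs (c - a) + 1) / b)).
  replace ((Rabs (c - a) + 1) / b * b) with (Rabs (c - a) + 1) in HN by (field; lra).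
  pose proof (Rle_abs (c - a)). pose proof (Rabs_pos (c - a)).
  assert (0 <= (Rabs (c - a) + 1) / b) by (apply Rlt_le, Rdiv_lt_0_compat; lra). specialize (HN H1). lra.
Qed.

Section FenchelMoreau.
Context {X : Banach}.
Variable H : X -> DualB X -> R -> Prop.
Hypothesis H_convex : epi_convex H.
Hypothesis H_closed : epi_closed H.
Hypothesis H_upward : epi_upward H.
Hypothesis H_nonempty : exists y g r, H y g r.
Hypothesis H_minorant : exists u p c, conj_le H u p c.

(** A hyperplane separates [(x, g, r)] from the epigraph with gap [eps]. If its vertical coefficient
    [s] is positive, division by [s] gives an affine minorant that contradicts the hypothesis; if
    [s = 0], large multiples of it are added to the given affine minorant. *)
Lemma fenchel_moreau x g r :
  (forall u p c, conj_le H u p c -> ev u x + ev p g - c <= r) -> H x g r.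
Proof.
  intros Hbi. apply NNPP. intros Hno.
  assert (Hfar : exists eps, 0 < eps /\ forall y' g' r', H y' g' r' ->
     eps <= vnorm (vsub y' x) + vnorm (vsub g' g) + Rabs (r' - r)).
  { apply NNPP. intros Hn. apply Hno. apply H_closed. intros eps He. apply NNPP. intros Hn'.
    apply Hn. exists eps. split; auto. intros y' g' r' Hy. apply Rnot_lt_le. intros Hlt. apply Hn'.
    exists y', g', r'. pose proof (vnorm_ge0 (vsub y' x)). pose proof (vnorm_ge0 (vsub g' g)).
    pose proof (Rabs_pos (r' - r)). repeat split; auto; lra. }
  destruct Hfar as (eps & He & Hfar).
  destruct (@sandwich (ProdB (ProdB X (DualB X)) RB) (fun z => 1 * vnorm z)
    (fun z t => (exists y' g' r', H y' g' r' /\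
        z = pr (pr (vsub y' x) (vsub g' g)) (vsub (r' : RB) (r : RB))) /\ t = eps))
    as (l & Hl & Hlq & Hle).
  - apply sublinear_norm. lra.
  - intros z1 t1 z2 t2 a Ha [(y1 & g1 & r1 & H1 & ->) ->] [(y2 & g2 & r2 & H2 & ->) ->].
    split; [|ring]. do 3 eexists. split; [apply (H_convex _ _ _ _ _ _ a Ha H1 H2)|].
    change (a * r1 + (1 - a) * r2) with (vadd (vscal a (r1 : RB)) (vscal (1 - a) (r2 : RB))).
    pvec.
  - intros z t [(y' & g' & r' & Hy & ->) ->]. rewrite !prod_norm. lin.
    rewrite Rmult_1_l. apply (Hfar _ _ _ Hy).
  - destruct (mk_dual l (linf_norm_dual l 1 Hl Hlq)) as [L HL].
    destruct (prod_dual L) as (M & sg & HM). destruct (prod_dual M) as (u & p & Hup).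
    set (s := ev sg (1 : RB)).
    assert (Hsep : forall y' g' r', H y' g' r' ->
      eps <= ev u (vsub y' x) + ev p (vsub g' g) + s * (r' - r)).
    { intros y' g' r' Hy.
      specialize (Hle _ eps (conj (ex_intro _ y' (ex_intro _ g' (ex_intro _ r' (conj Hy eq_refl)))) eq_refl)).
      rewrite <- HL, HM, Hup in Hle. linin Hle. lin.
      rewrite (ev_RB sg r'), (ev_RB sg r) in Hle. fold s in Hle. lra. }
    destruct H_nonempty as (y0 & g0 & r0 & H0).
    assert (Hs : 0 <= s).
    { apply Rnot_lt_le. intros Hs.
      apply (affine_unbounded (- (ev u (vsub y0 x) + ev p (vsub g0 g) + s * (r0 - r))) (- s) (- eps)); [lra|].
      intros N HN. specialize (Hsep y0 g0 (r0 + N)). 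
      assert (H y0 g0 (r0 + N)) by (apply (H_upward _ _ _ _ H0); lra). specialize (Hsep H1). lra. }
    destruct Hs as [Hs|Hs].
    + assert (Hc : conj_le H (vscal (- / s) u) (vscal (- / s) p)
         (ev (vscal (- / s) u) x + ev (vscal (- / s) p) g - r - eps / s)).
      { intros y' g' r' Hy. specialize (Hsep _ _ _ Hy). autorewrite with lin in *.
        apply (Rmult_le_reg_l s); auto. unfold Rdiv.
        apply Rminus_le. 
        match goal with |- ?A <= 0 => replace A with
          (eps - (ev u y' - ev u x + (ev p g' - ev p g) + s * (r' - r))) by (field; lra) end. lra. }
      specialize (Hbi _ _ _ Hc).
      assert (0 < eps / s) by (apply Rdiv_lt_0_compat; auto). lra.
    + destruct H_minorant as (u1 & p1' & c1 & Hc1).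
      apply (affine_unbounded (ev u1 x + ev p1' g - c1) eps r He). intros N HN.
      assert (Hc : conj_le H (vsub u1 (vscal N u)) (vsub p1' (vscal N p))
         (c1 - N * (eps + ev u x + ev p g))).
      { intros y' g' r' Hy. specialize (Hsep _ _ _ Hy). specialize (Hc1 _ _ _ Hy).
        rewrite <- Hs in Hsep. autorewrite with lin in *.
        apply (Rmult_le_compat_l N) in Hsep; auto. lra. }
      specialize (Hbi _ _ _ Hc). autorewrite with lin in Hbi. lra.
Qed.
End FenchelMoreau.

(** * A Robinson-Ursescu theorem: bounded preimages in a closed convex set *)

Section OpenMapping.
Context {P Z : Banach}.
Variables (K : P -> Prop) (L : P -> Z) (W : Z -> Prop) (M : R).
Hypothesis K_convex : convex_set K.
Hypothesis K_closed : forall k, (forall eps, 0 < eps -> exists k', K k' /\ vnorm (vsub k' k) < eps) -> K k.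
Hypothesis L_add : forall a b, L (vadd a b) = vadd (L a) (L b).
Hypothesis L_scal : forall r a, L (vscal r a) = vscal r (L a).
Hypothesis L_bound : forall a, vnorm (L a) <= M * vnorm a.
Hypothesis W_add : forall a b, W a -> W b -> W (vadd a b).
Hypothesis W_scal : forall r a, W a -> W (vscal r a).
Hypothesis W_closed : forall z, (forall eps, 0 < eps -> exists w, W w /\ vnorm (vsub w z) < eps) -> W z.
Hypothesis image_in_W : forall k, K k -> W (L k).
Hypothesis absorbing : forall z, W z -> exists delta, 0 < delta /\
  forall lam, 0 <= lam <= delta -> exists k, K k /\ L k = vscal lam z.


Lemma L_sub a b : L (vsub a b) = vsub (L a) (L b).
Proof. unfold vsub. rewrite L_add, !vopp_scal, L_scal. reflexivity. Qed.

(* Baire's theorem for the sets [n L (K n)], whose union is [W]. *)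
Lemma image_somewhere_dense : W vzero ->
  exists n x0 rho, 0 < n /\ W x0 /\ 0 < rho /\
    forall x, W x -> vnorm (vsub x x0) < rho -> forall eta, 0 < eta ->
      exists k, K k /\ vnorm k <= n /\ vnorm (vsub (vscal n (L k)) x) < eta.
Proof.
  intros W0. apply NNPP. intros Hno.
  assert (Hstep : forall n x0 rho, 0 < n -> W x0 -> 0 < rho -> exists x, W x /\
    vnorm (vsub x x0) < rho /\ exists eta, 0 < eta /\
      forall k, K k -> vnorm k <= n -> eta <= vnorm (vsub (vscal n (L k)) x)).
  { intros n x0 rho Hn Hx0 Hrho. apply NNPP. intros Hn1. apply Hno.
    exists n, x0, rho. split; auto. split; auto. split; auto. intros x Hx Hxr eta He.
    apply NNPP. intros Hn2. apply Hn1. exists x. split; auto. split; auto. exists eta. split; auto.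
    intros k Hk Hkn. apply Rnot_lt_le. intros Hlt. apply Hn2. eauto. }
  clear Hno.
  destruct (@dependent_choice_from (Z * R) (fun _ t => W (fst t) /\ 0 < snd t)
    (fun n t t' => snd t' <= snd t / 2 /\ vnorm (vsub (fst t') (fst t)) <= snd t / 2 /\
       forall k, K k -> vnorm k <= INR (S n) -> snd t' < vnorm (vsub (vscal (INR (S n)) (L k)) (fst t')))
    (vzero, 1)) as (s & Hs0 & Hs).
  - intros n [x rho] [Hx Hrho]; cbn [fst snd] in *.
    destruct (Hstep (INR (S n)) x (rho / 2)) as (x' & Hx' & Hd & eta & Heta & Hk); auto; try lra.
    { apply lt_0_INR. lia. }
    exists (x', Rmin (rho / 2) (eta / 2)); cbn [fst snd].
    assert (0 < Rmin (rho / 2) (eta / 2)) by (apply Rmin_glb_lt; lra).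
    split; [auto|]. split; [apply Rmin_l|]. split; [lra|].
    intros k HK Hkn. specialize (Hk k HK Hkn). pose proof (Rmin_r (rho / 2) (eta / 2)). lra.
  - cbn [fst snd]. split; auto; lra.
  - assert (Hrad : forall n, snd (s n) <= (/ 2) ^ n).
    { induction n as [|n IH]; [rewrite Hs0; simpl; lra|].
      destruct (Hs n) as (_ & H1 & _). simpl. lra. }
    assert (Hnest : forall n k, vnorm (vsub (fst (s (n + k)%nat)) (fst (s n))) <= snd (s n) - snd (s (n + k)%nat)).
    { intros n. induction k as [|k IH].
      - rewrite Nat.add_0_r. unfold vsub. rewrite vaddN, vnorm_zero. lra.
      - rewrite <- plus_n_Sm. destruct (Hs (n + k)%nat) as (_ & H1 & H2 & _).
        pose proof (vnorm_sub_tri (fst (s (S (n + k)))) (fst (s (n + k)%nat)) (fst (s n))). lra. }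
    destruct (geometric_limit (fun n => fst (s n)) 1) as (x & Hx).
    { intros n. destruct (Hs n) as (_ & _ & H2 & _). specialize (Hrad n). simpl. lra. }
    cbn beta in Hx.
    assert (Hball : forall n, vnorm (vsub x (fst (s n))) <= snd (s n)).
    { intros n. apply Rle_eps. intros e He.
      destruct (half_pow_small 1 e He) as [N HN]. specialize (HN (n + N)%nat ltac:(lia)).
      specialize (Hx (n + N)%nat). specialize (Hnest n N).
      destruct (Hs (n + N)%nat) as ((_ & H0) & _).
      pose proof (vnorm_sub_tri x (fst (s (n + N)%nat)) (fst (s n))). lra. }
    assert (HWx : W x).
    { apply W_closed. intros e He. destruct (half_pow_small 1 e He) as [N HN].
      specialize (HN N (le_n _)). exists (fst (s N)). split; [apply Hs|].
      rewrite vnorm_sub_sym. specialize (Hx N). lra. }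
    destruct (absorbing x HWx) as (delta & Hd & Habs).
    destruct (Habs delta ltac:(lra)) as (k1 & HK1 & HL1).
    destruct (Habs 0 ltac:(lra)) as (k0 & HK0 & HL0).
    (* For large [N], [x] equals [N L k] with [k] a convex combination of a preimage of [delta x]
       and a preimage of 0, and [k] has norm at most [N]; this contradicts the choice of the
       balls. *)
    destruct (INR_unbounded (vnorm k1 + vnorm k0 + / delta)) as [n Hn].
    pose proof (vnorm_ge0 k1). pose proof (vnorm_ge0 k0).
    assert (Hid : 0 < / delta) by (apply Rinv_0_lt_compat; auto).
    assert (HSn : INR n < INR (S n)) by (apply lt_INR; lia).
    set (N := INR (S n)) in *.
    assert (Hlam : 0 <= / (N * delta) <= 1).
    { assert (0 < N * delta) by (apply Rmult_lt_0_compat; lra). split.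
      - left. apply Rinv_0_lt_compat; auto.
      - rewrite <- Rinv_1. apply Rinv_le_contravar; [lra|].
        apply (Rmult_le_reg_r (/ delta)); auto. rewrite Rmult_assoc, Rinv_r by lra. lra. }
    destruct (Hs n) as (_ & _ & _ & Hfar).
    specialize (Hfar _ (K_convex _ _ _ Hlam HK1 HK0)).
    fold N in Hfar. rewrite L_add, !L_scal, HL1, HL0 in Hfar.
    assert (HN : vnorm (vadd (vscal (/ (N * delta)) k1) (vscal (1 - / (N * delta)) k0)) <= N).
    { eapply Rle_trans; [apply vnorm_tri|]. rewrite !vnorm_scal_pos by lra. nra. }
    specialize (Hfar HN). specialize (Hball (S n)). clearbody N.
    match type of Hfar with _ < vnorm (vsub ?A _) => replace A with x in Hfar by (vec; field; split; lra) end.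
    lra.
Qed.

(** Recentering at the origin: [n L k] approximates [x0 + z / c], while [- d x0] is attained
    exactly. The weights [a] and [1 - a] are chosen so that both copies of [x0] get the factor [c]
    and cancel. *)
Lemma image_dense_ball : W vzero -> exists rho b, 0 < rho /\ 0 <= b /\
  forall z, W z -> vnorm z <= rho -> forall eta, 0 < eta ->
    exists k, K k /\ vnorm k <= b /\ vnorm (vsub (L k) z) < eta.
Proof.
  intros W0. destruct (image_somewhere_dense W0) as (n & x0 & rho & Hn & Hx0 & Hrho & Hdense).
  destruct (absorbing (vscal (-1) x0) (W_scal _ _ Hx0)) as (d & Hd & Habs).
  destruct (Habs d ltac:(lra)) as (k1 & HK1 & HL1).
  assert (Hnd : 0 < n * d) by (apply Rmult_lt_0_compat; auto).
  set (c := d / (1 + n * d)). set (a := n * d / (1 + n * d)).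
  assert (Hc : 0 < c) by (apply Rdiv_lt_0_compat; lra).
  assert (Ha : 0 <= a <= 1).
  { unfold a. split; [apply Rlt_le, Rdiv_lt_0_compat; lra|].
    apply (Rmult_le_reg_r (1 + n * d)); [lra|]. unfold Rdiv. rewrite Rmult_assoc, Rinv_l; lra. }
  pose proof (vnorm_ge0 k1).
  exists (c * rho / 2), (n + vnorm k1). split; [nra|]. split; [lra|].
  intros z Hz Hzr eta Heta.
  destruct (Hdense (vadd x0 (vscal (/ c) z))) with (eta := eta / c) as (k & HK & Hkn & Hk).
  - auto.
  - replace (vsub (vadd x0 (vscal (/ c) z)) x0) with (vscal (/ c) z) by vec.
    rewrite vnorm_scal_pos by (left; apply Rinv_0_lt_compat; auto).
    apply (Rmult_lt_reg_l c); auto. rewrite <- Rmult_assoc, Rinv_r, Rmult_1_l by lra. nra.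
  - apply Rdiv_lt_0_compat; auto.
  - exists (vadd (vscal a k) (vscal (1 - a) k1)). split; [apply K_convex; auto|]. split.
    + eapply Rle_trans; [apply vnorm_tri|]. rewrite !vnorm_scal_pos by lra. nra.
    + rewrite L_add, !L_scal, HL1.
      replace (vsub (vadd (vscal a (L k)) (vscal (1 - a) (vscal d (vscal (-1) x0)))) z)
        with (vscal c (vsub (vscal n (L k)) (vadd x0 (vscal (/ c) z)))).
      * rewrite vnorm_scal_pos by lra. apply (Rmult_lt_compat_l c) in Hk; auto.
        replace (c * (eta / c)) with eta in Hk by (field; lra). exact Hk.
      * unfold a, c. vec; field; repeat split; lra.
Qed.

(** Successive approximation with residuals doubled at each step writes [z] as the sum of
    [(/ 2) ^ (n + 1) * L (k n)]. As [K] is convex and need not be a cone, the weights have to sum to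
    1; therefore the residual starts at [2 z] and the radius is halved. *)
Lemma image_contains_ball : W vzero -> exists rho b, 0 < rho /\
  forall z, W z -> vnorm z <= rho -> exists k, K k /\ vnorm k <= b /\ L k = z.
Proof.
  intros W0. destruct (image_dense_ball W0) as (rho & b & Hrho & Hb & Hdense).
  exists (rho / 2), b. split; [lra|]. intros z Hz Hzr.
  pose (kf := fun t : Z => epsilon (inhabits (vzero : P))
    (fun k => K k /\ vnorm k <= b /\ vnorm (vsub (L k) t) < rho / 2)).
  assert (Hkf : forall t, W t -> vnorm t <= rho ->
    K (kf t) /\ vnorm (kf t) <= b /\ vnorm (vsub (L (kf t)) t) < rho / 2).
  { intros t Ht Htr. unfold kf. apply epsilon_spec. apply Hdense; auto. lra. }
  pose (s := fix s n := match n with O => vscal 2 z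
     | S m => vscal 2 (vsub (s m) (L (kf (s m)))) end).
  assert (Hs : forall n, W (s n) /\ vnorm (s n) <= rho).
  { induction n as [|n [IH1 IH2]]; cbn [s].
    - split; auto. rewrite vnorm_scal_pos; lra.
    - destruct (Hkf _ IH1 IH2) as (H1 & H2 & H3). split.
      + apply W_scal. unfold vsub. rewrite vopp_scal. apply W_add; auto.
      + rewrite vnorm_scal_pos by lra. rewrite vnorm_sub_sym. lra. }
  pose (kap := fix kap n := match n with O => (vzero : P)
     | S m => vadd (kap m) (vscal ((/ 2) ^ (S m)) (kf (s m))) end).
  assert (Hres : forall n, vsub z (L (kap n)) = vscal ((/ 2) ^ (S n)) (s n)).
  { induction n as [|n IH].
    - cbn [kap s]. replace (L vzero) with (vzero : Z).
      + vec; simpl; field.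
      + rewrite <- (vscal0 (vzero : P)), L_scal, vscal0. reflexivity.
    - cbn [kap s]. rewrite L_add, L_scal.
      replace (vsub z (vadd (L (kap n)) (vscal ((/ 2) ^ S n) (L (kf (s n))))))
        with (vsub (vsub z (L (kap n))) (vscal ((/ 2) ^ S n) (L (kf (s n))))) by vec.
      rewrite IH. replace ((/ 2) ^ S (S n)) with (/ 2 * (/ 2) ^ S n) by reflexivity.
      generalize ((/ 2) ^ S n). intros c. vec; field. }
  (* The partial sum carries the total weight [1 - (/ 2) ^ n]; any point of [K] may fill the
     rest. *)
  assert (HKn : forall n k, K k -> K (vadd (kap n) (vscal ((/ 2) ^ n) k))).
  { induction n as [|n IH]; intros k Hk.
    - cbn [kap]. rewrite pow_O. replace (vadd vzero (vscal 1 k)) with k by vec. auto.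
    - cbn [kap]. destruct (Hs n) as [H1 H2]. destruct (Hkf _ H1 H2) as (H3 & _ & _).
      specialize (IH _ (K_convex _ _ (/ 2) ltac:(lra) H3 Hk)).
      replace ((/ 2) ^ S n) with (/ 2 * (/ 2) ^ n) by reflexivity.
      match type of IH with K ?A => match goal with |- K ?B => replace B with A; auto end end.
      generalize ((/ 2) ^ n). intros c. vec; field. }
  destruct (geometric_limit kap b) as (k & Hk).
  { intros n. cbn [kap].
    replace (vsub (vadd (kap n) (vscal ((/ 2) ^ S n) (kf (s n)))) (kap n))
      with (vscal ((/ 2) ^ S n) (kf (s n))) by vec.
    pose proof (half_pow_pos (S n)). destruct (Hs n) as [H1 H2]. destruct (Hkf _ H1 H2) as (_ & H3 & _).
    rewrite vnorm_scal_pos by lra. nra. }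
  exists k. split; [|split].
  - apply K_closed. intros eps He.
    destruct (Hs 0%nat) as [H1 H2]. destruct (Hkf _ H1 H2) as (H3 & _ & _).
    destruct (half_pow_small (b + vnorm (kf (s 0%nat))) eps He) as [N HN].
    specialize (HN N (le_n _)). specialize (Hk N).
    exists (vadd (kap N) (vscal ((/ 2) ^ N) (kf (s 0%nat)))). split; auto.
    replace (vsub (vadd (kap N) (vscal ((/ 2) ^ N) (kf (s 0%nat)))) k)
      with (vadd (vscal (-1) (vsub k (kap N))) (vscal ((/ 2) ^ N) (kf (s 0%nat)))) by vec.
    eapply Rle_lt_trans; [apply vnorm_tri|]. pose proof (half_pow_pos N).
    rewrite vnorm_scal, (vnorm_scal_pos ((/ 2) ^ N)), Rabs_left by lra. lra.
  - specialize (Hk 0%nat). cbn [kap] in Hk. rewrite pow_O in Hk.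
    replace (vsub k vzero) with k in Hk by vec. lra.
  - apply vsub_eq0. apply vnorm_eq0. apply Rle_antisym; [|apply vnorm_ge0].
    apply Rle_eps. intros e He.
    destruct (half_pow_small (Rabs M * b + rho) e He) as [N HN].
    specialize (HN N (le_n _)). specialize (Hk N). pose proof (half_pow_pos N).
    replace (vsub (L k) z) with (vsub (L (vsub k (kap N))) (vsub z (L (kap N))))
      by (rewrite L_sub; vec).
    rewrite Hres. unfold vsub at 1. eapply Rle_trans; [apply vnorm_tri|].
    rewrite vnorm_opp, vnorm_scal_pos by (left; apply half_pow_pos).
    destruct (Hs N) as [_ H2]. pose proof (L_bound (vsub k (kap N))).
    assert (M * vnorm (vsub k (kap N)) <= Rabs M * (b * (/ 2) ^ N)).
    { pose proof (Rle_abs M). pose proof (Rabs_pos M). pose proof (vnorm_ge0 (vsub k (kap N))).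
      apply Rle_trans with (Rabs M * vnorm (vsub k (kap N))); [apply Rmult_le_compat_r|apply Rmult_le_compat_l]; auto. }
    assert ((/ 2) ^ S N * vnorm (s N) <= (/ 2) ^ N * rho).
    { pose proof (vnorm_ge0 (s N)). apply Rmult_le_compat; auto; simpl; lra. }
    lra.
Qed.
End OpenMapping.

(** * Attained duality for the infimal convolution *)

Section Adjoint.
Context {X Y : Banach}.
Variables (A : X -> Y) (hA : lin_cont A).

Lemma adj_dual (v : DualB Y) : is_dual (adj A (ev v)).
Proof.
  destruct hA as (Hadd & Hscal & KA & HK). unfold adj. split; [split|].
  - intros. rewrite Hadd. apply ev_addr.
  - intros. rewrite Hscal. apply ev_scalr.
  - exists (vnorm v * KA). intros x. eapply Rle_trans; [apply ev_bound|].
    rewrite Rmult_assoc. apply Rmult_le_compat_l; [apply vnorm_ge0|auto].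
Qed.
Definition adjB (v : DualB Y) : DualB X := exist _ _ (adj_dual v).
Lemma ev_adjB v x : ev (adjB v) x = ev v (A x).
Proof. reflexivity. Qed.
Lemma adjB_add v w : adjB (vadd v w) = vadd (adjB v) (adjB w).
Proof. apply ev_ext. intros x. reflexivity. Qed.
Lemma adjB_scal a v : adjB (vscal a v) = vscal a (adjB v).
Proof. apply ev_ext. intros x. reflexivity. Qed.
Lemma adjB_bound : exists K, 0 <= K /\ forall v, vnorm (adjB v) <= K * vnorm v.
Proof.
  destruct hA as (_ & _ & KA & HK). exists (Rabs KA). split; [apply Rabs_pos|]. intros v.
  pose proof (vnorm_ge0 v). pose proof (Rabs_pos KA).
  apply dual_norm_le; [apply Rmult_le_pos; auto|].
  intros x. rewrite ev_adjB. eapply Rle_trans; [apply ev_bound|].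
  pose proof (vnorm_ge0 x).
  apply Rle_trans with (vnorm v * (Rabs KA * vnorm x)); [|right; ring].
  apply Rmult_le_compat_l; auto. eapply Rle_trans; [apply HK|].
  apply Rmult_le_compat_r; auto. apply Rle_abs.
Qed.

Lemma biadj_dual (p : DualB (DualB X)) : is_dual (fun v : DualB Y => ev p (adjB v)).
Proof.
  destruct adjB_bound as (K & HK0 & HK). split; [split|].
  - intros. rewrite adjB_add. apply ev_addr.
  - intros. rewrite adjB_scal. apply ev_scalr.
  - exists (vnorm p * K). intros v. eapply Rle_trans; [apply ev_bound|].
    rewrite Rmult_assoc. apply Rmult_le_compat_l; [apply vnorm_ge0|auto].
Qed.
Definition biadjB (p : DualB (DualB X)) : DualB (DualB Y) := exist _ _ (biadj_dual p).
Lemma ev_biadjB p v : ev (biadjB p) v = ev p (adjB v).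
Proof. reflexivity. Qed.
Lemma biadjB_add p q : biadjB (vadd p q) = vadd (biadjB p) (biadjB q).
Proof. apply ev_ext. intros x. reflexivity. Qed.
Lemma biadjB_scal a p : biadjB (vscal a p) = vscal a (biadjB p).
Proof. apply ev_ext. intros x. reflexivity. Qed.
End Adjoint.

Section Duality.
Context {X Y : Banach}.
Variables (A : X -> Y) (hA : lin_cont A).
Variables (HS : X -> DualB X -> R -> Prop) (HT : Y -> DualB Y -> R -> Prop).
Hypothesis S_convex : epi_convex HS.
Hypothesis S_closed : epi_closed HS.
Hypothesis S_upward : epi_upward HS.
Hypothesis T_convex : epi_convex HT.
Hypothesis T_closed : epi_closed HT.
Hypothesis T_upward : epi_upward HT.
Notation At := (adjB A hA).
Notation Att := (biadjB A hA).

(** The bound [h^*(f, p) <= rho] for the infimal convolution before closure, with the constraint on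
    [v] substituted. *)
Definition infconv_conj_le (f : DualB X) (p : DualB (DualB X)) (rho : R) : Prop :=
  forall u w v a b, HS u (At v) a -> HT (A w) v b ->
    ev f (vadd u w) + ev p (At v) - a - b <= rho.

Definition dual_attained (f : DualB X) (p : DualB (DualB X)) (rho : R) : Prop :=
  exists q v c1 c2, At v = f /\ conj_le HS f q c1 /\
    conj_le HT v (Att (vsub p q)) c2 /\ c1 + c2 <= rho.

(** * Duality under the interior condition *)

Section InteriorCondition.
Local Notation Z := (ProdB (ProdB Y (DualB Y)) (DualB X)).
Variable W : Z -> Prop.
Hypothesis W_zero : W vzero.
Hypothesis W_add : forall a b, W a -> W b -> W (vadd a b).
Hypothesis W_scal : forall r a, W a -> W (vscal r a).
Hypothesis W_closed : forall z, (forall eps, 0 < eps -> exists w, W w /\ vnorm (vsub w z) < eps) -> W z.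

(** Residual of the constraints [y = A w], [g = v], [f = A^* v]; over the domains of the two
    functions its values form the set in the interior condition. *)
Definition feasible_shift (y : Y) (g : DualB Y) (f : DualB X) (w : X) (v : DualB Y) : Z :=
  pr (pr (vsub y (A w)) (vsub g v)) (vsub f (At v)).

Hypothesis image_in_W : forall u f a y g b w v,
  HS u f a -> HT y g b -> W (feasible_shift y g f w v).
Hypothesis absorbing : forall z, W z -> exists delta, 0 < delta /\
  forall lam, 0 <= lam <= delta -> exists u f a y g b w v,
    HS u f a /\ HT y g b /\ feasible_shift y g f w v = vscal lam z.

(** The values [a] and [b] are coordinates too: the two epigraphs then form a closed convex set, and
    a norm bound on preimages also bounds the value function. *)
Local Notation P := (ProdB (ProdB (ProdB X X) (ProdB Y (DualB Y)))
  (ProdB (ProdB (DualB X) (DualB Y)) (ProdB RB RB))).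
Let ku (k : P) : X := p1 (p1 (p1 k)).
Let kw (k : P) : X := p2 (p1 (p1 k)).
Let ky (k : P) : Y := p1 (p2 (p1 k)).
Let kg (k : P) : DualB Y := p2 (p2 (p1 k)).
Let kf (k : P) : DualB X := p1 (p1 (p2 k)).
Let kv (k : P) : DualB Y := p2 (p1 (p2 k)).
Let ka (k : P) : RB := p1 (p2 (p2 k)).
Let kb (k : P) : RB := p2 (p2 (p2 k)).
Let mk u w y g f v (a b : R) : P := pr (pr (pr u w) (pr y g)) (pr (pr f v) (pr (a : RB) (b : RB))).
Let K (k : P) : Prop := HS (ku k) (kf k) (ka k) /\ HT (ky k) (kg k) (kb k).
Let L (k : P) : Z := feasible_shift (ky k) (kg k) (kf k) (kw k) (kv k).

Lemma interior_bounded_preimages : exists rho B, 0 < rho /\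
  forall z, W z -> vnorm z <= rho -> exists k, K k /\ vnorm k <= B /\ L k = z.
Proof.
  destruct hA as (Aadd & Ascal & KA & HKA).
  destruct (adjB_bound A hA) as (Kt & HKt0 & HKt).
  apply (@image_contains_ball P Z K L W (2 + Rabs KA + Kt)); auto.
  - intros k1 k2 l Hl [HS1 HT1] [HS2 HT2]. split.
    + apply (S_convex _ _ _ _ _ _ l Hl HS1 HS2).
    + apply (T_convex _ _ _ _ _ _ l Hl HT1 HT2).
  - intros k Hk. split.
    + apply S_closed. intros eps He. destruct (Hk eps He) as (k' & [H1 H2] & Hn).
      exists (ku k'), (kf k'), (ka k'). split; auto.
      rewrite !prod_norm in Hn. linin Hn.
      change (Rabs (ka k' - ka k)) with (vnorm (vsub (ka k') (ka k))).
      unfold ku, kf, ka. lin.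
      repeat match type of Hn with context [vnorm ?t] =>
        lazymatch goal with H : 0 <= vnorm t |- _ => fail | _ => pose proof (vnorm_ge0 t) end end.
      repeat split; lra.
    + apply T_closed. intros eps He. destruct (Hk eps He) as (k' & [H1 H2] & Hn).
      exists (ky k'), (kg k'), (kb k'). split; auto.
      rewrite !prod_norm in Hn. linin Hn.
      change (Rabs (kb k' - kb k)) with (vnorm (vsub (kb k') (kb k))).
      unfold ky, kg, kb. lin.
      repeat match type of Hn with context [vnorm ?t] =>
        lazymatch goal with H : 0 <= vnorm t |- _ => fail | _ => pose proof (vnorm_ge0 t) end end.
      repeat split; lra.
  - intros a b. unfold L, feasible_shift, ky, kg, kf, kw, kv. lin. rewrite Aadd, adjB_add. pvec.
  - intros r a. unfold L, feasible_shift, ky, kg, kf, kw, kv. lin. rewrite Ascal, adjB_scal. pvec.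
  - intros k. unfold L, feasible_shift. rewrite !prod_norm. lin.
    unfold vsub. pose proof (vnorm_tri _ (ky k) (vopp (A (kw k)))).
    pose proof (vnorm_tri _ (kg k) (vopp (kv k))). pose proof (vnorm_tri _ (kf k) (vopp (At (kv k)))).
    rewrite !vnorm_opp in *. pose proof (HKA (kw k)). pose proof (HKt (kv k)).
    fold (ku k) (kw k) (ky k) (kg k) (kf k) (kv k) (ka k) (kb k).
    pose proof (vnorm_ge0 (ku k)). pose proof (vnorm_ge0 (kw k)). pose proof (vnorm_ge0 (ky k)).
    pose proof (vnorm_ge0 (kg k)). pose proof (vnorm_ge0 (kf k)). pose proof (vnorm_ge0 (kv k)).
    pose proof (vnorm_ge0 (ka k)). pose proof (vnorm_ge0 (kb k)).
    pose proof (Rabs_pos KA). pose proof (Rle_abs KA).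
    assert (KA * vnorm (kw k) <= Rabs KA * vnorm (kw k)) by (apply Rmult_le_compat_r; auto).
    set (n := vnorm (ku k) + vnorm (kw k) + (vnorm (ky k) + vnorm (kg k)) +
      (vnorm (kf k) + vnorm (kv k) + (vnorm (ka k) + vnorm (kb k)))).
    assert (Rabs KA * vnorm (kw k) <= Rabs KA * n) by (apply Rmult_le_compat_l; unfold n; lra).
    assert (Kt * vnorm (kv k) <= Kt * n) by (apply Rmult_le_compat_l; unfold n; lra).
    unfold n in *. lra.
  - intros k [H1 H2]. apply (image_in_W _ _ _ _ _ _ _ _ H1 H2).
  - intros z Hz. destruct (absorbing z Hz) as (d & Hd & Habs). exists d. split; auto.
    intros lam Hlam. destruct (Habs lam Hlam) as (u & f & a & y & g & b & w & v & H1 & H2 & H3).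
    exists (mk u w y g f v a b). split; [split; auto|auto].
Qed.

(** A subgradient [(v', be, q')] at 0 of the value function of the shifted constraints is a dual
    solution. The variables [w] and [v] are free, so the linear terms in them vanish, which gives
    [A^* v' = - f] and [be = - A^** (p + q')]. The rest splits into two conjugate bounds at [- q']
    and [- v']. *)
Lemma interior_dual_attained f p rho : infconv_conj_le f p rho -> dual_attained f p rho.
Proof.
  intros Hprim. destruct interior_bounded_preimages as (r0 & B & Hr0 & Hpre).
  destruct hA as (Aadd & Ascal & KA & HKA).
  destruct (adjB_bound A hA) as (Kt & HKt0 & HKt).
  pose (val := fun k : P => ka k + kb k - ev f (ku k) - ev f (kw k) - ev p (At (kv k))).
  destruct (@subgradient Z (fun z s => exists k, K k /\ L k = z /\ val k <= s) (- rho)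
    (2 * B + vnorm f * B + vnorm f * B + vnorm p * (Kt * B)) r0) as (l & Hl); auto.
  - intros z1 s1 z2 s2 t Ht (k1 & [HS1 HT1] & <- & Hv1) (k2 & [HS2 HT2] & <- & Hv2).
    exists (vadd (vscal t k1) (vscal (1 - t) k2)). split; [split|split].
    + apply (S_convex _ _ _ _ _ _ t Ht HS1 HS2).
    + apply (T_convex _ _ _ _ _ _ t Ht HT1 HT2).
    + unfold L, feasible_shift, ky, kg, kf, kw, kv. lin. rewrite Aadd, !Ascal, adjB_add, !adjB_scal. pvec.
    + apply (Rmult_le_compat_l t) in Hv1; [|lra]. apply (Rmult_le_compat_l (1 - t)) in Hv2; [|lra].
      eapply Rle_trans; [|apply Rplus_le_compat; [exact Hv1|exact Hv2]].
      right. unfold val, ka, kb, ku, kw, kv. lin. rewrite adjB_add, !adjB_scal. lin.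
      change (@vadd RB) with Rplus. change (@vscal RB) with Rmult. ring.
  - intros s (k & [H1 H2] & H3 & Hv).
    pose proof (f_equal p1 H3) as H4. pose proof (f_equal p2 H3) as H5.
    pose proof (f_equal p1 H4) as H6. pose proof (f_equal p2 H4) as H7.
    unfold L, feasible_shift in H5, H6, H7. linin H5. linin H6. linin H7.
    apply vsub_eq0 in H5. apply vsub_eq0 in H6. apply vsub_eq0 in H7.
    rewrite H5 in H1. rewrite H6, H7 in H2.
    specialize (Hprim _ _ _ _ _ H1 H2). rewrite ev_addr in Hprim. unfold val in Hv. lra.
  - intros z s t (k & Hk & <- & _) Ht Htn.
    assert (HWz : W (L k)) by (apply (image_in_W _ _ _ _ _ _ _ _ (proj1 Hk) (proj2 Hk))).
    destruct (Hpre (vscal (- t) (L k))) as (k' & Hk' & Hkn & HLk'); auto.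
    { rewrite vnorm_scal, Rabs_Ropp, Rabs_right by lra. auto. }
    eexists. split; [|exists k'; split; [auto|split; [auto|apply Rle_refl]]].
    rewrite !prod_norm in Hkn.
    fold (ku k') (kw k') (ky k') (kg k') (kf k') (kv k') (ka k') (kb k') in Hkn.
    pose proof (vnorm_ge0 (ku k')). pose proof (vnorm_ge0 (kw k')). pose proof (vnorm_ge0 (ky k')).
    pose proof (vnorm_ge0 (kg k')). pose proof (vnorm_ge0 (kf k')). pose proof (vnorm_ge0 (kv k')).
    pose proof (vnorm_ge0 (ka k')). pose proof (vnorm_ge0 (kb k')).
    assert (ka k' <= vnorm (ka k')) by apply Rle_abs. assert (kb k' <= vnorm (kb k')) by apply Rle_abs.
    pose proof (ev_bound f (ku k')) as B1. apply Rabs_le_inv in B1.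
    pose proof (ev_bound f (kw k')) as B2. apply Rabs_le_inv in B2.
    pose proof (ev_bound p (At (kv k'))) as B3. apply Rabs_le_inv in B3.
    pose proof (vnorm_ge0 f). pose proof (vnorm_ge0 p). pose proof (HKt (kv k')).
    assert (vnorm f * vnorm (ku k') <= vnorm f * B) by (apply Rmult_le_compat_l; lra).
    assert (vnorm f * vnorm (kw k') <= vnorm f * B) by (apply Rmult_le_compat_l; lra).
    assert (Kt * vnorm (kv k') <= Kt * B) by (apply Rmult_le_compat_l; lra).
    assert (vnorm p * vnorm (At (kv k')) <= vnorm p * (Kt * B)) by (apply Rmult_le_compat_l; lra).
    unfold val. lra.
  - destruct (prod_dual l) as (l' & q' & H1). destruct (prod_dual l') as (v' & be & H2).
    assert (Hmain : forall u f' a y g b w v, HS u f' a -> HT y g b ->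
      ev f u - ev q' f' - a + (- ev v' y - ev be g - b)
      + (ev f w + ev v' (A w)) + (ev p (At v) + ev be v + ev q' (At v)) <= rho).
    { intros u f' a y g b w v Hu Hy.
      assert (Hk : exists k, K k /\ L k = L (mk u w y g f' v a b) /\ val k <= val (mk u w y g f' v a b)).
      { exists (mk u w y g f' v a b). split; [split; auto|split; [reflexivity|apply Rle_refl]]. }
      specialize (Hl _ _ Hk).
      rewrite H1, H2 in Hl. unfold L, val, feasible_shift, ku, kw, ky, kg, kf, kv, ka, kb, mk in Hl.
      linin Hl. lra. }
    destruct (absorbing vzero W_zero) as (d & Hd & Habs).
    destruct (Habs d ltac:(lra)) as (u0 & f0 & a0 & y0 & g0 & b0 & _ & _ & Hu0 & Hy0 & _).
    set (c0 := ev f u0 - ev q' f0 - a0 + (- ev v' y0 - ev be g0 - b0)).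
    assert (Hw : forall w, ev f w + ev v' (A w) = 0).
    { apply (linf_bounded_above_zero (fun w => ev f w + ev v' (A w)) (rho - c0)).
      - split; intros; rewrite ?Aadd, ?Ascal; lin; ring.
      - intros w. specialize (Hmain u0 f0 a0 y0 g0 b0 w vzero Hu0 Hy0).
        replace (At vzero) with (vzero : DualB X) in Hmain by (apply ev_ext; intros; reflexivity).
        linin Hmain. unfold c0. lra. }
    assert (Hv : forall v, ev p (At v) + ev be v + ev q' (At v) = 0).
    { apply (linf_bounded_above_zero (fun v => ev p (At v) + ev be v + ev q' (At v)) (rho - c0)).
      - split; intros; rewrite ?adjB_add, ?adjB_scal; lin; ring.
      - intros v. specialize (Hmain u0 f0 a0 y0 g0 b0 vzero v Hu0 Hy0).
        rewrite Hw in Hmain. unfold c0. lra. }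
    destruct (sum_bound_split
      (fun c => exists u f' a, HS u f' a /\ c = ev f u - ev q' f' - a)
      (fun c => exists y g b, HT y g b /\ c = - ev v' y - ev be g - b) rho) as (c1 & c2 & Hc1 & Hc2 & Hc).
    + do 4 eexists; eauto.
    + do 4 eexists; eauto.
    + intros c c' (u & f' & a & Hu & ->) (y & g & b & Hy & ->).
      specialize (Hmain u f' a y g b vzero vzero Hu Hy). rewrite Hw, Hv in Hmain. lra.
    + exists (vopp q'), (vopp v'), c1, c2. split; [|split; [|split]]; auto.
      * apply ev_ext. intros w. rewrite ev_adjB, ev_oppl. specialize (Hw w). lra.
      * intros u f' a Hu. apply Hc1. exists u, f', a. split; auto. lin. ring.
      * intros y g b Hy. apply Hc2. exists y, g, b. split; auto.
        rewrite ev_biadjB. lin. specialize (Hv g). lra.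
Qed.

End InteriorCondition.

(** * Weak-* approximation of the dual optimum *)

Definition dual_element (uf : DualB X) (up : DualB (DualB X)) (vf : DualB Y) (vp : DualB (DualB Y)) (r : R) :=
  exists c1 c2, conj_le HS uf up c1 /\ conj_le HT vf vp c2 /\ c1 + c2 <= r.

(** A basic weak-* neighbourhood of [(f, f, A^** p, rho)] meets the set in the closedness
    condition. *)
Definition dual_near (f : DualB X) (p : DualB (DualB X)) (rho : R)
    (xs1 xs2 : list X) (gs : list (DualB Y)) (eps : R) : Prop :=
  exists uf up vf vp r, dual_element uf up vf vp r /\
    Forall (fun x => Rabs (ev uf x - ev f x) < eps) xs1 /\
    Forall (fun x => Rabs (ev vf (A x) - ev f x) < eps) xs2 /\
    Forall (fun g => Rabs (ev up (At g) + ev vp g - ev p (At g)) < eps) gs /\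
    Rabs (r - rho) < eps.

Hypothesis S_minorant : exists u p c, conj_le HS u p c.
Hypothesis T_minorant : exists u p c, conj_le HT u p c.

(** The hypothesis bounds the sum of the two biconjugates; once this bound is split, the
    Fenchel-Moreau theorem applies to each function separately. *)
Lemma sum_fenchel_moreau x g y h kappa :
  (exists x' g' r', HS x' g' r') -> (exists x' g' r', HT x' g' r') ->
  (forall uf up vf vp r, dual_element uf up vf vp r ->
     ev uf x + ev up g + ev vf y + ev vp h - r <= kappa) ->
  exists a b, HS x g a /\ HT y h b /\ a + b <= kappa.
Proof.
  intros HSne HTne Hk.
  destruct (sum_bound_split
    (fun c => exists uf up c1, conj_le HS uf up c1 /\ c = ev uf x + ev up g - c1)
    (fun c => exists vf vp c2, conj_le HT vf vp c2 /\ c = ev vf y + ev vp h - c2) kappa)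
    as (a & b & Ha & Hb & Hab).
  - destruct S_minorant as (u & p & c & Hc). do 4 eexists; eauto.
  - destruct T_minorant as (u & p & c & Hc). do 4 eexists; eauto.
  - intros c c' (uf & up & c1 & H1 & ->) (vf & vp & c2 & H2 & ->).
    specialize (Hk uf up vf vp (c1 + c2)).
    assert (dual_element uf up vf vp (c1 + c2)) by (exists c1, c2; repeat split; auto; lra).
    specialize (Hk H). lra.
  - exists a, b. split; [|split; auto].
    + apply (fenchel_moreau HS S_convex S_closed S_upward HSne S_minorant).
      intros u p c Hc. apply Ha. do 3 eexists; eauto.
    + apply (fenchel_moreau HT T_convex T_closed T_upward HTne T_minorant).
      intros u p c Hc. apply Hb. do 3 eexists; eauto.
Qed.

Lemma conj_le_convex {E : Banach} (H : E -> DualB E -> R -> Prop) u1 q1 c1 u2 q2 c2 l :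
  0 <= l <= 1 -> conj_le H u1 q1 c1 -> conj_le H u2 q2 c2 ->
  conj_le H (vadd (vscal l u1) (vscal (1 - l) u2)) (vadd (vscal l q1) (vscal (1 - l) q2))
    (l * c1 + (1 - l) * c2).
Proof.
  intros Hl H1 H2 y g r Hy. specialize (H1 _ _ _ Hy). specialize (H2 _ _ _ Hy). lin.
  apply (Rmult_le_compat_l l) in H1; [|lra]. apply (Rmult_le_compat_l (1 - l)) in H2; lra.
Qed.

Local Notation V := (ProdB (ProdB (DualB X) (DualB X)) (ProdB (DualB (DualB Y)) RB)).

(* Otherwise a combination of finitely many evaluations separates, and by Fenchel-Moreau its
   coefficients give primal points violating [infconv_conj_le]; a separating combination that
   ignores the real coordinate is added, N-fold, to a feasible point. *)
Lemma primal_bound_near f p rho : infconv_conj_le f p rho ->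
  (exists u w v a b, HS u (At v) a /\ HT (A w) v b) ->
  forall xs1 xs2 gs eps, 0 < eps -> dual_near f p rho xs1 xs2 gs eps.
Proof.
  intros Hprim (u0 & w0 & v0 & a0 & b0 & Hu0 & Hw0) xs1 xs2 gs eps Heps.
  apply NNPP. intros Hno.
  (* The weak-* continuous functionals: evaluations at points of the preduals plus a multiple of the
     real coordinate. *)
  pose (Q := fun phi : V -> R => exists x1 x2 g s, forall z : V,
    phi z = ev (p1 (p1 z)) x1 + ev (p2 (p1 z)) x2 + ev (p1 (p2 z)) g + s * (p2 (p2 z) : R)).
  pose (Phi := map (fun x (z : V) => ev (p1 (p1 z)) x) xs1 ++
               map (fun x (z : V) => ev (p2 (p1 z)) x) xs2 ++
               map (fun g (z : V) => ev (p1 (p2 z)) g) gs ++ (fun z : V => p2 (p2 z) : R) :: nil).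
  pose (el := fun uf up vf vp (r : R) =>
    pr (pr uf (At vf)) (pr (vadd (Att up) vp) (r : RB)) : V).
  destruct (@weak_separation V Q) with (Phi := Phi)
    (C := fun z => exists uf up vf vp r, dual_element uf up vf vp r /\ z = el uf up vf vp r)
    (z0 := pr (pr f f) (pr (Att p) (rho : RB)) : V) (eps := eps)
    as (l & (x1 & x2 & g & s & Hl) & Hsep).
  - intros phi (x1 & x2 & g & s & Hphi). split; intros; rewrite !Hphi; lin.
    + change (@vadd RB) with Rplus. ring.
    + change (@vscal RB) with Rmult. ring.
  - exists vzero, vzero, vzero, 0. intros z. lin. ring.
  - intros a phi psi (x1 & x2 & g & s & Hphi) (y1 & y2 & h & t & Hpsi).
    exists (vadd x1 (vscal a y1)), (vadd x2 (vscal a y2)), (vadd g (vscal a h)), (s + a * t).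
    intros z. rewrite Hphi, Hpsi. lin. ring.
  - unfold Phi. rewrite !Forall_app. repeat split.
    + apply Forall_forall. intros phi Hphi. apply in_map_iff in Hphi. destruct Hphi as (x & <- & _).
      exists x, vzero, vzero, 0. intros z. lin. ring.
    + apply Forall_forall. intros phi Hphi. apply in_map_iff in Hphi. destruct Hphi as (x & <- & _).
      exists vzero, x, vzero, 0. intros z. lin. ring.
    + apply Forall_forall. intros phi Hphi. apply in_map_iff in Hphi. destruct Hphi as (x & <- & _).
      exists vzero, vzero, x, 0. intros z. lin. ring.
    + constructor; [|constructor]. exists vzero, vzero, vzero, 1. intros z. lin. rewrite !Rplus_0_l, Rmult_1_l. reflexivity.
  - intros z1 z2 t Ht (uf & up & vf & vp & r & (c1 & c2 & H1 & H2 & H3) & ->)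
      (uf' & up' & vf' & vp' & r' & (c1' & c2' & H1' & H2' & H3') & ->).
    do 5 eexists. split.
    + exists (t * c1 + (1 - t) * c1'), (t * c2 + (1 - t) * c2').
      split; [apply conj_le_convex; [exact Ht|exact H1|exact H1']|].
      split; [apply conj_le_convex; [exact Ht|exact H2|exact H2']|].
      apply (Rmult_le_compat_l t) in H3; [|lra]. apply (Rmult_le_compat_l (1 - t)) in H3'; [|lra].
      instantiate (1 := t * r + (1 - t) * r'). lra.
    + unfold el. rewrite adjB_add, !adjB_scal, biadjB_add, !biadjB_scal.
      change (t * r + (1 - t) * r') with (vadd (vscal t (r : RB)) (vscal (1 - t) (r' : RB))).
      pvec.
  - intros z (uf & up & vf & vp & r & He & ->). apply NNPP. intros Hn. apply Hno.
    assert (Hall : forall phi, In phi Phi ->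
      Rabs (phi (vsub (el uf up vf vp r) (pr (pr f f) (pr (Att p) (rho : RB)) : V))) < eps).
    { intros phi Hphi. apply Rnot_le_lt. intros Hc. apply Hn. eauto. }
    clear Hn. unfold Phi in Hall.
    exists uf, up, vf, vp, r. split; auto. split; [|split; [|split]].
    + apply Forall_forall. intros x Hx.
      specialize (Hall (fun z => ev (p1 (p1 z)) x)). unfold el in Hall. linin Hall. apply Hall.
      rewrite !in_app_iff, !in_map_iff. left; eauto.
    + apply Forall_forall. intros x Hx.
      specialize (Hall (fun z => ev (p2 (p1 z)) x)). unfold el in Hall. linin Hall. apply Hall.
      rewrite !in_app_iff, !in_map_iff. right; left; eauto.
    + apply Forall_forall. intros h Hh.
      specialize (Hall (fun z => ev (p1 (p2 z)) h)). unfold el in Hall. linin Hall. apply Hall.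
      rewrite !in_app_iff, !in_map_iff. right; right; left; eauto.
    + specialize (Hall (fun z => p2 (p2 z) : R)). unfold el in Hall. linin Hall. apply Hall.
      rewrite !in_app_iff. right; right; right; left; auto.
  - assert (Hsep' : forall uf up vf vp r, dual_element uf up vf vp r ->
      eps <= ev uf x1 - ev f x1 + (ev vf (A x2) - ev f x2)
        + (ev up (At g) + ev vp g - ev p (At g)) + s * (r - rho)).
    { intros uf up vf vp r He.
      specialize (Hsep _ (ex_intro _ uf (ex_intro _ up (ex_intro _ vf (ex_intro _ vp
        (ex_intro _ r (conj He eq_refl))))))).
      rewrite Hl in Hsep. unfold el in Hsep. linin Hsep. exact Hsep. }
    assert (HSne : exists x' g' r', HS x' g' r') by eauto.
    assert (HTne : exists x' g' r', HT x' g' r') by eauto.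
    pose proof hA as (Aadd & Ascal & _).
    assert (Hs : 0 <= s).
    { destruct S_minorant as (uf & up & c1 & Hc1). destruct T_minorant as (vf & vp & c2 & Hc2).
      apply Rnot_lt_le. intros Hs.
      apply (affine_unbounded (- (ev uf x1 - ev f x1 + (ev vf (A x2) - ev f x2)
        + (ev up (At g) + ev vp g - ev p (At g)) + s * (c1 + c2 - rho))) (- s) (- eps)); [lra|].
      intros N HN. specialize (Hsep' uf up vf vp (c1 + c2 + N)).
      assert (dual_element uf up vf vp (c1 + c2 + N)) by (exists c1, c2; repeat split; auto; lra).
      specialize (Hsep' H). lra. }
    destruct Hs as [Hs|Hs].
    (* Division by [- s] turns the separating coefficients into feasible primal points whose value
       exceeds [rho] by at least [eps / s]. *)
    + destruct (sum_fenchel_moreau (vscal (- / s) x1) (At (vscal (- / s) g))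
         (A (vscal (- / s) x2)) (vscal (- / s) g)
         (ev f (vscal (- / s) x1) + ev f (vscal (- / s) x2) + ev p (At (vscal (- / s) g)) - rho - eps / s)
         HSne HTne) as (a & b & Ha & Hb & Hab).
      * intros uf up vf vp r He. specialize (Hsep' _ _ _ _ _ He).
        rewrite !adjB_scal, !Ascal. lin. apply Rminus_le.
        match goal with |- ?T <= 0 => replace T with (/ s * (eps - (ev uf x1 - ev f x1 +
           (ev vf (A x2) - ev f x2) + (ev up (At g) + ev vp g - ev p (At g)) + s * (r - rho))))
           by (field; lra) end.
        assert (0 < / s) by (apply Rinv_0_lt_compat; auto). nra.
      * specialize (Hprim _ _ _ _ _ Ha Hb). rewrite ev_addr in Hprim.
        assert (0 < eps / s) by (apply Rdiv_lt_0_compat; auto). lra.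
    + apply (affine_unbounded (ev f u0 + ev f w0 + ev p (At v0) - a0 - b0) eps rho Heps).
      intros N HN.
      destruct (sum_fenchel_moreau (vsub u0 (vscal N x1)) (At (vsub v0 (vscal N g)))
         (A (vsub w0 (vscal N x2))) (vsub v0 (vscal N g))
         (a0 + b0 - N * (eps + ev f x1 + ev f x2 + ev p (At g))) HSne HTne) as (a & b & Ha & Hb & Hab).
      * intros uf up vf vp r He. specialize (Hsep' _ _ _ _ _ He).
        destruct He as (c1 & c2 & H1 & H2 & H3).
        specialize (H1 _ _ _ Hu0). specialize (H2 _ _ _ Hw0).
        rewrite <- Hs in Hsep'. unfold vsub. rewrite !vopp_scal, !Aadd, !adjB_add, !adjB_scal, !Ascal. lin.
        apply (Rmult_le_compat_l N) in Hsep'; auto. lra.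
      * specialize (Hprim _ _ _ _ _ Ha Hb). unfold vsub in Hprim.
        rewrite !vopp_scal, !adjB_add, !adjB_scal in Hprim. linin Hprim. lra.
Qed.

End Duality.

(** * Extended-real functions and their epigraphs *)

Lemma Rbar_le_refl a : Rbar_le a a.
Proof. destruct a; simpl; auto; lra. Qed.
Lemma Rbar_le_trans a b c : Rbar_le a b -> Rbar_le b c -> Rbar_le a c.
Proof. destruct a, b, c; simpl; auto; try tauto; lra. Qed.
Lemma Rbar_le_antisym a b : Rbar_le a b -> Rbar_le b a -> a = b.
Proof. destruct a, b; simpl; try tauto. intros. f_equal. lra. Qed.
Lemma Rbar_nle_lt r a : ~ Rbar_le a (Fin r) -> Rbar_lt (Fin r) a.
Proof.
  destruct a; unfold Rbar_lt; simpl; intros H; try tauto.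
  - split; [lra|]. intros E. injection E. lra.
  - split; auto. discriminate.
Qed.
Lemma Rbar_lt_nle r a : Rbar_lt (Fin r) a -> ~ Rbar_le a (Fin r).
Proof.
  destruct a; unfold Rbar_lt; simpl; intros [H1 H2] H; try tauto.
  apply H2. f_equal. lra.
Qed.
Lemma Rbar_le_eps a r : (forall e, 0 < e -> Rbar_le a (Fin (r + e))) -> Rbar_le a (Fin r).
Proof.
  destruct a; simpl; intros H; auto.
  - apply Rle_eps. auto.
  - apply (H 1 Rlt_0_1).
Qed.
Lemma Rbar_le_ge_real a r : (forall s, Rbar_le a (Fin s) -> r <= s) -> Rbar_le (Fin r) a.
Proof.
  destruct a; simpl; intros H; auto.
  - apply H. lra.
  - specialize (H (r - 1) I). lra.
Qed.

Lemma Rbar_sup_ex (E : Rbar -> Prop) : exists s, Rbar_is_sup E s.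
Proof.
  destruct (classic (E PInf)) as [HP|HP].
  { exists PInf. split; [intros [] _; exact I|]. intros t Ht. apply (Ht _ HP). }
  destruct (classic (exists r, E (Fin r))) as [Hr|Hr].
  2:{ exists MInf. split; [|intros; exact I]. intros [r| |] He; simpl; auto. exfalso; eauto. }
  destruct (classic (exists m, forall r, E (Fin r) -> r <= m)) as [[m Hm]|Hm].
  - destruct (completeness (fun r => E (Fin r))) as [s [Hs1 Hs2]]; auto.
    { exists m. exact Hm. }
    exists (Fin s). split.
    + intros [r| |] He; [apply Hs1; exact He|contradiction|exact I].
    + intros [t| |] Ht; simpl; auto.
      * apply Hs2. intros r He. apply (Ht _ He).
      * destruct Hr as [r Hr]. apply (Ht _ Hr).
  - exists PInf. split; [intros [] _; exact I|].
    intros [t| |] Ht; simpl; auto.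
    + apply Hm. exists t. intros r He. apply (Ht _ He).
    + destruct Hr as [r Hr]. apply (Ht _ Hr).
Qed.

Lemma Rbar_sup_spec E : Rbar_is_sup E (Rbar_sup E).
Proof. unfold Rbar_sup. apply epsilon_spec. apply Rbar_sup_ex. Qed.

Lemma Rbar_inf_spec E : Rbar_is_inf E (Rbar_inf E).
Proof.
  unfold Rbar_inf. apply epsilon_spec.
  destruct (Rbar_sup_ex (fun t => forall e, E e -> Rbar_le t e)) as [s [H1 H2]].
  exists s. split.
  - intros e He. apply H2. auto.
  - intros t Ht. apply H1. exact Ht.
Qed.

Lemma Rbar_inf_le E r :
  Rbar_le (Rbar_inf E) (Fin r) <-> forall e, 0 < e -> exists a, E a /\ Rbar_le a (Fin (r + e)).
Proof.
  destruct (Rbar_inf_spec E) as [H1 H2]. split.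
  - intros Hle e He. apply NNPP. intros Hno.
    assert (Hlow : Rbar_le (Fin (r + e)) (Rbar_inf E)).
    { apply H2. intros a Ha. apply Rbar_nle_lt. intros Hc. eauto. }
    pose proof (Rbar_le_trans _ _ _ Hlow Hle) as Hc. simpl in Hc. lra.
  - intros H. apply Rbar_le_eps. intros e He. destruct (H e He) as (a & Ha & Hle).
    eapply Rbar_le_trans; [apply H1, Ha|exact Hle].
Qed.

Lemma Rbar_plus_le a b r s t : Rbar_le (Fin s) a -> Rbar_le (Fin t) b ->
  Rbar_le (Rbar_plus a b) (Fin r) ->
  exists a' b', Rbar_le a (Fin a') /\ Rbar_le b (Fin b') /\ a' + b' <= r.
Proof.
  destruct a as [a| |], b as [b| |]; simpl; try tauto. intros _ _ H. exists a, b. simpl. lra.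
Qed.

Lemma Rbar_plus_ge a b r s t : Rbar_le a (Fin s) -> Rbar_le b (Fin t) -> s + t <= r ->
  Rbar_le (Rbar_plus a b) (Fin r).
Proof. destruct a, b; simpl; try tauto. lra. Qed.

Section DualConversion.
Context {X : Banach}.

Definition toD (f : X -> R) : DualB X :=
  match excluded_middle_informative (is_dual f) with
  | left H => exist _ f H
  | right _ => vzero
  end.
Lemma ev_toD f : is_dual f -> ev (toD f) = f.
Proof. intros H. unfold toD. destruct excluded_middle_informative; tauto. Qed.

(** In the statement a bidual element is a function on all maps [X -> R] of which only the values on
    the dual matter; hence a relation and not an equality. *)
Definition represents (P : DualB (DualB X)) (p : (X -> R) -> R) : Prop :=
  forall g, ev P g = p (ev g).

Definition raw (P : DualB (DualB X)) : (X -> R) -> R := fun f => ev P (toD f).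
Lemma toD_ev f : toD (ev f) = f.
Proof. apply ev_ext. intros x. rewrite ev_toD; auto. apply ev_dual. Qed.
Lemma represents_raw P : represents P (raw P).
Proof. intros g. unfold raw. rewrite toD_ev. reflexivity. Qed.

Lemma bidual_represented p : is_bidual p -> exists P, represents P p.
Proof.
  intros (Hadd & Hscal & M & HM).
  destruct (@mk_dual (DualB X) (fun g => p (ev g))) as [P HP].
  - split; [split|].
    + intros f g. apply Hadd; apply ev_dual.
    + intros a f. apply Hscal, ev_dual.
    + exists M. intros f. apply HM; [apply ev_dual|apply vnorm_ge0|].
      intros x. apply ev_bound.
  - exists P. intros g. rewrite HP. reflexivity.
Qed.

Lemma represented_bidual P p : represents P p -> is_bidual p.
Proof.
  intros HP. split; [|split].
  - intros f g Hf Hg. destruct (mk_dual f Hf) as [F <-], (mk_dual g Hg) as [G <-].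
    change (dadd (ev F) (ev G)) with (ev (vadd F G)). rewrite <- !HP. apply ev_addr.
  - intros a f Hf. destruct (mk_dual f Hf) as [F <-].
    change (dscal a (ev F)) with (ev (vscal a F)). rewrite <- !HP. apply ev_scalr.
  - exists (vnorm P). intros f K Hf HK HfK. destruct (mk_dual f Hf) as [F <-]. rewrite <- HP.
    eapply Rle_trans; [apply ev_bound|]. apply Rmult_le_compat_l; [apply vnorm_ge0|].
    apply dual_norm_le; auto.
Qed.

Lemma dsub_ev (f g : DualB X) : dsub (ev f) (ev g) = ev (vsub f g).
Proof. extensionality x. rewrite ev_subl. reflexivity. Qed.

Lemma dball_norm (f g : DualB X) eps : 0 < eps ->
  dball (ev f) (ev g) eps <-> vnorm (vsub f g) < eps.
Proof.
  intros He. unfold dball. rewrite dsub_ev. split.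
  - intros (K & HK & Hb). apply Rle_lt_trans with (Rmax K 0).
    + apply dual_norm_le; [apply Rmax_r|]. intros x. eapply Rle_trans; [apply Hb|].
      apply Rmult_le_compat_r; [apply vnorm_ge0|apply Rmax_l].
    + apply Rmax_lub_lt; auto.
  - intros H. exists (vnorm (vsub f g)). split; auto. intros x. apply ev_bound.
Qed.

Definition epi (h : bifun X) : X -> DualB X -> R -> Prop :=
  fun x f r => Rbar_le (h x (ev f)) (Fin r).

Lemma epi_is_upward h : epi_upward (epi h).
Proof. intros y g r s H Hrs. eapply Rbar_le_trans; [exact H|exact Hrs]. Qed.

Lemma convexf_epi h : convexf h <-> epi_convex (epi h).
Proof.
  split.
  - intros H y1 g1 r1 y2 g2 r2 l Hl H1 H2.
    apply (H y1 (ev g1) y2 (ev g2)); auto; apply ev_dual.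
  - intros H y1 g1 y2 g2 r1 r2 l Hg1 Hg2 Hl H1 H2.
    destruct (mk_dual g1 Hg1) as [G1 <-], (mk_dual g2 Hg2) as [G2 <-].
    apply (H y1 G1 r1 y2 G2 r2 l Hl H1 H2).
Qed.

Lemma norm_lsc_epi h : norm_lsc h <-> epi_closed (epi h).
Proof.
  split.
  - intros H x f r Hcl. apply NNPP. intros Hno.
    assert (Hr1 : exists r1, r < r1 /\ Rbar_lt (Fin r1) (h x (ev f))).
    { unfold epi in Hno. destruct (h x (ev f)) as [t| |]; simpl in Hno; [|exists (r + 1)|tauto].
      - exists ((r + t) / 2). split; [lra|]. apply Rbar_nle_lt. simpl. lra.
      - split; [lra|]. apply Rbar_nle_lt. simpl. tauto. }
    destruct Hr1 as (r1 & Hr1 & Hlt).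
    destruct (H x (ev f) r1 (ev_dual f) Hlt) as (eps & He & Hnear).
    destruct (Hcl (Rmin eps (r1 - r))) as (y & g & s & Hy & H1 & H2 & H3).
    { apply Rmin_glb_lt; lra. }
    pose proof (Rmin_l eps (r1 - r)). pose proof (Rmin_r eps (r1 - r)).
    apply (Rbar_lt_nle r1 (h y (ev g))).
    + apply Hnear; [apply ev_dual|lra|]. apply dball_norm; lra.
    + apply (epi_is_upward h y g s r1 Hy). apply Rabs_def2 in H3. lra.
  - intros H x f r Hf Hlt. destruct (mk_dual f Hf) as [F <-].
    apply NNPP. intros Hno. apply (Rbar_lt_nle _ _ Hlt). apply (H x F r).
    intros eps He. apply NNPP. intros Hno'. apply Hno. exists eps. split; auto.
    intros y g Hg Hy Hgf. apply Rbar_nle_lt. intros Hle. apply Hno'.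
    destruct (mk_dual g Hg) as [G <-]. exists y, G, r. split; auto. split; auto.
    split; [apply dball_norm; auto|]. rewrite Rminus_diag, Rabs_R0. auto.
Qed.

Lemma above_epi h :
  (forall x f, is_dual f -> Rbar_le (Fin (f x)) (h x f)) <-> above_coupling (epi h).
Proof.
  split.
  - intros H y g r Hy. apply (Rbar_le_trans _ _ _ (H y (ev g) (ev_dual g)) Hy).
  - intros H x f Hf. destruct (mk_dual f Hf) as [F <-]. apply Rbar_le_ge_real.
    intros s Hs. apply (H x F s Hs).
Qed.

Lemma conjf_le h f P p c : represents P p ->
  Rbar_le (conjf h (ev f) p) (Fin c) <-> conj_le (epi h) f P c.
Proof.
  intros HP. unfold conjf.
  match goal with |- Rbar_le (Rbar_sup ?E) _ <-> _ => destruct (Rbar_sup_spec E) as [H1 H2] end.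
  split.
  - intros Hle y g r Hy. rewrite HP.
    assert (Hel : Rbar_le (Rbar_rminus (ev f y + p (ev g)) (h y (ev g))) (Fin c)).
    { eapply Rbar_le_trans; [apply H1|exact Hle]. exists y, (ev g). split; auto. apply ev_dual. }
    unfold epi in Hy. destruct (h y (ev g)); simpl in *; try tauto. lra.
  - intros Hc. apply H2. intros e (x & g & Hg & ->).
    destruct (mk_dual g Hg) as [G <-]. specialize (Hc x G). rewrite HP in Hc. unfold epi in Hc.
    destruct (h x (ev G)) as [r| |]; simpl in *; auto.
    + apply Hc. lra.
    (* Where [h] is [MInf] every real is admissible, and this one violates the bound. *)
    + specialize (Hc (ev f x + p (ev G) - c - 1) I). lra.
Qed.

Lemma conj_above_epi h :
  (forall f p, is_dual f -> is_bidual p -> Rbar_le (Fin (p f)) (conjf h f p)) <->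
  conj_above_coupling (epi h).
Proof.
  split.
  - intros H f P eta He. apply NNPP. intros Hno.
    pose proof (represents_raw P) as HP.
    assert (Hc : conj_le (epi h) f P (ev P f - eta)).
    { intros y g r Hy. apply Rnot_lt_le. intros Hlt. apply Hno. exists y, g, r. split; auto. lra. }
    apply (conjf_le h f P _ _ HP) in Hc.
    specialize (H (ev f) (raw P) (ev_dual f) (represented_bidual _ _ HP)).
    pose proof (Rbar_le_trans _ _ _ H Hc) as Hle. simpl in Hle. rewrite <- HP in Hle. lra.
  - intros H f p Hf Hp. destruct (mk_dual f Hf) as [F <-].
    destruct (bidual_represented p Hp) as [P HP].
    apply Rbar_le_ge_real. intros s Hs. apply (conjf_le h F P p s HP) in Hs.
    rewrite <- HP. apply Rle_eps. intros e He. destruct (H F P e He) as (y & g & r & Hy & Hle).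
    specialize (Hs y g r Hy). lra.
Qed.

Lemma strong_rep_epi h S : strong_rep h S ->
  epi_convex (epi h) /\ epi_closed (epi h) /\ above_coupling (epi h) /\ conj_above_coupling (epi h).
Proof.
  intros [(H1 & H2 & H3 & _) H4]. rewrite <- convexf_epi, <- norm_lsc_epi, <- above_epi, <- conj_above_epi.
  auto.
Qed.

Definition contact_graph (h : bifun X) (S : op X) : Prop :=
  forall x f, S x f <-> is_dual f /\ Rbar_le (h x f) (Fin (f x)).

Lemma contact_graph_ev h S x f : contact_graph h S -> S x (ev f) <-> contact (epi h) x f.
Proof.
  intros HS. rewrite (HS x (ev f)). unfold contact, epi. split; [tauto|]. split; auto. apply ev_dual.
Qed.

(** Contact points are related to each other, so the contact set is a monotone extension of [S], and
    maximality gives equality. *)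
Lemma maximal_contact_graph h S : strong_rep h S -> maximal_monotone S -> contact_graph h S.
Proof.
  intros Hh [[Hop Hmon] Hmax].
  destruct (strong_rep_epi h S Hh) as (H1 & H2 & H3 & H4).
  intros x f. split.
  - intros Hx. split; [apply (Hop x f Hx)|]. destruct Hh as [(_ & _ & _ & H) _].
    rewrite (H x f Hx). apply Rbar_le_refl.
  - intros Hx. apply (Hmax (fun x f => is_dual f /\ Rbar_le (h x f) (Fin (f x)))); auto.
    + split; [intros y g Hy; apply Hy|].
      intros y1 g1 y2 g2 [Hg1 Hy1] [Hg2 Hy2].
      destruct (mk_dual g1 Hg1) as [G1 <-], (mk_dual g2 Hg2) as [G2 <-].
      pose proof (contact_related (epi h) H1 H3 y1 G1 Hy1 y2 G2 Hy2) as H. rewrite !ev_J in H. lin. lra.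
    + intros y g Hy. split; [apply (Hop y g Hy)|]. destruct Hh as [(_ & _ & _ & H) _].
      rewrite (H y g Hy). apply Rbar_le_refl.
Qed.

Lemma gossez_related h S P p f : contact_graph h S -> represents P p ->
  gossez S p (ev f) <-> related (epi h) P f.
Proof.
  intros HS HP. split.
  - intros (_ & _ & H) y g Hy. specialize (H y (ev g) (proj2 (contact_graph_ev h S y g HS) Hy)).
    rewrite dsub_ev, <- HP in H. linin H. lra.
  - intros H. split; [apply (represented_bidual P p HP)|]. split; [apply ev_dual|].
    intros y g Hy. destruct (mk_dual g (proj1 (proj1 (HS y g) Hy))) as [G <-].
    apply (contact_graph_ev h S y G HS) in Hy. specialize (H y G Hy).
    rewrite dsub_ev, <- HP. lin. lra.
Qed.

Lemma strong_contact_typeD h S : strong_rep h S -> contact_graph h S -> typeD S.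
Proof.
  intros Hh HS. destruct (strong_rep_epi h S Hh) as (H1 & H2 & H3 & H4).
  split; [split; [split|]|].
  - intros x f Hx. apply (proj1 (HS x f) Hx).
  - intros y1 g1 y2 g2 Hy1 Hy2.
    destruct (mk_dual g1 (proj1 (proj1 (HS _ _) Hy1))) as [G1 <-].
    destruct (mk_dual g2 (proj1 (proj1 (HS _ _) Hy2))) as [G2 <-].
    apply (contact_graph_ev h S _ _ HS) in Hy1. apply (contact_graph_ev h S _ _ HS) in Hy2.
    pose proof (contact_related (epi h) H1 H3 y1 G1 Hy1 y2 G2 Hy2) as H. rewrite !ev_J in H. lin. lra.
  - intros S' [Hop Hmon] Hsub x f Hx. destruct (mk_dual f (Hop x f Hx)) as [F <-].
    apply (contact_graph_ev h S _ _ HS).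
    apply (related_contact (epi h) H1 H2 H3 H4). intros y g Hy.
    apply (contact_graph_ev h S _ _ HS) in Hy. specialize (Hmon _ _ _ _ Hx (Hsub _ _ Hy)).
    linin Hmon. rewrite !ev_J. lra.
  - intros p f Hpf. destruct (mk_dual f (proj1 (proj2 Hpf))) as [F <-].
    destruct (bidual_represented p (proj1 Hpf)) as [P HP].
    apply (gossez_related h S P p F HS HP) in Hpf.
    (* An index is a finite list of functionals with a precision [/ (n + 1)]; it selects a contact
       point that is this close to [(P, F)] on the list. *)
    pose (I := (list (DualB X) * nat)%type).
    pose (le := fun i j : I => incl (fst i) (fst j) /\ (snd i <= snd j)%nat).
    assert (Hd : forall n, 0 < / (INR n + 1)).
    { intros n. apply Rinv_0_lt_compat. pose proof (pos_INR n). lra. }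
    assert (Hex : forall i : I, exists t : X * DualB X, contact (epi h) (fst t) (snd t) /\
       vnorm (fst t) <= vnorm P + / (INR (snd i) + 1) /\
       vnorm (vsub (snd t) F) <= / (INR (snd i) + 1) /\
       Forall (fun w => Rabs (ev w (fst t) - ev P w) <= / (INR (snd i) + 1)) (fst i)).
    { intros [l n]. destruct (related_weak_approximation (epi h) H1 H2 H3 H4 P F l _ Hpf (Hd n))
        as (y & g & Hyg). exists (y, g). exact Hyg. }
    pose (t := fun i => proj1_sig (constructive_indefinite_description _ (Hex i))).
    assert (Ht : forall i, contact (epi h) (fst (t i)) (snd (t i)) /\
       vnorm (fst (t i)) <= vnorm P + / (INR (snd i) + 1) /\
       vnorm (vsub (snd (t i)) F) <= / (INR (snd i) + 1) /\
       Forall (fun w => Rabs (ev w (fst (t i)) - ev P w) <= / (INR (snd i) + 1)) (fst i)).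
    { intros i. unfold t. destruct constructive_indefinite_description. auto. }
    clearbody t.
    assert (Hle1 : forall n, / (INR n + 1) <= 1).
    { intros n. rewrite <- Rinv_1. apply Rinv_le_contravar; [lra|]. pose proof (pos_INR n). lra. }
    assert (Hsmall : forall eps, 0 < eps -> exists N, forall n, (N <= n)%nat -> / (INR n + 1) < eps).
    { intros eps He. destruct (INR_unbounded (/ eps)) as [N HN]. exists N. intros n Hn.
      apply le_INR in Hn. assert (0 < / eps) by (apply Rinv_0_lt_compat; auto).
      rewrite <- (Rinv_inv eps). apply Rinv_lt_contravar; [|lra].
      apply Rmult_lt_0_compat; lra. }
    exists I, le, (fun i => fst (t i)), (fun i => ev (snd (t i))).
    split; [|split; [|split; [|split]]].
    + split; [exact (inhabits (nil, 0%nat))|]. split; [|split].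
      * intros i. split; [apply incl_refl|apply le_n].
      * intros i j k [Ha Hb] [Hc He]. split; [eapply incl_tran; eauto|lia].
      * intros i j. exists (fst i ++ fst j, (snd i + snd j)%nat). unfold le; cbn [fst snd].
        split; (split; [|lia]); [apply incl_appl|apply incl_appr]; apply incl_refl.
    + intros i. apply (contact_graph_ev h S _ _ HS). apply Ht.
    + exists (vnorm P + vnorm F + 1). intros i. destruct (Ht i) as (_ & Hn & Hg & _).
      specialize (Hle1 (snd i)). pose proof (vnorm_ge0 P). pose proof (vnorm_ge0 F). split; [lra|].
      intros x. eapply Rle_trans; [apply ev_bound|]. apply Rmult_le_compat_r; [apply vnorm_ge0|].
      replace (snd (t i)) with (vadd (vsub (snd (t i)) F) F) by vec.
      eapply Rle_trans; [apply vnorm_tri|]. lra.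
    + intros g Hg eps He. destruct (mk_dual g Hg) as [G <-]. rewrite <- HP.
      destruct (Hsmall eps He) as [N HN]. exists (G :: nil, N). intros i [Hi1 Hi2]. cbn [fst snd] in *.
      destruct (Ht i) as (_ & _ & _ & HF). rewrite Forall_forall in HF.
      specialize (HF G (Hi1 G (or_introl eq_refl))). specialize (HN _ Hi2). lra.
    + intros eps He. destruct (Hsmall eps He) as [N HN]. exists (nil, N). intros i [_ Hi2].
      cbn [snd] in Hi2. apply dball_norm; auto. destruct (Ht i) as (_ & _ & Hg & _).
      specialize (HN _ Hi2). lra.
Qed.

End DualConversion.

(** * The generalized parallel sum *)

Section ParallelSum.
Context {X Y : Banach}.
Variables (A : X -> Y) (hA : lin_cont A).
Variables (S : op X) (T : op Y) (hS : bifun X) (hT : bifun Y).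
Hypothesis S_rep : strong_rep hS S.
Hypothesis T_rep : strong_rep hT T.
Notation At := (adjB A hA).
Notation Att := (biadjB A hA).
Notation hcl := (clf (infconv hS hT A)).

Let S_convex : epi_convex (epi hS). Proof. apply (strong_rep_epi hS S S_rep). Qed.
Let S_closed : epi_closed (epi hS). Proof. apply (strong_rep_epi hS S S_rep). Qed.
Let S_above : above_coupling (epi hS). Proof. apply (strong_rep_epi hS S S_rep). Qed.
Let S_conj : conj_above_coupling (epi hS). Proof. apply (strong_rep_epi hS S S_rep). Qed.
Let T_convex : epi_convex (epi hT). Proof. apply (strong_rep_epi hT T T_rep). Qed.
Let T_closed : epi_closed (epi hT). Proof. apply (strong_rep_epi hT T T_rep). Qed.
Let T_above : above_coupling (epi hT). Proof. apply (strong_rep_epi hT T T_rep). Qed.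
Let T_conj : conj_above_coupling (epi hT). Proof. apply (strong_rep_epi hT T T_rep). Qed.

Definition infconv_epi (x : X) (f : DualB X) (r : R) : Prop :=
  exists u w v a b, epi hS u (At v) a /\ epi hT (A w) v b /\
    x = vadd u w /\ f = At v /\ a + b <= r.

(** The infimum need not be attained, whence the slack [e]; the closure absorbs it afterwards. *)
Lemma infconv_le x f r :
  Rbar_le (infconv hS hT A x (ev f)) (Fin r) <-> forall e, 0 < e -> infconv_epi x f (r + e).
Proof.
  unfold infconv. rewrite Rbar_inf_le. split; intros H e He; specialize (H e He).
  - destruct H as (el & (u & w & v & Hv & Hx & Hf & ->) & Hle).
    destruct (mk_dual v Hv) as [V <-].
    assert (Ef : f = At V).
    { apply ev_ext. intros z. symmetry. apply Hf. }
    pose proof (proj2 (above_epi hS) S_above) as HS. pose proof (proj2 (above_epi hT) T_above) as HT.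
    destruct (Rbar_plus_le _ _ _ _ _ (HS u (ev f) (ev_dual f)) (HT (A w) (ev V) (ev_dual V)) Hle)
      as (a & b & Ha & Hb & Hab).
    exists u, w, V, a, b. rewrite <- Ef. auto.
  - destruct H as (u & w & v & a & b & Ha & Hb & -> & -> & Hab).
    exists (Rbar_plus (hS u (ev (At v))) (hT (A w) (ev v))). split.
    + exists u, w, (ev v). split; [apply ev_dual|]. auto.
    + apply (Rbar_plus_ge _ _ _ _ _ Ha Hb Hab).
Qed.

Lemma hcl_le x f r : epi hcl x f r <->
  forall eps, 0 < eps -> exists y g s, infconv_epi y g s /\
    vnorm (vsub y x) < eps /\ vnorm (vsub g f) < eps /\ Rabs (s - r) < eps.
Proof.
  unfold epi, clf. rewrite Rbar_inf_le. split.
  - intros H eps He. destruct (H (eps / 4) ltac:(lra)) as (el & (r' & -> & Hr') & Hle).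
    simpl in Hle. destruct (Hr' (eps / 4) ltac:(lra)) as (y & g & s & Hg & Hy & Hgf & Hs & Hinf).
    destruct (mk_dual g Hg) as [G <-]. apply dball_norm in Hgf; [|lra].
    destruct (proj1 (infconv_le y G s) Hinf (eps / 4) ltac:(lra))
      as (u & w & v & a & b & Ha & Hb & Hx & Hf & Hab).
    (* The outer infimum only gives [r' <= r + eps / 4], and [r'] may be far below [r]; the maximum
       lifts the value back to the neighbourhood of [r]. *)
    exists y, G, (Rmax (s + eps / 4) r). apply Rabs_def2 in Hs. split; [|split; [lra|split; [lra|]]].
    + exists u, w, v, a, b. repeat split; auto. pose proof (Rmax_l (s + eps / 4) r). lra.
    + unfold Rmax. destruct Rle_dec; apply Rabs_def1; lra.
  - intros H e He. exists (Fin r). split; [|simpl; lra]. exists r. split; auto.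
    intros eps Heps. destruct (H eps Heps) as (y & g & s & Hi & Hy & Hg & Hs).
    exists y, (ev g), s. split; [apply ev_dual|]. split; auto. split; [apply dball_norm; auto|].
    split; auto. apply infconv_le. intros e' He'.
    destruct Hi as (u & w & v & a & b & Ha & Hb & Hx & Hf & Hab).
    exists u, w, v, a, b. repeat split; auto. lra.
Qed.

Lemma infconv_epi_hcl x f r : infconv_epi x f r -> epi hcl x f r.
Proof.
  intros H. apply hcl_le. intros eps He. exists x, f, r. split; auto.
  unfold vsub. rewrite !vaddN, !vnorm_zero, Rminus_diag, Rabs_R0. auto.
Qed.

Lemma hcl_closed : epi_closed (epi hcl).
Proof.
  intros x f r H. apply hcl_le. intros eps He.
  destruct (H (eps / 2) ltac:(lra)) as (y & g & s & Hy & H1 & H2 & H3).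
  destruct (proj1 (hcl_le y g s) Hy (eps / 2) ltac:(lra)) as (y' & g' & s' & Hi & H1' & H2' & H3').
  exists y', g', s'. split; auto.
  pose proof (vnorm_sub_tri y' y x). pose proof (vnorm_sub_tri g' g f).
  apply Rabs_def2 in H3. apply Rabs_def2 in H3'. split; [lra|]. split; [lra|]. apply Rabs_def1; lra.
Qed.

Lemma infconv_epi_convex : epi_convex infconv_epi.
Proof.
  destruct hA as (Aadd & Ascal & _).
  intros x1 f1 r1 x2 f2 r2 l Hl (u1 & w1 & v1 & a1 & b1 & Ha1 & Hb1 & -> & -> & H1)
    (u2 & w2 & v2 & a2 & b2 & Ha2 & Hb2 & -> & -> & H2).
  exists (vadd (vscal l u1) (vscal (1 - l) u2)), (vadd (vscal l w1) (vscal (1 - l) w2)),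
    (vadd (vscal l v1) (vscal (1 - l) v2)), (l * a1 + (1 - l) * a2), (l * b1 + (1 - l) * b2).
  rewrite adjB_add, !adjB_scal, Aadd, !Ascal. repeat split.
  - apply S_convex; auto.
  - apply T_convex; auto.
  - vec.
  - apply (Rmult_le_compat_l l) in H1; [|lra]. apply (Rmult_le_compat_l (1 - l)) in H2; lra.
Qed.

Lemma hcl_convex : epi_convex (epi hcl).
Proof.
  intros x1 f1 r1 x2 f2 r2 l Hl H1 H2. apply hcl_le. intros eps He.
  destruct (proj1 (hcl_le _ _ _) H1 eps He) as (y1 & g1 & s1 & Hi1 & Hy1 & Hg1 & Hs1).
  destruct (proj1 (hcl_le _ _ _) H2 eps He) as (y2 & g2 & s2 & Hi2 & Hy2 & Hg2 & Hs2).
  do 3 eexists. split; [apply (infconv_epi_convex _ _ _ _ _ _ l Hl Hi1 Hi2)|].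
  assert (Hmix : forall s t, s < eps -> t < eps -> l * s + (1 - l) * t < eps).
  { intros s t Hs Ht. destruct (Rle_lt_or_eq_dec 0 l) as [Hl0|Hl0]; [lra| |subst l; lra].
    apply (Rmult_lt_compat_l l) in Hs; auto.
    apply Rlt_le in Ht. apply (Rmult_le_compat_l (1 - l)) in Ht; lra. }
  split; [|split].
  - replace (vsub (vadd (vscal l y1) (vscal (1 - l) y2)) (vadd (vscal l x1) (vscal (1 - l) x2)))
      with (vadd (vscal l (vsub y1 x1)) (vscal (1 - l) (vsub y2 x2))) by vec.
    eapply Rle_lt_trans; [apply vnorm_tri|]. rewrite !vnorm_scal_pos by lra. auto.
  - replace (vsub (vadd (vscal l g1) (vscal (1 - l) g2)) (vadd (vscal l f1) (vscal (1 - l) f2)))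
      with (vadd (vscal l (vsub g1 f1)) (vscal (1 - l) (vsub g2 f2))) by vec.
    eapply Rle_lt_trans; [apply vnorm_tri|]. rewrite !vnorm_scal_pos by lra. auto.
  - apply Rabs_def2 in Hs1. apply Rabs_def2 in Hs2.
    pose proof (Hmix (s1 - r1) (s2 - r2) ltac:(lra) ltac:(lra)).
    pose proof (Hmix (r1 - s1) (r2 - s2) ltac:(lra) ltac:(lra)).
    apply Rabs_def1; lra.
Qed.

Lemma hcl_above : above_coupling (epi hcl).
Proof.
  intros x f r H. apply Rle_eps. intros e He.
  destruct (ev_continuous f x (e / 2) ltac:(lra)) as (delta & Hd & Hcont).
  destruct (proj1 (hcl_le _ _ _) H (Rmin delta (e / 2))) as (y & g & s & Hi & Hy & Hg & Hs).
  { apply Rmin_glb_lt; lra. }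
  pose proof (Rmin_l delta (e / 2)). pose proof (Rmin_r delta (e / 2)).
  specialize (Hcont g y ltac:(lra) ltac:(lra)). apply Rabs_def2 in Hcont. apply Rabs_def2 in Hs.
  destruct Hi as (u & w & v & a & b & Ha & Hb & -> & -> & Hab).
  apply S_above in Ha. apply T_above in Hb. rewrite ev_addr, !ev_adjB in *. lra.
Qed.

(** Closure leaves the conjugate unchanged, because [<f, y> + <p, g> - r] is norm-continuous in
    [(y, g, r)]. *)
Lemma hcl_conj_le f p c :
  conj_le (epi hcl) f p c <-> infconv_conj_le A hA (epi hS) (epi hT) f p c.
Proof.
  split.
  - intros H u w v a b Ha Hb.
    specialize (H (vadd u w) (At v) (a + b)).
    assert (Hi : epi hcl (vadd u w) (At v) (a + b)).
    { apply infconv_epi_hcl. exists u, w, v, a, b. repeat split; auto; lra. }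
    specialize (H Hi). lra.
  - intros H x g r Hx. apply Rle_eps. intros e He.
    pose proof (vnorm_ge0 f). pose proof (vnorm_ge0 p).
    set (D := vnorm f + vnorm p + 1).
    assert (Hd : 0 < e / D) by (apply Rdiv_lt_0_compat; unfold D; lra).
    destruct (proj1 (hcl_le _ _ _) Hx (e / D) Hd) as (y & g' & s & Hi & Hy & Hg & Hs).
    destruct Hi as (u & w & v & a & b & Ha & Hb & -> & -> & Hab).
    specialize (H u w v a b Ha Hb).
    pose proof (ev_bound f (vsub (vadd u w) x)) as B1. apply Rabs_le_inv in B1.
    pose proof (ev_bound p (vsub (At v) g)) as B2. apply Rabs_le_inv in B2.
    assert (vnorm f * vnorm (vsub (vadd u w) x) <= vnorm f * (e / D)) by (apply Rmult_le_compat_l; lra).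
    assert (vnorm p * vnorm (vsub (At v) g) <= vnorm p * (e / D)) by (apply Rmult_le_compat_l; lra).
    apply Rabs_def2 in Hs.
    assert (HD : e / D * D = e) by (field; unfold D; lra).
    unfold D in HD at 2. linin B1. linin B2. linin H. lra.
Qed.

Section AttainedDuality.
Hypothesis S_graph : contact_graph hS S.
Hypothesis T_graph : contact_graph hT T.
Hypothesis duality : forall f p rho,
  infconv_conj_le A hA (epi hS) (epi hT) f p rho -> dual_attained A hA (epi hS) (epi hT) f p rho.

Lemma conj_ge (Z : Banach) (H : Z -> DualB Z -> R -> Prop) f p c :
  conj_above_coupling H -> conj_le H f p c -> ev p f <= c.
Proof.
  intros HH Hc. apply Rle_eps. intros e He. destruct (HH f p e He) as (y & g & r & Hy & Hle).
  specialize (Hc _ _ _ Hy). lra.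
Qed.

(** The bounds [h_S^* >= c] at [(f, q)] and [h_T^* >= c] at [(v, A^** (p - q))] add up to [<p, f>],
    since [A^* v = f]. *)
Lemma hcl_conj_above : conj_above_coupling (epi hcl).
Proof.
  intros f p eta He. apply NNPP. intros Hno.
  assert (Hc : conj_le (epi hcl) f p (ev p f - eta)).
  { intros y g r Hy. apply Rnot_lt_le. intros Hlt. apply Hno. exists y, g, r. split; auto. lra. }
  apply hcl_conj_le in Hc. apply duality in Hc. destruct Hc as (q & v & c1 & c2 & <- & H1 & H2 & H3).
  apply conj_ge in H1; auto. apply conj_ge in H2; auto. rewrite ev_biadjB, ev_subl in H2. lra.
Qed.

(** At a contact point the two dual terms sum to at most [<f, x>], while they are at least [<q, f>]
    and [<J x - q, f>], whose sum is [<f, x>]. Both are therefore equalities, which is relatedness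
    to [S] and to [T]; conversely relatedness bounds both conjugates, and these bounds add up. *)
Lemma par_sum_contact_graph : contact_graph hcl (par_sum S T A).
Proof.
  assert (Hmain : forall x F, contact (epi hcl) x F <->
    exists q v, At v = F /\ related (epi hS) q F /\ related (epi hT) (Att (vsub (J x) q)) v).
  { intros x F. split.
    - intros Hc. apply (contact_conj_le (epi hcl) hcl_convex hcl_above) in Hc.
      apply hcl_conj_le in Hc. apply duality in Hc. destruct Hc as (q & v & c1 & c2 & <- & H1 & H2 & H3).
      pose proof (conj_ge _ _ _ _ _ S_conj H1) as G1. pose proof (conj_ge _ _ _ _ _ T_conj H2) as G2.
      exists q, v. split; auto. rewrite ev_biadjB, ev_subl, ev_J in G2. split.
      + apply conj_le_related. replace (ev q (At v)) with c1 by lra. exact H1.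
      + apply conj_le_related. rewrite ev_biadjB, ev_subl, ev_J.
        replace (ev (At v) x - ev q (At v)) with c2 by lra. exact H2.
    - intros (q & v & <- & H1 & H2).
      apply (related_contact (epi hcl) hcl_convex hcl_closed hcl_above hcl_conj_above).
      apply conj_le_related. apply hcl_conj_le. intros u w v' a b Ha Hb.
      pose proof (related_conj_le (epi hS) S_convex S_closed S_above S_conj q (At v) H1 _ _ _ Ha) as G1.
      pose proof (related_conj_le (epi hT) T_convex T_closed T_above T_conj _ v H2 _ _ _ Hb) as G2.
      rewrite !ev_biadjB, !ev_subl, !ev_J in G2. rewrite ev_addr, !ev_J, !ev_adjB in *. lra. }
  intros x f. split.
  - intros (Hf & p & q & Hp & Hq & Hpq & HSp & g & HTg & Hg). split; auto.
    destruct (mk_dual f Hf) as [F <-]. apply (proj2 (Hmain x F)).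
    destruct (bidual_represented p Hp) as [P HP].
    destruct (mk_dual g (proj1 (proj2 HTg))) as [G <-].
    assert (EF : At G = F) by (apply ev_ext; exact Hg).
    exists P, G. split; auto. split.
    + apply (gossez_related hS S P p F S_graph HP). exact HSp.
    + apply (gossez_related hT T _ (biadj A q) G T_graph); auto.
      intros v. rewrite ev_biadjB, ev_subl, ev_J, HP. unfold biadj.
      specialize (Hpq (ev (At v)) (ev_dual _)). unfold Jc, badd in Hpq.
      change (adj A (ev v)) with (ev (At v)). lra.
  - intros [Hf Hle]. destruct (mk_dual f Hf) as [F <-].
    destruct (proj1 (Hmain x F) Hle) as (q & v & <- & H1 & H2).
    split; auto. exists (raw q), (raw (vsub (J x) q)).
    split; [apply (represented_bidual q), represents_raw|].
    split; [apply (represented_bidual (vsub (J x) q)), represents_raw|].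
    split; [|split].
    + intros g Hgd. destruct (mk_dual g Hgd) as [G <-]. unfold badd.
      rewrite <- !represents_raw, ev_subl, ev_J. unfold Jc. ring.
    + apply (gossez_related hS S q); auto. apply represents_raw.
    + exists (ev v). split; [|reflexivity].
      apply (gossez_related hT T (Att (vsub (J x) q))); auto.
      intros g. rewrite ev_biadjB. unfold biadj. change (adj A (ev g)) with (ev (At g)).
      apply represents_raw.
Qed.

Lemma par_sum_strong_rep : strong_rep hcl (par_sum S T A).
Proof.
  split; [split; [|split; [|split]]|].
  - apply convexf_epi, hcl_convex.
  - apply norm_lsc_epi, hcl_closed.
  - apply above_epi, hcl_above.
  - intros x f Hx. apply par_sum_contact_graph in Hx. destruct Hx as [Hf Hle].
    apply Rbar_le_antisym; auto. apply above_epi; auto. apply hcl_above.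
  - apply conj_above_epi, hcl_conj_above.
Qed.

End AttainedDuality.

Hypothesis qual : qual_nonempty hS hT A.

Lemma not_PInf_le a : a <> PInf -> exists r, Rbar_le a (Fin r).
Proof. destruct a as [r| |]; intros H; [exists r|congruence|exists 0]; simpl; auto; lra. Qed.

Lemma qual_feasible : exists u w v a b, epi hS u (At v) a /\ epi hT (A w) v b.
Proof.
  destruct qual as (y & g & f & [Hg Hy] & (u & Hf & Hu) & (w & ->) & _ & Hfg).
  destruct (mk_dual g Hg) as [G <-]. destruct (mk_dual f Hf) as [F <-].
  destruct (not_PInf_le _ Hy) as [b Hb]. destruct (not_PInf_le _ Hu) as [a Ha].
  exists u, w, G, a, b. split; auto.
  replace (At G) with F; auto. apply ev_ext. exact Hfg.
Qed.

(** A contact point [(y, g)] supplies the minorant with slopes [g] and [J y], and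
    [contact_negative_infimum] at the origin provides one. *)
Lemma epi_minorant (Z : Banach) (h : bifun Z) (U : op Z) :
  strong_rep h U -> exists u p c, conj_le (epi h) u p c.
Proof.
  intros HU. destruct (strong_rep_epi h U HU) as (H1 & H2 & H3 & H4).
  destruct (contact_negative_infimum (epi h) H1 H2 H3 H4 vzero vzero 1 Rlt_0_1) as (y & g & Hc & _).
  exists g, (J y), (ev g y). apply contact_conj_le; auto.
Qed.

(** [(f, f, A^** p, rho)] lies in the test set and, by [primal_bound_near], in the weak closure.
    Closedness gives an exact decomposition, whose [T] component is forced to be [A^** (p - q)]. *)
Lemma cond_b_duality f p rho : cond_b hS hT A ->
  infconv_conj_le A hA (epi hS) (epi hT) f p rho -> dual_attained A hA (epi hS) (epi hT) f p rho.
Proof.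
  intros Hb Hprim.
  assert (Hbi : is_bidual (biadj A (raw p))).
  { apply (represented_bidual (Att p)). intros g. rewrite ev_biadjB. unfold biadj.
    change (adj A (ev g)) with (ev (At g)). apply represents_raw. }
  assert (HW : cond_b_W A (ev f, ev f, biadj A (raw p), rho)).
  { split; [reflexivity|]. exists (raw p). split; [|intros g Hg; reflexivity].
    apply (represented_bidual p), represents_raw. }
  destruct (Hb (ev f, ev f, biadj A (raw p), rho)) as [Hcl _]; auto.
  { split; [apply ev_dual|]. split; [apply ev_dual|auto]. }
  destruct Hcl as [(uf & up & vf & vp & r & Huf & Hup & Hvf & Hvp & Hsum & Hq) _].
  { split; auto. intros xs1 xs2 gs eps He Hgs.
    destruct (primal_bound_near A hA (epi hS) (epi hT) S_convex S_closed (epi_is_upward hS)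
      T_convex T_closed (epi_is_upward hT) (epi_minorant _ _ _ S_rep) (epi_minorant _ _ _ T_rep)
      f p rho Hprim qual_feasible xs1 xs2 (map toD gs) eps He)
      as (uf & up & vf & vp & r & (c1 & c2 & H1 & H2 & H3) & N1 & N2 & N3 & N4).
    exists (ev uf), (adj A (ev vf)), (badd (biadj A (raw up)) (raw vp)), r.
    split; [|split; [|split; [|split]]]; auto.
    - exists (ev uf), (raw up), (ev vf), (raw vp), r.
      split; [apply ev_dual|]. split; [apply (represented_bidual up), represents_raw|].
      split; [apply ev_dual|]. split; [apply (represented_bidual vp), represents_raw|].
      split; [|repeat split; reflexivity].
      apply (Rbar_plus_ge _ _ r c1 c2); auto; apply (conjf_le _ _ _ _ _ (represents_raw _)); auto.
    - rewrite Forall_forall in *. intros g Hg. specialize (Hgs g Hg).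
      specialize (N3 (toD g) (in_map toD gs g Hg)).
      destruct (mk_dual g Hgs) as [G <-]. rewrite toD_ev in N3. unfold badd, biadj.
      change (adj A (ev G)) with (ev (At G)). rewrite <- !represents_raw. exact N3. }
  destruct Hq as (Hf1 & Hf2 & Hpq & <-).
  destruct (mk_dual uf Huf) as [U <-]. destruct (mk_dual vf Hvf) as [v <-].
  destruct (bidual_represented up Hup) as [q Hq]. destruct (bidual_represented vp Hvp) as [Q HQ].
  assert (EU : f = U) by (apply ev_ext; exact Hf1). subst U.
  assert (Ev : At v = f) by (apply ev_ext; intros x; symmetry; apply Hf2).
  assert (EQ : Q = Att (vsub p q)).
  { apply ev_ext. intros g. specialize (Hpq (ev g) (ev_dual g)). unfold badd, biadj in Hpq.
    change (adj A (ev g)) with (ev (At g)) in Hpq.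
    rewrite <- represents_raw, <- Hq, <- HQ in Hpq. rewrite ev_biadjB, ev_subl. lra. }
  destruct (Rbar_plus_le _ _ _ _ _ (proj2 S_rep (ev f) up (ev_dual f) Hup)
    (proj2 T_rep (ev v) vp (ev_dual v) Hvp) Hsum) as (c1 & c2 & H1 & H2 & H3).
  exists q, v, c1, c2. split; auto. rewrite <- EQ.
  split; [apply (conjf_le hS f q up c1 Hq); auto|].
  split; [apply (conjf_le hT v Q vp c2 HQ); auto|auto].
Qed.

(** * The interior condition and affine hulls of triples *)

Definition trip_of (z : ProdB (ProdB Y (DualB Y)) (DualB X)) : @trip X Y :=
  (p1 (p1 z), ev (p2 (p1 z)), ev (p2 z)).

Lemma trip_of_inj z1 z2 : trip_of z1 = trip_of z2 -> z1 = z2.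
Proof.
  intros H. injection H. intros H3 H2 H1.
  apply prod_ext; [apply prod_ext; auto|]; apply ev_ext; intros x; congruence.
Qed.

Lemma tadd_zero_r (z : @trip X Y) : tadd z tzero = z.
Proof.
  destruct z as [[y g] f]. unfold tadd, tzero. rewrite vadd0.
  f_equal; [f_equal|]; extensionality x; unfold dadd, dzero; ring.
Qed.
Lemma tadd_zero_l (z : @trip X Y) : tadd tzero z = z.
Proof.
  destruct z as [[y g] f]. unfold tadd, tzero. rewrite vadd0l.
  f_equal; [f_equal|]; extensionality x; unfold dadd, dzero; ring.
Qed.
Lemma tadd_assoc (a b c : @trip X Y) : tadd a (tadd b c) = tadd (tadd a b) c.
Proof.
  destruct a as [[y1 g1] f1], b as [[y2 g2] f2], c as [[y3 g3] f3]. unfold tadd. rewrite vaddA.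
  f_equal; [f_equal|]; extensionality x; unfold dadd; ring.
Qed.
Lemma tscal_zero c : tscal c (@tzero X Y) = tzero.
Proof.
  unfold tscal, tzero. rewrite vscal_zero.
  f_equal; [f_equal|]; extensionality x; unfold dscal, dzero; ring.
Qed.
Lemma tscal_add c (a b : @trip X Y) : tscal c (tadd a b) = tadd (tscal c a) (tscal c b).
Proof.
  destruct a as [[y1 g1] f1], b as [[y2 g2] f2]. unfold tscal, tadd. rewrite vscalDr.
  f_equal; [f_equal|]; extensionality x; unfold dscal, dadd; ring.
Qed.
Lemma tscal_scal c d (a : @trip X Y) : tscal c (tscal d a) = tscal (c * d) a.
Proof.
  destruct a as [[y1 g1] f1]. unfold tscal. rewrite vscalA.
  f_equal; [f_equal|]; extensionality x; unfold dscal; ring.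
Qed.
Lemma tscal_one (a : @trip X Y) : tscal 1 a = a.
Proof.
  destruct a as [[y1 g1] f1]. unfold tscal. rewrite vscal1.
  f_equal; [f_equal|]; extensionality x; unfold dscal; ring.
Qed.

Notation tsum l := (fold_right (fun q acc => tadd (tscal (fst q) (snd q)) acc) (@tzero X Y) l).
Notation wsum l := (fold_right (fun q acc => fst q + acc) 0 l).

Lemma tsum_app l1 l2 : tsum (l1 ++ l2) = tadd (tsum l1) (tsum l2).
Proof.
  induction l1 as [|q l IH]; cbn [app fold_right fst snd]; [symmetry; apply tadd_zero_l|].
  rewrite IH. apply tadd_assoc.
Qed.
Lemma wsum_app (l1 l2 : list (R * @trip X Y)) : wsum (l1 ++ l2) = wsum l1 + wsum l2.
Proof. induction l1 as [|q l IH]; simpl; [ring|]. rewrite IH. ring. Qed.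
Lemma tsum_scal c (l : list (R * @trip X Y)) :
  tsum (map (fun q => (c * fst q, snd q)) l) = tscal c (tsum l).
Proof.
  induction l as [|q l IH]; cbn [map]; cbn [app fold_right fst snd]; [symmetry; apply tscal_zero|].
  rewrite IH, tscal_add, tscal_scal. reflexivity.
Qed.
Lemma wsum_scal c (l : list (R * @trip X Y)) :
  wsum (map (fun q => (c * fst q, snd q)) l) = c * wsum l.
Proof. induction l as [|q l IH]; simpl; [ring|]. rewrite IH. ring. Qed.

Section AffineHull.
Variable D : @trip X Y -> Prop.
Hypothesis D_zero : D tzero.
Notation affD := (aff tadd tscal tzero D).

Lemma aff_mem z : D z -> affD z.
Proof.
  intros Hz. exists ((1, z) :: nil). split; [constructor; auto|]. split; [simpl; ring|].
  cbn [app fold_right fst snd]. rewrite tadd_zero_r, tscal_one. reflexivity.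
Qed.
(** As [D] contains 0, the total weight is corrected by a multiple of the zero triple; together with
    [aff_scal] this makes the affine hull a linear subspace. *)
Lemma aff_add z1 z2 : affD z1 -> affD z2 -> affD (tadd z1 z2).
Proof.
  intros (l1 & F1 & W1 & ->) (l2 & F2 & W2 & ->).
  exists (l1 ++ l2 ++ (-1, tzero) :: nil). split; [|split].
  - rewrite !Forall_app. split; auto.
  - rewrite !wsum_app, W1, W2. simpl. ring.
  - rewrite !tsum_app. f_equal. cbn [app fold_right fst snd]. rewrite tscal_zero, !tadd_zero_r. reflexivity.
Qed.
Lemma aff_scal c z : affD z -> affD (tscal c z).
Proof.
  intros (l & F & W & ->).
  exists (map (fun q => (c * fst q, snd q)) l ++ (1 - c, tzero) :: nil). split; [|split].
  - rewrite Forall_app. split; auto. rewrite Forall_map. exact F.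
  - rewrite wsum_app, wsum_scal, W. simpl. ring.
  - rewrite tsum_app, tsum_scal. cbn [app fold_right fst snd]. rewrite tscal_zero, !tadd_zero_r. reflexivity.
Qed.
(** Each point of [D] is its own difference with 0, so the directions tested by [icr] include the
    affine hull of [D]. *)
Lemma aff_diffset z : affD z -> aff tadd tscal tzero (diffset tadd tscal D) z.
Proof.
  intros (l & F & W & ->). exists l. split; [|split]; auto.
  eapply Forall_impl; [|exact F]. intros q Hq. exists (snd q), tzero.
  split; auto. split; auto. rewrite tscal_zero, tadd_zero_r. reflexivity.
Qed.
End AffineHull.

Lemma qual_set_zero : qual_set hS hT A tzero.
Proof.
  destruct qual as (y & g & f & Hy & Hu & (w & ->) & Hg & Hfg).
  exists (A w), g, f, w, g. split; auto. split; auto. split; auto.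
  unfold tzero, vsub. rewrite vaddN.
  f_equal; [f_equal|]; extensionality x; unfold dsub, dzero; [|rewrite Hfg]; ring.
Qed.

(** The affine hull of the qualification set serves as the closed subspace: its closedness is one
    half of [ic], and the algebraic interior gives the absorption property along it. *)
Lemma cond_a_duality f p rho : cond_a hS hT A ->
  infconv_conj_le A hA (epi hS) (epi hT) f p rho -> dual_attained A hA (epi hS) (epi hT) f p rho.
Proof.
  intros [Hclosed Hicr].
  pose proof qual_set_zero as D0.
  apply (interior_dual_attained A hA (epi hS) (epi hT) S_convex S_closed T_convex T_closed
    (fun z => aff tadd tscal tzero (qual_set hS hT A) (trip_of z))).
  - apply aff_mem. exact D0.
  - intros a b Ha Hb. apply (aff_add _ D0 _ _ Ha Hb).
  - intros r a Ha. apply (aff_scal _ D0 r _ Ha).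
  - intros z Hz. apply Hclosed.
    + split; apply ev_dual.
    + intros eps He. destruct (Hz eps He) as (w & Hw & Hn). exists (trip_of w). split; auto.
      rewrite !prod_norm in Hn. linin Hn.
      pose proof (vnorm_ge0 (vsub (p1 (p1 w)) (p1 (p1 z)))).
      pose proof (vnorm_ge0 (vsub (p2 (p1 w)) (p2 (p1 z)))).
      pose proof (vnorm_ge0 (vsub (p2 w) (p2 z))).
      split; [|split]; [lra|apply dball_norm; lra|apply dball_norm; lra].
  - intros u f' a y g b w v Ha Hb. apply aff_mem.
    exists y, (ev g), (ev f'), w, (ev v).
    split; [split; [apply ev_dual|intros E; unfold epi in Hb; rewrite E in Hb; exact Hb]|].
    split; [exists u; split; [apply ev_dual|intros E; unfold epi in Ha; rewrite E in Ha; exact Ha]|].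
    split; [apply ev_dual|]. unfold trip_of, feasible_shift. lin.
    rewrite <- !dsub_ev. reflexivity.
  - intros z Hz. destruct (Hicr (trip_of z) (aff_diffset _ D0 _ Hz)) as (d & Hd & Hlam).
    exists d. split; auto. intros lam Hl.
    destruct (Hlam lam Hl) as (y & g & f' & w & v & [Hg Hy] & (u & Hf & Hu) & Hv & E).
    destruct (mk_dual g Hg) as [G <-], (mk_dual f' Hf) as [F <-], (mk_dual v Hv) as [V <-].
    destruct (not_PInf_le _ Hy) as [b Hb]. destruct (not_PInf_le _ Hu) as [a Ha].
    exists u, F, a, y, G, b, w, V. split; auto. split; auto.
    apply trip_of_inj. rewrite tadd_zero_l in E.
    transitivity (tscal lam (trip_of z)); [|reflexivity]. rewrite E.
    unfold trip_of, feasible_shift. lin. rewrite <- !dsub_ev. reflexivity.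
Qed.

End ParallelSum.

Theorem theorem3p1 (X Y : Banach) (S : op X) (T : op Y)
  (hS : bifun X) (hT : bifun Y) (A : X -> Y) :
  nonzero_space X -> nonzero_space Y ->
  typeD S -> typeD T ->
  strong_rep hS S -> strong_rep hT T ->
  lin_cont A ->
  qual_nonempty hS hT A ->
  (cond_a hS hT A \/ cond_b hS hT A) ->
  strong_rep (clf (infconv hS hT A)) (par_sum S T A) /\ typeD (par_sum S T A).
Proof.
  intros _ _ HS HT S_rep T_rep hA Hqual Hcond.
  pose proof (maximal_contact_graph hS S S_rep (proj1 HS)) as S_graph.
  pose proof (maximal_contact_graph hT T T_rep (proj1 HT)) as T_graph.
  assert (duality : forall f p rho, infconv_conj_le A hA (epi hS) (epi hT) f p rho ->
    dual_attained A hA (epi hS) (epi hT) f p rho).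
  { intros f p rho Hprim. destruct Hcond as [Ha|Hb].
    - apply (cond_a_duality A hA S T hS hT S_rep T_rep Hqual f p rho Ha Hprim).
    - apply (cond_b_duality A hA S T hS hT S_rep T_rep Hqual f p rho Hb Hprim). }
  pose proof (par_sum_strong_rep A hA S T hS hT S_rep T_rep S_graph T_graph duality) as Hrep.
  split; auto.
  apply (strong_contact_typeD _ _ Hrep).
  apply (par_sum_contact_graph A hA S T hS hT S_rep T_rep S_graph T_graph duality).
Qed.
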